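(* Let $n\ge 1$, let $a,b\in\mathbb{R}^n$ with $a\neq b$, let $p\in(0,1)$, and let $\mu$ be the probability measure on $\mathbb{R}^n$ with Lebesgue density $$\mu(x)=p\,\gamma(x-a)+(1-p)\,\gamma(x-b).$$ Define $d:=|a-b|$, $m:=\min\{p,1-p\}$, and $r^*>0$ via the equality $Q_{m,d}(r^* )=\tfrac12$. Then the Cheeger constant of $\mu$ is given by the minimum $$h_\mu=\min_{r\in[0,r^*]}\bigl(\log Q_{m,d}\bigr)'(r).$$ If $\mathcal{O}\subset[0,r^*]$ is the set of minimizers (of $(\log Q_{m,d})'$ over $[0,r^*]$) and $\nu:=\frac{b-a}{|b-a|}$, then the following holds: (1) If $p\le\frac12$, then a Borel set $E\subseteq\mathbb{R}^n$ is a Cheeger set for $\mu$ if and only if $E=H^{-}_{a\cdot\nu+t,\nu}$ or $E=H^{+}_{a\cdot\nu+t,\nu}$ for some $t\in\mathcal{O}$. (2) If $p>\frac12$, then a Borel set $E\subseteq\mathbb{R}^n$ is a Cheeger set for $\mu$ if and only if $E=H^{-}_{-b\cdot\nu+t,-\nu}$ or $E=H^{+}_{-b\cdot\nu+t,-\nu}$ for some $t\in\mathcal{O}$. Here equality of Borel sets is meant up to $\mu$-null sets.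
   Context: $\gamma(x)=(2\pi)^{-n/2}e^{-|x|^2/2}$ is the standard Gaussian density on $\mathbb{R}^n$; $\Phi(x)=\frac{1}{\sqrt{2\pi}}\int_{-\infty}^x e^{-t^2/2}\,dt$ for $x\in\mathbb{R}$. For $\alpha\in[0,1]$, $\beta\ge0$, define $Q_{\alpha,\beta}:\mathbb{R}\to(0,\infty)$ by $Q_{\alpha,\beta}(x)=\alpha\Phi(x)+(1-\alpha)\Phi(x-\beta)$. $\mathcal{B}(\mathbb{R}^n)$ is the Borel $\sigma$-algebra. For a Borel probability measure $\mu$ on $\mathbb{R}^n$ and $A\in\mathcal{B}(\mathbb{R}^n)$, the lower Minkowski content is $\mu_+(A)=\liminf_{\varepsilon\to0}\frac{\mu(A^\varepsilon\setminus A)}{\varepsilon}$ ($\varepsilon>0$), where $A^\varepsilon=\{x\in\mathbb{R}^n:\mathrm{dist}(A,x)<\varepsilon\}$ is the open $\varepsilon$-neighborhood of $A$. The Cheeger constant of $\mu$ is $$h_\mu=\inf_{A\in\mathcal{B}(\mathbb{R}^n),\ 0<\mu(A)<1}\frac{\mu_+(A)}{\min\{\mu(A),1-\mu(A)\}}.$$ A set $S$ at which this infimum is attained is called a Cheeger set for $\mu$. For $c\in\mathbb{R}$ and a unit vector $\nu\in\mathbb{S}^{n-1}$: $H^-_{c,\nu}=\{x\in\mathbb{R}^n:x\cdot\nu<c\}$ and $H^+_{c,\nu}=\{x\in\mathbb{R}^n:x\cdot\nu>c\}$. Convention: whenever two Borel sets $A,B$ are said to satisfy $A=B$, equality is meant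 up to $\mu$-null sets, i.e. $\mu(A\Delta B)=0$.
   Formalization: In (1) and (2), ''E is a Cheeger set'' is read as ''E equals a Cheeger set up to a null set'' (a half-space plus a countable dense set has infinite Minkowski content, so the literal ''if'' fails); the half-spaces themselves are also shown to be Cheeger sets. *)

(* Defs.v *)
From HB Require Import structures.
From mathcomp Require Import all_boot all_order all_algebra.
From mathcomp Require Import all_classical all_reals all_analysis.

Set Implicit Arguments.
Unset Strict Implicit.
Unset Printing Implicit Defensive.

Import Order.TTheory GRing.Theory Num.Theory.
Import numFieldTopology.Exports numFieldNormedType.Exports.

Local Open Scope classical_set_scope.
Local Open Scope ring_scope.

(* The library's norm on row vectors is the sup norm: it induces the usual
   topology but not the Euclidean distance. *)
Section euclidean.
Context {R : realType} {n : nat}.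
Implicit Types (x y nu : 'rV[R]_n) (A : set 'rV[R]_n) (c e : R).

Definition dotr x y : R := \sum_(i < n) x 0 i * y 0 i.

Definition enorm x : R := Num.sqrt (dotr x x).

Definition dist_set A x : \bar R :=
  ereal_inf [set (enorm (x - y))%:E | y in A].

Definition nbhd_set A e : set 'rV[R]_n := [set x | (dist_set A x < e%:E)%E].

Definition halfspace_lt c nu : set 'rV[R]_n := [set x | dotr x nu < c].
Definition halfspace_gt c nu : set 'rV[R]_n := [set x | dotr x nu > c].

End euclidean.

Definition borelRn (R : realType) (n : nat) :=
  g_sigma_algebraType (@open 'rV[R]_n).

Section lebesgue.
Context {R : realType}.

Definition consRn n (z : measurableTypeR R * borelRn R n) : borelRn R n.+1 :=
  \row_(i < n.+1) (if unlift ord0 i is Some j then z.2 0 j else z.1).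

Definition unconsRn n (v : borelRn R n.+1) : measurableTypeR R * borelRn R n :=
  (v 0 ord0, \row_(j < n) v 0 (lift ord0 j)).

Lemma consRnK n : cancel (@consRn n) (@unconsRn n).
Proof.
move=> [x v]; rewrite /unconsRn /consRn mxE unlift_none; congr pair.
by apply/rowP => j; rewrite !mxE liftK.
Qed.

Let rat_ball n (c : 'rV[rat]_n * nat) : set 'rV[R]_n :=
  ball (map_mx ratr c.1 : 'rV[R]_n) (c.2.+1%:R^-1 : R).

Lemma open_rational_balls n (U : set 'rV[R]_n) : open U ->
  U = \bigcup_(c : 'rV[rat]_n * nat)
    (if pselect (rat_ball c `<=` U) then rat_ball c else set0).
Proof.
move=> oU; apply/seteqP; split => [x Ux|x [[q k] _ /=]]; last first.
  by case: pselect => //= qU; exact: qU.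
have /nbhs_ballP[e /= e0 xeU] : nbhs x U by exact: open_nbhs_nbhs.
have [k ke] : exists k, k.+1%:R^-1 < e / 2.
  have e20 : 0 < e / 2 by rewrite divr_gt0.
  by have [k _ /(_ k (leqnn k))] := near_infty_natSinv_lt (PosNum e20); exists k.
have rk : 0 < (k.+1%:R^-1 : R) by rewrite invr_gt0.
have /= /choice[q qx] (j : 'I_n) :
    exists q : rat, `|x 0 j - ratr q| < (k.+1%:R^-1 : R).
  have [|q] := @rat_in_itvoo R (x 0 j - k.+1%:R^-1) (x 0 j).
    by rewrite ltrBlDr ltrDl.
  rewrite in_itv/= => /andP[h1 h2]; exists q.
  by rewrite ger0_norm ?subr_ge0 1?ltW// ltrBlDr addrC -ltrBlDr.
have xq : rat_ball (\row_j q j, k) x.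
  split => // i j; rewrite ord1 !mxE /ball/= distrC; exact: qx.
exists (\row_j q j, k) => //=; case: pselect => //= -[] y qy.
apply: xeU; apply: (@le_ball _ _ _ (k.+1%:R^-1 + k.+1%:R^-1)).
  by rewrite [leRHS]splitr lerD// ltW.
exact: (ball_triangle (ball_sym xq) qy).
Qed.

Lemma measurable_consRn n : measurable_fun setT (@consRn n).
Proof.
apply: (measurability _ (erefl :
  @measurable _ (borelRn R n.+1) = <<s @open 'rV[R]_n.+1 >>)) => _ [U oU <-].
rewrite setTI (open_rational_balls oU) preimage_bigcup.
apply: countable_bigcupT_measurable => // -[q k] /=.
case: pselect => //= _; last by rewrite preimage_set0.
have rk : 0 < (k.+1%:R^-1 : R) by rewrite invr_gt0.
rewrite [X in measurable X](_ : _ =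
    (ball (ratr (q 0 ord0) : R) k.+1%:R^-1) `*`
    rat_ball (\row_j q 0 (lift ord0 j), k)).
  apply: measurableX.
    by apply: measurable_realfun.open_measurable; exact: ball_open.
  by apply: sub_sigma_algebra; exact: ball_open.
apply/seteqP; split => -[x v] /=.
  move=> [_ h]; split; first by have := h 0 ord0; rewrite !mxE unlift_none.
  by split=> // i j; have := h 0 (lift ord0 j); rewrite ord1 !mxE liftK.
move=> [h1 [_ h2]]; split=> // i j; rewrite ord1 !mxE.
case: unliftP => [l|] ->//.
by have := h2 0 l; rewrite !mxE.
Qed.

Lemma measurable_unconsRn n : measurable_fun setT (@unconsRn n).
Proof.
apply: measurable_fun_pair.
  apply: (measurability _ (measurable_realfun.RGenOpens.measurableE R)).
  move=> _ [_ [x [y ->]] <-].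
  rewrite setTI; apply: sub_sigma_algebra.
  apply: open_comp; last exact: interval_open.
  by move=> v _; exact: coord_continuous.
apply: (measurability _ (erefl :
  @measurable _ (borelRn R n) = <<s @open 'rV[R]_n >>)) => _ [U oU <-].
rewrite setTI; apply: sub_sigma_algebra.
have : open ((fun v : 'rV[R]_n.+1 => (unconsRn v).2 : 'rV[R]_n) @^-1` U).
  rewrite openE => v Uv.
  have /nbhs_ballP[e /= e0 eU] : nbhs (unconsRn v).2 U by exact: open_nbhs_nbhs.
  apply/nbhs_ballP; exists e => //= w [_ vw]; apply: eU; split => // i j.
  by rewrite !mxE; exact: vw.
by [].
Qed.

Definition lebesgue_step n (m : {sigma_finite_measure set (borelRn R n) -> \bar R})
    : set (borelRn R n.+1) -> \bar R :=
  pushforward (lebesgue_measure \x m)%E (@consRn n).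

Section step.
Variables (n : nat) (m : {sigma_finite_measure set (borelRn R n) -> \bar R}).

Let step0 : lebesgue_step m set0 = 0%E.
Proof. by rewrite /lebesgue_step /pushforward preimage_set0 measure0. Qed.

Let step_ge0 A : (0 <= lebesgue_step m A)%E.
Proof. by rewrite /lebesgue_step /pushforward; exact: measure_ge0. Qed.

Let step_sigma_additive : semi_sigma_additive (lebesgue_step m).
Proof.
move=> F mF tF mUF; rewrite /lebesgue_step /pushforward preimage_bigcup.
apply: measure_semi_sigma_additive.
- by move=> k; rewrite -[X in measurable X]setTI; exact: measurable_consRn.
- apply/trivIsetP => /= i j _ _ ij; rewrite -preimage_setI.
  by move/trivIsetP : tF => /(_ _ _ _ _ ij) ->//; rewrite preimage_set0.
- rewrite -preimage_bigcup -[X in measurable X]setTI.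
  exact: measurable_consRn.
Qed.

HB.instance Definition _ := isMeasure.Build _ _ _ (lebesgue_step m)
  step0 step_ge0 step_sigma_additive.

Let step_sigma_finite : sigma_finite setT (lebesgue_step m).
Proof.
have /sigma_finiteP[F [TF ndF Foo]] :=
  @sigma_finiteT _ (measurableTypeR R) R lebesgue_measure.
have /sigma_finiteP[G [TG ndG Goo]] := sigma_finiteT m.
exists (fun k => @unconsRn n @^-1` (F k `*` G k)).
  rewrite -preimage_bigcup -[LHS](@preimage_setT _ _ (@unconsRn n)); congr preimage.
  rewrite -setXTT TF TG predeqE => -[x y]; split; last first.
    by move=> [k _ []/= ? ?]; split; exists k.
  move=> [/= [i _ Fix] [k _ Gky]]; exists (maxn i k) => //; split.
    by move: x Fix; exact/subsetPset/ndF/leq_maxl.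
  by move: y Gky; exact/subsetPset/ndG/leq_maxr.
move=> k; have [mF Fk] := Foo k; have [mG Gk] := Goo k; split.
  rewrite -[X in measurable X]setTI.
  by apply: measurable_unconsRn => //; exact: measurableX.
rewrite /lebesgue_step /pushforward -comp_preimage.
rewrite (_ : @unconsRn n \o @consRn n = id); last by apply/funext/consRnK.
by rewrite preimage_id product_measure1E// lte_mul_pinfty// ge0_fin_numE.
Qed.

HB.instance Definition _ := Measure_isSigmaFinite.Build _ _ _ (lebesgue_step m)
  step_sigma_finite.

End step.

Fixpoint lebesgue_Rn n : {sigma_finite_measure set (borelRn R n) -> \bar R} :=
  if n is k.+1 then lebesgue_step (lebesgue_Rn k)
  else \d_(0 : borelRn R 0).

Definition box n (F : 'I_n -> set R) : set (borelRn R n) :=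
  [set v | forall i, F i (v 0 i)].

Lemma lebesgue_Rn_box n (F : 'I_n -> set (measurableTypeR R)) :
  (forall i, measurable (F i)) ->
  measurable (box F) /\
  lebesgue_Rn n (box F) = (\prod_(i < n) lebesgue_measure (F i))%E.
Proof.
elim: n F => [|n IH] F mF.
  rewrite (_ : box F = setT); last by apply/seteqP; split=> // v _ [].
  by split; [exact: measurableT|rewrite big_ord0 /= diracE in_setT].
have [mG GE] := IH (fun j => F (lift ord0 j)) (fun j => mF _).
have FE : box F = @unconsRn n @^-1`
    (F ord0 `*` box (fun j => F (lift ord0 j))).
  apply/seteqP; split=> v /=.
    by move=> h; split=> // j; rewrite mxE; exact: h.
  move=> [h0 h] i; case: (unliftP ord0 i) => [j|] -> //.
  by have := h j; rewrite mxE.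
rewrite FE; split.
  rewrite -[X in measurable X]setTI.
  by apply: measurable_unconsRn => //; exact: measurableX.
rewrite /= /lebesgue_step /pushforward -comp_preimage.
rewrite (_ : @unconsRn n \o @consRn n = id); last by apply/funext/consRnK.
by rewrite preimage_id product_measure1E// GE big_ord_recl.
Qed.

End lebesgue.

Section cheeger.
Context {R : realType} {n : nat}.
Implicit Types (mu : probability (borelRn R n) R) (A B S E : set (borelRn R n)).
Local Open Scope ereal_scope.

Definition minkowski_content mu A : \bar R :=
  limf_einf (fun e : R => mu (nbhd_set A e `\` A) / e%:E) 0%R^'+.

Definition cheeger_ratio mu A : \bar R :=
  minkowski_content mu A / mine (mu A) (1 - mu A).

Definition admissible mu A := [/\ measurable A, 0 < mu A & mu A < 1].

Definition cheeger_constant mu : \bar R :=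
  ereal_inf [set cheeger_ratio mu A | A in admissible mu].

Definition cheeger_set mu S :=
  admissible mu S /\ cheeger_ratio mu S = cheeger_constant mu.

Definition eq_mod0 mu A B := mu (A `+` B) = 0.

(* The lower Minkowski content is not invariant under modification by null sets
   (adding a dense countable set to a half-space makes it infinite), so a
   characterization of Cheeger sets up to null sets has to be read for classes:
   E has to agree with a Cheeger set up to a null set. *)
Definition cheeger_set_mod0 mu E :=
  exists2 S, cheeger_set mu S & eq_mod0 mu E S.

End cheeger.

Section gaussian.
Context {R : realType}.

Definition gauss_density {n} (x : 'rV[R]_n) : R :=
  (2 * pi) `^ (- (n%:R / 2)) * expR (- (enorm x ^+ 2 / 2)).

Definition Phi (x : R) : R := (Num.sqrt (2 * pi))^-1 *
  \int[@lebesgue_measure R]_(t in `]-oo, x]) expR (- (t ^+ 2 / 2)).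

Definition Qfun (alpha beta x : R) : R :=
  alpha * Phi x + (1 - alpha) * Phi (x - beta).

Definition dlogQ (alpha beta : R) : R -> R :=
  derive1 (fun x => ln (Qfun alpha beta x)).

Definition minimizers (f : R -> R) (r : R) : set R :=
  [set t | t \in `[0, r] /\ forall s, s \in `[0, r] -> f t <= f s].

End gaussian.

(* Main.v *)
Require Import Defs.
From HB Require Import structures.
From mathcomp Require Import all_boot all_order all_algebra.
From mathcomp Require Import all_classical all_reals all_analysis.
From mathcomp Require Import measurable_realfun.
From mathcomp Require Import ring lra.

(* By Gaussian isoperimetry, enlarging A moves iPhi (gamma_a A) and iPhi (gamma_b A)
   (iPhi the inverse of Phi) up by at least the size of the enlargement.  With
   x = iPhi (gamma_a A), y = iPhi (gamma_b A) the content of A is therefore at least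
   p phi(x) + (1 - p) phi(y), while its measure is p Phi(x) + (1 - p) Phi(y).  The
   Neyman-Pearson lemma gives |x - y| <= d, with equality only for half-spaces
   orthogonal to b - a, for which the content bound is an equality as well.  On a level
   line of the measure, the content bound is least at the ends |x - y| = d, which
   leaves the two functions (log Q_{p,d})' and (log Q_{1-p,d})'; for p <= 1/2 and
   measure at most 1/2 the second one never wins, except by a tie at measure 1/2.

   Gaussian isoperimetry is obtained from a comparison of random walks: if
   V x >= U x' + sqrt (E - |x - x'|^2) for all x, x', then the same inequality holds
   between the averages of U and V, taken in the scale Phi.  It is proved for one
   symmetric two-point step, iterated to the Gaussian law of the line by the central
   limit theorem, and tensorized. *)
Set Implicit Arguments.
Unset Strict Implicit.
Unset Printing Implicit Defensive.

Import Order.TTheory GRing.Theory Num.Theory.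
Import numFieldTopology.Exports numFieldNormedType.Exports.

Local Open Scope classical_set_scope.
Local Open Scope ring_scope.

(** The term [E - |x - x'|^2] is chosen because it splits over coordinates: fixing the first
    coordinates of two points only lowers [E]. A set enters through functions with values near [L]
    on it and [- L] away from it. For such functions the condition must become void when [x] and
    [x'] are far apart, and its curvature must stay bounded; the square root offers neither. Hence
    [gprofile], which is affine below [l ^+ 2] and eventually less than [- (2 * L)]. In one step of
    length [t] the terms of order [t ^+ 2] cancel, so about [t ^- 2] steps leave an error of order
    [t]. The condition divides by the variance still to come, so the walk is stopped at variance
    [1 - tau], and the missing [tau] is paid for by the Lipschitz bound on the functions. On the
    line, the interval [[0, rs]] arises because a level reached at a negative argument always loses:
    there [gphi / Phi] is at least [2 * gphi 0], which bounds the value at [rs]. The heavier weight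
    [1 - p] is excluded by comparing with the value at the median, where both weights agree by
    reflection. *)

Section monotone.
Context {R : realType}.
Implicit Types f df : R -> R.

Lemma is_derive_continuous f x l : is_derive x (1:R) f l -> {for x, continuous f}.
Proof. by move=> [fx _]; exact/differentiable_continuous/derivable1_diffP. Qed.

Lemma is_derive_mvt f df (a b : R) : a < b ->
  (forall x, a <= x <= b -> is_derive x 1 f (df x)) ->
  exists c, [/\ a < c, c < b & f b - f a = df c * (b - a)].
Proof.
move=> ab fdf; have [|//|c] := @MVT R f df a b ab.
  by move=> x; rewrite in_itv/= => /andP[ax xb]; apply: fdf; rewrite !ltW.
  apply: derivable_within_continuous => x; rewrite in_itv/= => xab.
  by have [] := fdf _ xab.
by rewrite in_itv/= => /andP[ac cb] fE; exists c.
Qed.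

Lemma is_derive_le f df (a b : R) : a <= b ->
  (forall x, a <= x <= b -> is_derive x 1 f (df x)) ->
  (forall x, a < x < b -> 0 <= df x) -> f a <= f b.
Proof.
rewrite le_eqVlt => /predU1P[->//|ab] fdf df0.
have [c [ac cb fE]] := is_derive_mvt ab fdf.
rewrite -subr_ge0 fE; apply: mulr_ge0; last by rewrite subr_ge0 ltW.
by apply: df0; rewrite ac cb.
Qed.

Lemma is_derive_lt f df (a b : R) : a < b ->
  (forall x, a <= x <= b -> is_derive x 1 f (df x)) ->
  (forall x, a < x < b -> 0 < df x) -> f a < f b.
Proof.
move=> ab fdf df0; have [c [ac cb fE]] := is_derive_mvt ab fdf.
rewrite -subr_gt0 fE; apply: mulr_gt0; last by rewrite subr_gt0.
by apply: df0; rewrite ac cb.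
Qed.

Lemma is_derive_lipschitz f df (K a b : R) :
  (forall x : R, is_derive x 1 f (df x)) -> (forall x, `|df x| <= K) ->
  `|f a - f b| <= K * `|a - b|.
Proof.
move=> fdf dfK; wlog ab : a b / a < b => [H|].
  have [|ba|->] := ltgtP a b; first exact: H.
    by rewrite distrC [in leRHS]distrC; exact: H.
  by rewrite !subrr normr0 mulr0.
have [c [_ _ fE]] := is_derive_mvt ab (fun x _ => fdf x).
by rewrite distrC fE normrM [in leRHS]distrC ler_wpM2r.
Qed.

End monotone.

(** * The standard normal density, its distribution function and the inverse [iPhi] *)

Section gaussian_line.
Context {R : realType}.
Implicit Types x y : R.

Definition gphi x : R := (Num.sqrt (2 * pi))^-1 * expR (- (x ^+ 2 / 2)).

Let sqrt2pi_gt0 : 0 < (Num.sqrt (2 * pi))^-1 :> R.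
Proof. by rewrite invr_gt0 sqrtr_gt0 mulr_gt0// pi_gt0. Qed.

Lemma gphi_gt0 x : 0 < gphi x.
Proof. by rewrite mulr_gt0// expR_gt0. Qed.

Lemma gphiN x : gphi (- x) = gphi x.
Proof. by rewrite /gphi sqrrN. Qed.

Lemma le_gphi x y : y ^+ 2 <= x ^+ 2 -> gphi x <= gphi y.
Proof. by move=> xy; rewrite ler_pM2l// ler_expR lerN2 ler_pM2r. Qed.

Lemma gphi_le1 x : gphi x <= 1.
Proof.
rewrite /gphi mulr_ile1 ?expR_ge0 ?invr_ge0 ?sqrtr_ge0//.
  rewrite -[leRHS]invr1 lef_pV2 ?posrE//; last by rewrite -invr_gt0.
  rewrite -[leLHS]sqrtr1 ler_wsqrtr//.
  by have := @pi_ge2 R; lra.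
by rewrite -[leRHS]expR0 ler_expR oppr_le0 divr_ge0// sqr_ge0.
Qed.

Lemma normal_pdf1E m x : normal_pdf m 1 x = gphi (x - m).
Proof.
rewrite normal_pdfE ?oner_eq0// /normal_peak /normal_fun /gphi !expr1n mul1r.
by rewrite -mulr_natl mulNr; congr (_ * expR (- (_ / _))).
Qed.

#[global] Instance is_derive_gphi x : is_derive x 1 gphi (- x * gphi x).
Proof.
rewrite /gphi; apply: is_derive_eq.
by rewrite /GRing.scale/=; move: (_^-1) (expR _) => c e; field.
Qed.

Lemma continuous_gphi : continuous gphi.
Proof. by move=> x; exact: is_derive_continuous. Qed.

Lemma gphi_lipschitz x y : `|gphi x - gphi y| <= `|x - y|.
Proof.
rewrite -[leRHS]mul1r.
apply: (@is_derive_lipschitz _ _ (fun x => - x * gphi x)) => z.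
rewrite normrM normrN [X in _ * X]ger0_norm ?(ltW (gphi_gt0 _))//.
have c1 : (Num.sqrt (2 * pi))^-1 <= 1 :> R.
  by have := gphi_le1 0; rewrite /gphi expr0n mul0r oppr0 expR0 mulr1.
rewrite /gphi mulrCA mulr_ile1 ?invr_ge0 ?sqrtr_ge0//.
rewrite expRN ler_pdivrMr ?expR_gt0// mul1r.
apply: le_trans (expR_ge1Dx _).
rewrite -[z ^+ 2]real_normK ?num_real//; have := sqr_ge0 (`|z| - 1).
by rewrite sqrrB; nra.
Qed.

Let integrable_gexp D : measurable D ->
  lebesgue_measure.-integrable D (EFin \o (fun t : R => expR (- (t ^+ 2 / 2)))).
Proof.
move=> mD; have -> : (fun t : R => expR (- (t ^+ 2 / 2))) =
    (fun t => Num.sqrt (2 * pi) * normal_pdf 0 1 t).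
  apply/funext => t; rewrite normal_pdf1E subr0 /gphi mulrA divff ?mul1r//.
  by rewrite gt_eqF// sqrtr_gt0 mulr_gt0// pi_gt0.
apply: (@integrableS _ _ _ _ setT) => //.
exact: (integrableZl measurableT (Num.sqrt (2 * pi)) (@integrable_normal_pdf R 0 1)).
Qed.

Let integrable_gphi D : measurable D ->
  lebesgue_measure.-integrable D (EFin \o gphi).
Proof.
move=> mD; exact: (integrableZl mD (Num.sqrt (2 * pi))^-1 (integrable_gexp mD)).
Qed.

Lemma PhiE x : Phi x = \int[@lebesgue_measure R]_(t in `]-oo, x]) gphi t.
Proof. by rewrite /Phi -RintegralZl//; exact: integrable_gexp. Qed.

Lemma EFin_Phi x : (Phi x)%:E = normal_prob 0 1 `]-oo, x].
Proof.
rewrite PhiE /normal_prob /Rintegral fineK; last first.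
  by apply: integrable_fin_num => //; exact: integrable_gphi.
by apply: eq_integral => t _; rewrite normal_pdf1E subr0.
Qed.

#[global] Instance is_derive_Phi x : is_derive x 1 (@Phi R) (gphi x).
Proof.
have PhiF : @Phi R = fun x => \int[@lebesgue_measure R]_(t in `]-oo, x]) normal_pdf 0 1 t.
  apply/funext => y; rewrite PhiE; apply: eq_Rintegral => t _.
  by rewrite normal_pdf1E subr0.
have cpdf : continuous (normal_pdf 0 1 : R -> R).
  by apply: continuous_normal_pdf; exact: oner_neq0.
rewrite PhiF; have [||dx dE] := @continuous_FTC1 R (normal_pdf 0 1) -oo%O x (x + 1) _ _
  (ltNyr _) (cpdf x).
- by rewrite ltrDl.
- apply: (@integrableS _ _ _ _ setT) => //.
  exact: integrable_normal_pdf.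
- by apply: DeriveDef; rewrite // -derive1E dE normal_pdf1E subr0.
Qed.

Lemma continuous_Phi : continuous (@Phi R).
Proof. by move=> x; exact: is_derive_continuous. Qed.

Lemma lt_Phi x y : x < y -> Phi x < Phi y.
Proof. by move=> xy; apply: is_derive_lt xy _ _ => // z _; exact: gphi_gt0. Qed.

Lemma Phi_mono : {mono @Phi R : x y / x <= y}.
Proof. by apply: le_mono; exact: lt_Phi. Qed.

Lemma Phi_lt_mono : {mono @Phi R : x y / x < y}.
Proof. exact: leW_mono Phi_mono. Qed.

Lemma Phi_inj : injective (@Phi R).
Proof. exact: inc_inj Phi_mono. Qed.

(** The identity seen as a random variable under the normal law, so that the general limits of
    distribution functions apply to [Phi]. *)
Let idTR : measurableTypeR R -> R := idfun.

#[local] HB.instance Definition _ :=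
  @isMeasurableFun.Build _ _ _ _ idTR (@measurable_id _ _ setT).

Let cdfE x :
  cdf (idTR : {RV (normal_prob 0 1 : probability (measurableTypeR R) R) >-> R}) x
  = (Phi x)%:E.
Proof. by rewrite EFin_Phi /cdf /distribution/= /pushforward preimage_id. Qed.

Lemma Phi_cvgy : Phi x @[x --> +oo] --> (1 : R).
Proof.
have := cvg_cdfy1
  (idTR : {RV (normal_prob 0 1 : probability (measurableTypeR R) R) >-> R}).
move=> /fine_cvgP[_]; rewrite (_ : fine \o _ = @Phi R)//.
by apply/funext => x; rewrite /comp cdfE.
Qed.

Lemma Phi_cvgNy : Phi x @[x --> -oo] --> (0 : R).
Proof.
have := cvg_cdfNy0
  (idTR : {RV (normal_prob 0 1 : probability (measurableTypeR R) R) >-> R}).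
move=> /fine_cvgP[_]; rewrite (_ : fine \o _ = @Phi R)//.
by apply/funext => x; rewrite /comp cdfE.
Qed.

Lemma Phi_lt1 x : Phi x < 1.
Proof.
rewrite ltNge; apply/negP => Px; near (+oo : set_system R) => y.
have : Phi y < Phi (x + 1).
  near: y; apply: (cvgr_lt _ Phi_cvgy).
  by apply: le_lt_trans Px _; rewrite Phi_lt_mono ltrDl.
by apply/negP; rewrite -leNgt Phi_mono; near: y; apply: nbhs_pinfty_ge; rewrite num_real.
Unshelve. all: by end_near. Qed.

Lemma Phi_gt0 x : 0 < Phi x.
Proof.
rewrite ltNge; apply/negP => Px; near (-oo : set_system R) => y.
have : Phi (x - 1) < Phi y.
  near: y; apply: (cvgr_gt _ Phi_cvgNy).
  by apply: lt_le_trans Px; rewrite Phi_lt_mono gtrBl.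
by apply/negP; rewrite -leNgt Phi_mono; near: y; apply: nbhs_ninfty_le; rewrite num_real.
Unshelve. all: by end_near. Qed.

Lemma exists_Phi_gt y : y < 1 -> exists x : R, y < Phi x.
Proof.
by move=> y1; near (+oo : set_system R) => x; exists x; near: x;
  exact: (cvgr_gt _ Phi_cvgy).
Unshelve. all: by end_near. Qed.

Lemma exists_Phi_lt y : 0 < y -> exists x : R, Phi x < y.
Proof.
by move=> y1; near (-oo : set_system R) => x; exists x; near: x;
  exact: (cvgr_lt _ Phi_cvgNy).
Unshelve. all: by end_near. Qed.

(* [Phi x + Phi (- x)] is constant, and tends to 1 at infinity. *)
Lemma PhiN x : Phi (- x) = 1 - Phi x.
Proof.
have dS (z : R) : is_derive z 1 (fun t => Phi t + Phi (- t)) 0.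
  apply: is_derive_eq; rewrite /GRing.scale/= gphiN; ring.
have SE y : Phi y + Phi (- y) = Phi x + Phi (- x).
  apply/eqP; rewrite -subr_eq0 -normr_le0.
  have := @is_derive_lipschitz _ _ _ 0 y x dS.
  by rewrite mul0r; apply => z; rewrite normr0.
have : Phi y + Phi (- y) @[y --> +oo] --> (1 + 0 : R).
  by apply: cvgD; [exact: Phi_cvgy|exact: (proj1 (cvgNy_compNP _ _) Phi_cvgNy)].
under eq_fun do rewrite SE.
move=> /(cvg_lim (@Rhausdorff R)).
by rewrite (cvg_lim (@Rhausdorff R) (cvg_cst _)) addr0; lra.
Qed.

Lemma Phi0 : Phi 0 = 2^-1 :> R.
Proof. by have := PhiN 0; rewrite oppr0; lra. Qed.

(** Outside the open unit interval [iPhi] takes the default value 0; every use first checks that its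
    argument lies strictly between 0 and 1. *)
Definition iPhi y : R := xget 0 [set x | Phi x = y].

Lemma PhiK : cancel (@Phi R) iPhi.
Proof.
move=> x; rewrite /iPhi; case: xgetP => [y _ /= /Phi_inj//|xN].
by case: (xN x).
Qed.

Lemma iPhiK y : 0 < y < 1 -> Phi (iPhi y) = y.
Proof.
move=> /andP[y0 y1]; rewrite /iPhi; case: xgetP => [x _ //|xN].
have [u Pu] := exists_Phi_lt y0; have [v Pv] := exists_Phi_gt y1.
have uv : u <= v by rewrite -Phi_mono ltW// (lt_trans Pu).
have [||c _ cE] := @IVT R (@Phi R) u v y uv.
- exact/continuous_subspaceT/continuous_Phi.
- have Puv : Phi u <= Phi v by rewrite Phi_mono.
  by rewrite (min_idPl Puv) (max_idPr Puv) !ltW.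
- by case: (xN c).
Qed.

Lemma Phi_lipschitz x y : `|Phi x - Phi y| <= `|x - y|.
Proof.
rewrite -[leRHS]mul1r; apply: (@is_derive_lipschitz _ _ gphi) => z.
by rewrite ger0_norm ?gphi_le1// (ltW (gphi_gt0 _)).
Qed.

Lemma is_derive_iPhi y : 0 < y < 1 -> is_derive y 1 iPhi (gphi (iPhi y))^-1.
Proof.
move=> y01; rewrite -{1}(iPhiK y01).
apply: (@is_derive_inverse _ (@Phi R)).
- by near=> x; exact: PhiK.
- by near=> x; exact: continuous_Phi.
- by rewrite gt_eqF// gphi_gt0.
Unshelve. all: by end_near. Qed.

End gaussian_line.

(** * Random walk comparison on the line *)

Section two_point.
Context {R : realType}.
Implicit Types u v z k M c b L : R.

(** The isoperimetric profile [gphi \o iPhi] has slope [- iPhi]. Thus [gphi z + k * Phi z] compares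
    the profile with its tangent at [Phi k], and its derivative changes sign only at [k]. *)
Lemma is_derive_gphi_Phi k z :
  is_derive z 1 (fun x => gphi x + k * Phi x) ((k - z) * gphi z).
Proof. by apply: is_derive_eq; rewrite /GRing.scale/=; ring. Qed.

Lemma le_gphi_Phi k u v : u <= v -> v <= k ->
  gphi u + k * Phi u <= gphi v + k * Phi v.
Proof.
move=> uv vk; apply: (is_derive_le uv (fun x _ => is_derive_gphi_Phi k x)).
by move=> x /andP[_ xv]; rewrite mulr_ge0 ?(ltW (gphi_gt0 _))//; lra.
Qed.

Lemma ge_gphi_Phi k u v : u <= v -> k <= u ->
  gphi v + k * Phi v <= gphi u + k * Phi u.
Proof.
move=> uv ku; have := @le_gphi_Phi (- k) (- v) (- u).
rewrite !gphiN !PhiN !lerN2 => /(_ uv ku); lra.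
Qed.

Lemma lt_gphi_Phi k u v : u < v -> v <= k ->
  gphi u + k * Phi u < gphi v + k * Phi v.
Proof.
move=> uv vk; apply: (is_derive_lt uv (fun x _ => is_derive_gphi_Phi k x)).
by move=> x /andP[_ xv]; rewrite mulr_gt0 ?gphi_gt0//; lra.
Qed.

Lemma gt_gphi_Phi k u v : u < v -> k <= u ->
  gphi v + k * Phi v < gphi u + k * Phi u.
Proof.
move=> uv ku; have := @lt_gphi_Phi (- k) (- v) (- u).
rewrite !gphiN !PhiN ltrN2 lerN2 => /(_ uv ku); lra.
Qed.

Lemma gphi_Phi_max k z : gphi z + k * Phi z <= gphi k + k * Phi k.
Proof.
by have [zk|/ltW kz] := leP z k; [exact: le_gphi_Phi|exact: ge_gphi_Phi].
Qed.

(** A converse to the tangent inequality, up to a quadratic term. With that term added, the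
    derivative has the sign of [x - M], because [gphi] is 1-Lipschitz. *)
Lemma gphi_Phi_lb M z b : `|z - M| <= b ->
  gphi M + M * Phi M - (gphi M + b) * (z - M) ^+ 2 / 2 <= gphi z + M * Phi z.
Proof.
move=> zMb.
pose h x := gphi x + M * Phi x + (gphi M + b) / 2 * (x - M) ^+ 2.
pose dh x := (x - M) * (gphi M + b - gphi x).
have hdh (x : R) : is_derive x 1 h (dh x).
  apply: is_derive_eq; rewrite /GRing.scale/= /dh subr0.
  by move: (gphi _) (gphi _) => p q; field.
suff : h M <= h z by rewrite /h subrr expr0n/= mulr0; lra.
have near_M x : `|x - M| <= b -> 0 <= gphi M + b - gphi x.
  by have := gphi_lipschitz x M; rewrite ler_norml => /andP[_]; lra.
have [Mz|/ltW zM] := leP M z.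
  apply: (is_derive_le Mz (fun x _ => hdh x)) => x /andP[Mx xz].
  apply: mulr_ge0; first by rewrite subr_ge0 ltW.
  apply: near_M; move: zMb; rewrite ger0_norm ?subr_ge0// => zMb.
  by rewrite ger0_norm ?subr_ge0 ?(ltW Mx)//; lra.
have /(_ (fun x => - h x) (fun x => - dh x)) H := is_derive_le zM.
rewrite -lerN2; apply: H => x /andP[zx xM].
rewrite -mulNr opprB; apply: mulr_ge0; first by rewrite subr_ge0 ltW.
apply: near_M; move: zMb; rewrite ler0_norm ?subr_le0// => zMb.
by rewrite ler0_norm ?subr_le0 ?(ltW xM)//; lra.
Qed.

(** The quasi-arithmetic mean generated by [Phi]. *)
Definition gmean u v : R := iPhi ((Phi u + Phi v) / 2).

Lemma Phi_avg01 u v : 0 < (Phi u + Phi v) / 2 < 1.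
Proof.
by have := (Phi_gt0 u, Phi_gt0 v, Phi_lt1 u, Phi_lt1 v) => -[[[]]]; lra.
Qed.

Lemma Phi_gmean u v : Phi (gmean u v) = (Phi u + Phi v) / 2.
Proof. exact: iPhiK (Phi_avg01 u v). Qed.

Lemma le_gmean u v u' v' : u <= u' -> v <= v' -> gmean u v <= gmean u' v'.
Proof.
rewrite -Phi_mono -(Phi_mono v) -(Phi_mono (gmean _ _)) !Phi_gmean.
by move: (Phi u) (Phi v) (Phi u') (Phi v') => ? ? ? ?; lra.
Qed.

Lemma gmeanC u v : gmean u v = gmean v u.
Proof. by rewrite /gmean addrC. Qed.

Lemma gmean_id u : gmean u u = u.
Proof. by apply: Phi_inj; rewrite Phi_gmean; lra. Qed.

Lemma gmean_between u v : u <= v -> u <= gmean u v <= v.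
Proof.
by move=> uv; rewrite -{1}(gmean_id u) -{3}(gmean_id v) !le_gmean.
Qed.

(** Concavity of the profile: the tangent inequalities at the mean are averaged, and the [Phi] terms
    cancel by the definition of [gmean]. *)
Lemma gphi_gmean_ub u v : (gphi u + gphi v) / 2 <= gphi (gmean u v).
Proof.
have := gphi_Phi_max (gmean u v) u; have := gphi_Phi_max (gmean u v) v.
by rewrite Phi_gmean; lra.
Qed.

(** Averaging [gphi_Phi_lb] loses half of [gphi M] times the mean square distance of [u] and [v]
    from [M]. Since [M] is nearly their midpoint, this distance is [b ^+ 2 / 4] up to higher order,
    which gives the sharp [b ^+ 2 / 8]; the rest is bounded crudely by the cubic term. *)
Lemma gphi_gmean_lb u v L b : `|u| <= L -> `|v| <= L -> `|u - v| <= b -> b <= 1 ->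
  gphi (gmean u v) * (1 - b ^+ 2 / 8 - (gphi L) ^- 3 * b ^+ 3)
    <= (gphi u + gphi v) / 2.
Proof.
wlog uv : u v / u <= v => [H uL vL|].
  have [uv|/ltW vu] := leP u v; first exact: H.
  by rewrite gmeanC distrC (addrC (gphi u)); exact: H.
move=> uL vL uvb b1; have /andP[uM Mv] := gmean_between uv.
have PM := Phi_gmean u v; set M := gmean u v in uM Mv PM *.
set c0 := gphi L.
have c0gt : 0 < c0 by exact: gphi_gt0.
have c0le1 : c0 <= 1 by exact: gphi_le1.
have L0 : 0 <= L by exact: le_trans uL.
have c0P z : u <= z <= v -> c0 <= gphi z.
  move=> /andP[uz zv]; apply: le_gphi.
  by move: uL vL; rewrite !ler_norml => /andP[? ?] /andP[? ?]; nra.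
have {}uvb : v - u <= b by move: uvb; rewrite distrC ger0_norm ?subr_ge0.
clearbody M c0; clear uL vL.
(* [M] is the midpoint up to order [b ^+ 2]: both halves carry the same [Phi]-mass, and the
   densities found by the mean value theorem on them differ by at most [b]. *)
have diff : (M - u - (v - M)) ^+ 2 <= (b ^+ 2 / c0) ^+ 2.
  have [uv'|vu] := ltP u v; last first.
    have eM : M = u by lra.
    have ev : v = u by lra.
    by rewrite eM ev !subrr expr0n sqr_ge0.
  have uM' : u < M.
    by rewrite -Phi_lt_mono PM; have := lt_Phi uv'; move: (Phi u) (Phi v); clear => ? ?; lra.
  have Mv' : M < v.
    by rewrite -Phi_lt_mono PM; have := lt_Phi uv'; move: (Phi u) (Phi v); clear => ? ?; lra.
  have [y [uy yM yE]] := is_derive_mvt uM' (fun x _ => is_derive_Phi x).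
  have [z [Mz zv zE]] := is_derive_mvt Mv' (fun x _ => is_derive_Phi x).
  have yz : `|gphi z - gphi y| <= b.
    apply: le_trans (gphi_lipschitz _ _) _.
    by rewrite ger0_norm; move: uy yM Mz zv uvb; clear; lra.
  have cy : c0 <= gphi y by apply: c0P; move: uy yM Mv; clear; lra.
  have yzE : gphi y * (M - u) = gphi z * (v - M).
    by rewrite -yE -zE PM; move: (Phi u) (Phi v); clear => ? ?; lra.
  have main : c0 * `|M - u - (v - M)| <= b ^+ 2.
    apply: (@le_trans _ _ (gphi y * `|M - u - (v - M)|)).
      by rewrite ler_wpM2r.
    rewrite -[X in X * _]ger0_norm ?(ltW (gphi_gt0 _))// -normrM mulrBr yzE.
    rewrite -mulrBl normrM expr2 ler_pM// ger0_norm; move: uM' Mv' uvb; clear; lra.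
  rewrite -real_normK ?num_real// lerXn2r ?nnegrE//.
    by rewrite divr_ge0 ?sqr_ge0 ?ltW.
  by rewrite ler_pdivlMr// mulrC.
have cM : c0 <= gphi M by apply: c0P; rewrite uM.
have lu : gphi M + M * Phi M - (gphi M + b) * (u - M) ^+ 2 / 2
    <= gphi u + M * Phi u.
  by apply: gphi_Phi_lb; rewrite ler0_norm ?subr_le0//; lra.
have lv : gphi M + M * Phi M - (gphi M + b) * (v - M) ^+ 2 / 2
    <= gphi v + M * Phi v.
  by apply: gphi_Phi_lb; rewrite ger0_norm ?subr_ge0//; lra.
have b0 : 0 <= b by move: uv uvb; clear; lra.
pose S := ((u - M) ^+ 2 + (v - M) ^+ 2) / 2.
have SE : S = ((v - u) ^+ 2 + (M - u - (v - M)) ^+ 2) / 4 by rewrite /S; field.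
have S_le : S <= b ^+ 2 / 4 * (1 + b ^+ 2 / c0 ^+ 2).
  have -> : b ^+ 2 / 4 * (1 + b ^+ 2 / c0 ^+ 2) =
      (b ^+ 2 + (b ^+ 2 / c0) ^+ 2) / 4 by field; rewrite gt_eqF.
  by rewrite SE; nra.
have avg : gphi M - (gphi M + b) * S / 2 <= (gphi u + gphi v) / 2.
  by rewrite /S; nra.
apply: le_trans avg.
have gb : gphi M + b <= gphi M * (1 + b / c0).
  rewrite mulrDr mulr1 lerD2l mulrCA ler_peMr// ler_pdivlMr// mul1r//.
have S0 : 0 <= S by rewrite /S divr_ge0 ?addr_ge0 ?sqr_ge0.
have : (gphi M + b) * S / 2 <= gphi M * (1 + b / c0) *
    (b ^+ 2 / 4 * (1 + b ^+ 2 / c0 ^+ 2)) / 2.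
  rewrite ler_pM2r//; apply: ler_pM => //.
  by rewrite addr_ge0// ltW// gphi_gt0.
have : (1 + b / c0) * (b ^+ 2 / 4 * (1 + b ^+ 2 / c0 ^+ 2)) / 2 <=
   b ^+ 2 / 8 + c0 ^- 3 * b ^+ 3.
  set x := c0^-1.
  have x1 : 1 <= x by rewrite -[leLHS]invr1 lef_pV2 ?posrE.
  rewrite -!exprVn -/x.
  have -> : (1 + b * x) * (b ^+ 2 / 4 * (1 + b ^+ 2 * x ^+ 2)) / 2 =
    b ^+ 2 / 8 + b ^+ 3 * (x + b * x ^+ 2 + b ^+ 2 * x ^+ 3) / 8 by field.
  rewrite lerD2l -mulrA [leRHS]mulrC ler_wpM2l ?exprn_ge0//.
  have x2 : x <= x ^+ 3 by rewrite ler_eXnr.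
  have x3 : x ^+ 2 <= x ^+ 3 by rewrite ler_weXn2l.
  have x30 : 0 <= x ^+ 3 by rewrite exprn_ge0// (le_trans ler01).
  have b2 : b ^+ 2 <= 1 by rewrite expr_le1.
  have : b * x ^+ 2 <= x ^+ 3.
    by apply: le_trans x3; rewrite ler_piMl ?sqr_ge0.
  have : b ^+ 2 * x ^+ 3 <= x ^+ 3 by rewrite ler_piMl.
  by move: x2 x30; clear; lra.
have := gphi_gt0 M; set g := gphi M; nra.
Qed.

Lemma is_derive_gmean_shift u v (x : R) :
  is_derive x 1 (fun y => gmean (u + y) (v + y))
    ((gphi (u + x) + gphi (v + x)) / 2 / gphi (gmean (u + x) (v + x))).
Proof.
have d1 : is_derive x 1 (fun x => (Phi (u + x) + Phi (v + x)) / 2)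
    ((gphi (u + x) + gphi (v + x)) / 2).
  by apply: is_derive_eq; rewrite /GRing.scale/=; field.
rewrite mulrC.
exact: (@is_derive1_comp R iPhi _ x _ _ (is_derive_iPhi (Phi_avg01 (u + x) (v + x))) d1).
Qed.

(** The derivative of the shifted mean is the mean of [gphi] over [gphi] of the mean;
    [gphi_gmean_lb] bounds it below along the whole shift. *)
Lemma gmean_shift_ge0 u v c L b : 0 <= c ->
  `|u| + c <= L -> `|v| + c <= L -> `|u - v| <= b -> b <= 1 ->
  gmean u v + c * (1 - b ^+ 2 / 8 - (gphi L) ^- 3 * b ^+ 3)
    <= gmean (u + c) (v + c).
Proof.
move=> c0 uL vL uvb b1; set k := 1 - _ - _.
pose h x := gmean (u + x) (v + x) - x * k.
pose dh x := (gphi (u + x) + gphi (v + x)) / 2 / gphi (gmean (u + x) (v + x)) - k.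
have hdh (x : R) : is_derive x 1 h (dh x).
  have d := is_derive_gmean_shift u v x.
  by apply: is_derive_eq; rewrite /GRing.scale/= /dh mulr1; ring.
have : h 0 <= h c.
  apply: (is_derive_le c0 (fun x _ => hdh x)) => x /andP[x0 xc].
  rewrite /dh subr_ge0 ler_pdivlMr ?gphi_gt0// mulrC.
  apply: gphi_gmean_lb => //.
  - by apply: le_trans (ler_normD _ _) _; rewrite (ger0_norm (ltW x0)); lra.
  - by apply: le_trans (ler_normD _ _) _; rewrite (ger0_norm (ltW x0)); lra.
  - by rewrite opprD addrACA subrr addr0.
by rewrite /h mul0r !addr0 subr0 lerBrDr.
Qed.

(** For a downward shift it is the upper bound 1 on the same derivative that matters, and so no
    error appears. *)
Lemma gmean_shift_le0 u v c : c <= 0 ->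
  gmean u v + c <= gmean (u + c) (v + c).
Proof.
move=> c0; pose h x := x - gmean (u + x) (v + x).
have hdh (x : R) : is_derive x 1 h
    (1 - (gphi (u + x) + gphi (v + x)) / 2 / gphi (gmean (u + x) (v + x))).
  have d := is_derive_gmean_shift u v x.
  by apply: is_derive_eq.
have : h c <= h 0.
  apply: (is_derive_le c0 (fun x _ => hdh x)) => x _.
  by rewrite subr_ge0 ler_pdivrMr ?gphi_gt0// mul1r gphi_gmean_ub.
by rewrite /h !addr0; move: (gmean _ _) (gmean _ _); clear => ? ?; lra.
Qed.

End two_point.

(** * A concave substitute for the square root *)

Section profile.
Context {R : realType}.
Implicit Types l w mu L e : R.

(* A concave function of [w] that agrees with [Num.sqrt w] for [l ^+ 2 <= w] and is
   affine below [l ^+ 2], where the square root is singular. *)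
Definition gplam l w : R := Num.max l (Num.sqrt w).

Definition gprofile l w : R := (w + gplam l w ^+ 2) / (2 * gplam l w).

Lemma gplamP l w : 0 < l ->
  (w <= l ^+ 2 /\ gplam l w = l) \/
  [/\ l ^+ 2 <= w, gplam l w ^+ 2 = w & l <= gplam l w].
Proof.
move=> l0; have [wl|lw] := leP w (l ^+ 2); [left|right]; rewrite /gplam.
  split=> //; apply/max_idPl; rewrite -[leRHS](ger0_norm (ltW l0)) -sqrtr_sqr.
  exact: ler_wsqrtr.
have w0 : 0 <= w by rewrite (le_trans _ (ltW lw))// sqr_ge0.
have ls : l <= Num.sqrt w.
  by rewrite -[leLHS](ger0_norm (ltW l0)) -sqrtr_sqr ler_wsqrtr// ltW.
by rewrite (max_idPr ls) sqr_sqrtr//; split=> //; exact: ltW.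
Qed.

Lemma le_gplam l w : l <= gplam l w.
Proof. by rewrite /gplam le_max lexx. Qed.

Lemma gplam_gt0 l w : 0 < l -> 0 < gplam l w.
Proof. by move=> l0; rewrite (lt_le_trans l0)// le_gplam. Qed.

Lemma sqr_gplam_ge l w : 0 < l -> w <= gplam l w ^+ 2.
Proof. by move=> l0; have [[wl ->]//|[_ -> _]] := gplamP w l0. Qed.

(** [gprofile l w] is the minimum of [(w + mu ^+ 2) / (2 * mu)] over [mu >= l], attained at
    [gplam l w]. As a minimum of affine functions of [w] it is concave. *)
Lemma gprofile_tangent l w mu : 0 < l -> l <= mu ->
  gprofile l w <= (w + mu ^+ 2) / (2 * mu).
Proof.
move=> l0 lmu; have mu0 : 0 < mu by exact: lt_le_trans lmu.
rewrite -subr_ge0 /gprofile; have s0 := gplam_gt0 w l0.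
set s := gplam l w in s0 *.
have -> : (w + mu ^+ 2) / (2 * mu) - (w + s ^+ 2) / (2 * s) =
    (s - mu) * (w - mu * s) / (2 * mu * s) by field; rewrite !gt_eqF.
apply: divr_ge0; last by rewrite !mulr_ge0// ltW.
have [[wl sE]|[lw sE ls]] := gplamP w l0; rewrite -/s in sE.
  by rewrite sE; apply: mulr_le0; nra.
rewrite -sE (_ : _ * _ = s * (s - mu) ^+ 2); last by ring.
by rewrite mulr_ge0 ?sqr_ge0// ltW.
Qed.

(** The slope at [w] is [1 / (2 * gplam l w)], and cutting the square root off at [l ^+ 2] keeps the
    curvature of order [l ^- 3]. The four cases are the positions of [w] and [w'] relative to
    [l ^+ 2]. *)
Lemma gprofile_semiconvex l w w' : 0 < l ->
  gprofile l w + (w' - w) / (2 * gplam l w) - (w' - w) ^+ 2 / (4 * l ^+ 3)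
    <= gprofile l w'.
Proof.
move=> l0; rewrite /gprofile.
have s0 := gplam_gt0 w l0; have s0' := gplam_gt0 w' l0.
have P := gplamP w l0; have P' := gplamP w' l0.
set s := gplam l w in s0 P *; set s' := gplam l w' in s0' P' *; clearbody s s'.
have l30 : 0 < l ^+ 3 by rewrite exprn_gt0.
rewrite -subr_ge0.
have -> : (w' + s' ^+ 2) / (2 * s') - ((w + s ^+ 2) / (2 * s) +
    (w' - w) / (2 * s) - (w' - w) ^+ 2 / (4 * l ^+ 3)) =
  (w' - w) ^+ 2 / (4 * l ^+ 3) - (s' - s) * (w' - s * s') / (2 * s * s').
  by field; rewrite !gt_eqF.
rewrite subr_ge0 ler_pdivrMr ?mulr_gt0//.
rewrite mulrAC ler_pdivlMr ?mulr_gt0//.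
have : (s' - s) * (w' - s * s') * (4 * l ^+ 3) <= (w' - w) ^+ 2 * (2 * s * s').
  case: P P' => [[wl sE]|[lw sE ls]] [[wl' sE']|[lw' sE' ls']].
  - rewrite sE sE' subrr !mul0r; apply: mulr_ge0; [exact: sqr_ge0|nra].
  - have -> : (s' - s) * (w' - s * s') * (4 * l ^+ 3) =
        (s' - s) ^+ 2 * s' * (4 * l ^+ 3) by rewrite -sE'; ring.
    have -> : (w' - w) ^+ 2 * (2 * s * s') = (w' - w) ^+ 2 * (2 * s) * s' by ring.
    rewrite mulrAC ler_wpM2r ?(ltW s0')//.
    have h1 : (s' - s) * (2 * l) <= w' - w by rewrite -sE' sE; nra.
    have h0 : 0 <= s' - s by rewrite sE subr_ge0.
    have h2 : ((s' - s) * (2 * l)) ^+ 2 <= (w' - w) ^+ 2.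
      have h3 : 0 <= (s' - s) * (2 * l) by rewrite mulr_ge0// mulr_ge0// ltW.
      by rewrite lerXn2r ?nnegrE// (le_trans h3).
    rewrite (_ : _ * (4 * _) = ((s' - s) * (2 * l)) ^+ 2 * l); last by ring.
    apply: ler_pM; rewrite ?sqr_ge0 ?(ltW l0)//; lra.
  - have h0 : 0 <= s - s' by rewrite sE' subr_ge0.
    have ww : 0 <= w - w' by lra.
    have h1 : (s - s') * (2 * l) <= w - w' by rewrite sE' -sE; nra.
    have h2 : s * s' - w' <= w - w' by rewrite sE' -sE; nra.
    have h3 : 0 <= s * s' - w' by rewrite sE'; nra.
    have -> : (s' - s) * (w' - s * s') * (4 * l ^+ 3) =
       ((s - s') * (2 * l) * (s * s' - w')) * (2 * l * l) by ring.
    have -> : (w' - w) ^+ 2 * (2 * s * s') = ((w - w') * (w - w')) * (2 * s * l).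
      by rewrite sE'; ring.
    apply: ler_pM; rewrite ?mulr_ge0 ?(ltW l0)//.
      by apply: ler_pM => //; rewrite !mulr_ge0 ?(ltW l0).
    by rewrite -!mulrA ler_pM2l// ler_pM2r.
  - have -> : (s' - s) * (w' - s * s') * (4 * l ^+ 3) =
        (s' - s) ^+ 2 * (2 * l) ^+ 2 * l * s' by rewrite -sE'; ring.
    have -> : (w' - w) ^+ 2 * (2 * s * s') =
       (s' - s) ^+ 2 * (s' + s) ^+ 2 * (2 * s) * s' by rewrite -sE -sE'; ring.
    rewrite ler_wpM2r ?(ltW s0')//; apply: ler_pM.
    + by rewrite mulr_ge0 ?sqr_ge0.
    + exact: ltW.
    + rewrite ler_wpM2l ?sqr_ge0// lerXn2r ?nnegrE//; lra.
    + lra.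
by [].
Qed.

Lemma gprofile_le l w : 0 < l -> gprofile l w <= gplam l w.
Proof.
move=> l0; rewrite /gprofile ler_pdivrMr ?mulr_gt0 ?gplam_gt0//.
by have := sqr_gplam_ge w l0; nra.
Qed.

(** The threshold at which the affine part [(w + l ^+ 2) / (2 * l)] reaches [- (2 * L)]; below it
    the condition is void for functions bounded by [L]. *)
Lemma gprofile_leN l w L : 0 < l -> 0 <= L ->
  w <= - l ^+ 2 - 4 * L * l -> gprofile l w <= - (2 * L).
Proof.
move=> l0 L0 wL; have [[wl sE]|[lw sE ls]] := gplamP w l0; last by nra.
rewrite /gprofile sE ler_pdivrMr ?mulr_gt0//; nra.
Qed.

Lemma gprofile_sqr l e : 0 < l -> l <= e -> gprofile l (e ^+ 2) = e.
Proof.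
move=> l0 le; have e0 : 0 < e by exact: lt_le_trans le.
have -> : gprofile l (e ^+ 2) = (e ^+ 2 + e ^+ 2) / (2 * e).
  rewrite /gprofile /gplam sqrtr_sqr (ger0_norm (ltW e0)).
  by rewrite (max_idPr le).
by field; rewrite gt_eqF.
Qed.

End profile.

(** * One step of the walk *)

Section random_walk.
Context {R : realType}.
Implicit Types (U V : R -> R) (s t x r e : R).

Definition walk t U x : R := gmean (U (x - t)) (U (x + t)).

(* [1 - s] is the variance still to come: distances are measured relative to it. *)
Definition shifted_above (E l s e : R) U V :=
  forall x x', U x' + gprofile l (E - (x - x') ^+ 2 / (1 - s)) - e <= V x.

Lemma walk_bound t L U : (forall x, `|U x| <= L) -> forall x, `|walk t U x| <= L.
Proof.
move=> UL x; rewrite ler_norml -[X in X <= walk _ _ _](gmean_id (- L)).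
rewrite -[X in _ && (_ <= X)](gmean_id L) !le_gmean//.
all: by have := UL (x - t); have := UL (x + t); rewrite !ler_norml =>
  /andP[? ?] /andP[? ?].
Qed.

(* Whichever of the two increments of [U] is too steep can be flattened, which
   only raises the mean of [U] and leaves the lower bounds on [V] intact. *)
Lemma flatten_pair (u v g a1 a2 b L : R) : `|u| <= L -> `|v| <= L -> 0 <= b ->
  u + g <= a1 -> v + (g - b) <= a1 -> v + g <= a2 -> u + (g - b) <= a2 ->
  exists u' v', [/\ u <= u' /\ v <= v', `|u'| <= L, `|v'| <= L, `|u' - v'| <= b
    & u' + g <= a1 /\ v' + g <= a2].
Proof.
move=> uL vL b0 ua1 va1 va2 ua2.
move: (uL) (vL); rewrite !ler_norml => /andP[? ?] /andP[? ?].
have [uv|vu] := ltP b (v - u).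
  exists (v - b), v; split=> //; try by [split; lra].
  - by rewrite ler_norml; apply/andP; split; lra.
  - by rewrite addrAC subrr sub0r normrN ger0_norm.
have [uv'|vu'] := ltP b (u - v).
  exists u, (u - b); split=> //; try by [split; lra].
  - by rewrite ler_norml; apply/andP; split; lra.
  - by rewrite opprB addrC subrK ger0_norm.
exists u, v; split=> //.
by rewrite ler_norml; apply/andP; split; lra.
Qed.

(** A second-order expansion in [r]: [|r| / (sg * lam)] is the modulus of the slope of the profile
    there. The increment is [2 * t] because the two points of a crossed pair step in opposite
    directions. *)
Lemma gprofile_step (E l tau sg rho r r' t : R)
    (lam := gplam l (E - r ^+ 2 / sg)) :
  0 < l -> 0 < tau -> tau <= sg -> 0 < t -> t <= 1 -> `|r| <= rho ->
  `|r - r'| = 2 * t ->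
  gprofile l (E - r ^+ 2 / sg) - (2 * t * (`|r| / (sg * lam)) +
    (2 / (tau * l) + 4 * (rho + 1) ^+ 2 / (tau ^+ 2 * l ^+ 3)) * t ^+ 2) <=
  gprofile l (E - r' ^+ 2 / sg).
Proof.
move=> l0 tau0 tsg t0 t1 rrho rt.
set w := E - r ^+ 2 / sg in lam *; set w' := E - r' ^+ 2 / sg.
have lam_l : l <= lam by exact: le_gplam.
have lam0 : 0 < lam by exact: gplam_gt0.
have sg0 : 0 < sg by exact: lt_le_trans tsg.
apply: le_trans (gprofile_semiconvex w w' l0); rewrite -/lam.
have wwE : w' - w = (r ^+ 2 - r' ^+ 2) / sg by rewrite /w' /w; ring.
clearbody w w' lam.
have rr : `|r ^+ 2 - r' ^+ 2| <= 4 * t * (`|r| + t).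
  have -> : r ^+ 2 - r' ^+ 2 = (r - r') * (2 * r - (r - r')) by ring.
  rewrite normrM rt; have := ler_normB (2 * r) (r - r').
  by rewrite rt normrM (ger0_norm (ler0n _ 2)); nra.
have sl : 0 < sg * lam by rewrite mulr_gt0.
have lin : - (2 * t * (`|r| / (sg * lam)) + 2 / (tau * l) * t ^+ 2) <=
    (w' - w) / (2 * lam).
  have -> : (w' - w) / (2 * lam) = (r ^+ 2 - r' ^+ 2) / 2 / (sg * lam).
    by rewrite wwE; field; rewrite !gt_eqF.
  have h : (sg * lam)^-1 <= (tau * l)^-1.
    by rewrite lef_pV2 ?posrE ?mulr_gt0// ler_pM ?(ltW tau0) ?(ltW l0).
  apply: (@le_trans _ _
      (- (2 * t * (`|r| / (sg * lam)) + 2 * t ^+ 2 * (sg * lam)^-1))).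
    rewrite lerN2 lerD2l [leRHS]mulrAC ler_wpM2l//.
    by rewrite mulr_ge0// sqr_ge0.
  have -> : - (2 * t * (`|r| / (sg * lam)) + 2 * t ^+ 2 * (sg * lam)^-1) =
      - (4 * t * (`|r| + t)) / 2 / (sg * lam) by field; rewrite !gt_eqF.
  rewrite ler_pM2r ?invr_gt0// ler_pM2r ?invr_gt0//.
  by move: rr; rewrite ler_norml => /andP[].
have quad : (w' - w) ^+ 2 / (4 * l ^+ 3) <=
    4 * (rho + 1) ^+ 2 / (tau ^+ 2 * l ^+ 3) * t ^+ 2.
  have -> : 4 * (rho + 1) ^+ 2 / (tau ^+ 2 * l ^+ 3) * t ^+ 2 =
    (4 * t * (rho + 1) / tau) ^+ 2 / (4 * l ^+ 3) by field; rewrite !gt_eqF.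
  have t40 : 0 <= 4 * t by rewrite mulr_ge0// ltW.
  have rho0 : 0 <= rho by exact: le_trans rrho.
  rewrite ler_pM2r ?invr_gt0 ?mulr_gt0 ?exprn_gt0//.
  rewrite -real_normK ?num_real// lerXn2r ?nnegrE//.
    by rewrite divr_ge0 ?(ltW tau0)// mulr_ge0// addr_ge0.
  rewrite wwE normrM; apply: ler_pM => //.
    by apply: le_trans rr _; rewrite ler_wpM2l// lerD.
  by rewrite ger0_norm ?invr_ge0 ?(ltW sg0)// lef_pV2.
by move: lin quad; clear; lra.
Qed.

(** The tangent at [lam] bounds the new profile, and [1 / (sg - t ^+ 2)] is at least
    [1 / sg + t ^+ 2 / sg ^+ 2]. *)
Lemma gprofile_decay (E l sg r t : R) (lam := gplam l (E - r ^+ 2 / sg)) :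
  0 < l -> 0 < sg -> 0 < sg - t ^+ 2 ->
  gprofile l (E - r ^+ 2 / (sg - t ^+ 2)) <=
  gprofile l (E - r ^+ 2 / sg) - lam * (t ^+ 2 * (`|r| / (sg * lam)) ^+ 2 / 2).
Proof.
move=> l0 sg0 sg0'; have lam0 : 0 < lam by exact: gplam_gt0.
apply: (le_trans (gprofile_tangent _ l0 (le_gplam l _ : l <= lam))).
have h : r ^+ 2 / sg + r ^+ 2 * t ^+ 2 / sg ^+ 2 <= r ^+ 2 / (sg - t ^+ 2).
  rewrite ler_pdivlMr//.
  have -> : (r ^+ 2 / sg + r ^+ 2 * t ^+ 2 / sg ^+ 2) * (sg - t ^+ 2) =
      r ^+ 2 * (1 - (t ^+ 2 / sg) ^+ 2) by field; rewrite gt_eqF.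
  by rewrite ler_piMr ?sqr_ge0// gerBl sqr_ge0.
have -> : lam * (t ^+ 2 * (`|r| / (sg * lam)) ^+ 2 / 2) =
    r ^+ 2 * t ^+ 2 / sg ^+ 2 / (2 * lam).
  by rewrite expr_div_n real_normK ?num_real//; field; rewrite !gt_eqF.
rewrite /gprofile -/lam -mulrBl ler_pM2r ?invr_gt0 ?mulr_gt0//.
by move: h; clear; lra.
Qed.

(** The leading part of [b ^+ 2 / 8] is [(2 * t * q) ^+ 2 / 8 = t ^+ 2 * q ^+ 2 / 2], exactly the
    factor of [lam] gained in [gprofile_decay]; all other terms are of order [t ^+ 3]. *)
Let step_error (La lam Q C2 K q t c : R) (b := 2 * t * q + C2 * t ^+ 2) :
  0 <= K -> 0 <= Q -> 0 <= C2 -> 0 <= q -> q <= Q -> 0 <= t -> t <= 1 -> 0 <= c ->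
  c <= lam -> lam <= La ->
  c * (b ^+ 2 / 8 + K * b ^+ 3) <= lam * (t ^+ 2 * q ^+ 2 / 2) +
    La * (Q * C2 / 2 + C2 ^+ 2 / 8 + K * (2 * Q + C2) ^+ 3) * t ^+ 3.
Proof.
move=> K0 Q0 C20 q0 qQ t0 t1 c0 clam lamLa.
have tq : 0 <= t * q by exact: mulr_ge0.
have C2t : 0 <= C2 * t ^+ 2 by apply: mulr_ge0; last exact: sqr_ge0.
have b0 : 0 <= b by rewrite /b -mulrA addr_ge0// mulr_ge0.
have b_le : b <= (2 * Q + C2) * t.
  have h1 : C2 * t ^+ 2 <= C2 * t by rewrite ler_wpM2l// expr2 ler_piMr.
  have h2 : q * t <= Q * t by rewrite ler_wpM2r.
  by rewrite /b; move: h1 h2; clear; lra.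
have t30 : 0 <= t ^+ 3 by rewrite exprn_ge0.
have b3 : b ^+ 3 <= (2 * Q + C2) ^+ 3 * t ^+ 3.
  by rewrite -exprMn lerXn2r ?nnegrE// (le_trans b0).
have b2 : b ^+ 2 / 8 <= t ^+ 2 * q ^+ 2 / 2 + (Q * C2 / 2 + C2 ^+ 2 / 8) * t ^+ 3.
  have -> : b ^+ 2 / 8 = t ^+ 2 * q ^+ 2 / 2 +
      (q * C2 / 2 + C2 ^+ 2 / 8 * t) * t ^+ 3 by rewrite /b; field.
  rewrite lerD2l ler_wpM2r//.
  apply: lerD; last by rewrite ler_piMr// divr_ge0// sqr_ge0.
  by rewrite ler_pM2r ?invr_gt0// ler_wpM2r.
have Kb : K * b ^+ 3 <= K * ((2 * Q + C2) ^+ 3 * t ^+ 3) by rewrite ler_wpM2l.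
set X := t ^+ 2 * q ^+ 2 / 2 in b2 *.
have X0 : 0 <= X by rewrite /X divr_ge0// mulr_ge0 ?sqr_ge0.
set Y := (Q * C2 / 2 + C2 ^+ 2 / 8 + K * (2 * Q + C2) ^+ 3) * t ^+ 3.
have Y0 : 0 <= Y.
  rewrite /Y mulr_ge0//.
  have h1 : 0 <= Q * C2 / 2 by rewrite divr_ge0// mulr_ge0.
  have h2 : 0 <= C2 ^+ 2 / 8 by rewrite divr_ge0// sqr_ge0.
  have h3 : 0 <= K * (2 * Q + C2) ^+ 3.
    by rewrite mulr_ge0// exprn_ge0// addr_ge0// mulr_ge0.
  by rewrite !addr_ge0.
rewrite -mulrA -/Y; apply: (@le_trans _ _ (c * (X + Y))).
  by rewrite ler_wpM2l//; move: b2 Kb; rewrite /Y; clear; lra.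
by rewrite mulrDr; apply: lerD; rewrite ler_wpM2r// (le_trans clam).
Qed.

(* In one step the averages in the scale [Phi] lose [c * b ^+ 2 / 8] up to third order,
   where [b] is [2 * t] times the slope of the profile, and this is what the profile
   loses when [s] is replaced by [s + t ^+ 2]. *)
Lemma walk_step (E l tau L : R) : 0 < l -> 0 < tau -> 0 <= L ->
  exists C t0, [/\ 0 <= C, 0 < t0 & forall s t e U V,
    0 <= s -> 0 < t -> t <= t0 -> s + t ^+ 2 <= 1 - tau -> 0 <= e ->
    (forall x, `|U x| <= L) -> (forall x, `|V x| <= L) ->
    shifted_above E l s e U V ->
    shifted_above E l (s + t ^+ 2) (e + C * t ^+ 3) (walk t U) (walk t V)].
Proof.
move=> l0 tau0 L0.
(* In the case of near points [rho] bounds [|r|], [La] bounds [lam] and hence the shift, and [Q]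
   bounds the slope of the profile. [C2] is the second-order coefficient of [gprofile_step], and [K]
   is the constant of [gmean_shift_ge0] on the range [L + La]. *)
pose rho := 1 + (`|E| + l ^+ 2 + 4 * L * l).
pose La := l + 1 + `|E|.
pose Q := rho / (tau * l).
pose C2 := 2 / (tau * l) + 4 * (rho + 1) ^+ 2 / (tau ^+ 2 * l ^+ 3).
pose K : R := gphi (L + La) ^- 3.
have rho_le : `|E| + l ^+ 2 + 4 * L * l <= rho by rewrite lerDr.
have rho1 : 1 <= rho.
  by rewrite lerDl !addr_ge0 ?sqr_ge0 ?mulr_ge0 ?(ltW l0).
have La0 : 0 < La by rewrite /La; have := normr_ge0 E; lra.
have Q0 : 0 <= Q.
  apply: divr_ge0; first exact: le_trans rho1.
  by rewrite mulr_ge0 ?(ltW l0) ?(ltW tau0).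
have C20 : 0 <= C2.
  apply: addr_ge0; apply: divr_ge0; first by [].
  - by rewrite mulr_ge0 ?(ltW l0) ?(ltW tau0).
  - by rewrite mulr_ge0 ?sqr_ge0.
  - by rewrite mulr_ge0 ?sqr_ge0 ?exprn_ge0 ?(ltW l0).
have K0 : 0 <= K by rewrite invr_ge0 exprn_ge0// ltW// gphi_gt0.
exists (La * (Q * C2 / 2 + C2 ^+ 2 / 8 + K * (2 * Q + C2) ^+ 3)).
(* This size of [t] ensures [t <= 1] and [b <= 1], the latter being required by
   [gmean_shift_ge0]. *)
exists (1 + 2 * Q + C2)^-1.
have D0 : 0 < 1 + 2 * Q + C2 by lra.
have C0 : 0 <= La * (Q * C2 / 2 + C2 ^+ 2 / 8 + K * (2 * Q + C2) ^+ 3).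
  rewrite mulr_ge0 ?(ltW La0)//.
  have h1 : 0 <= Q * C2 / 2 by rewrite divr_ge0// mulr_ge0.
  have h2 : 0 <= C2 ^+ 2 / 8 by rewrite divr_ge0// sqr_ge0.
  have h3 : 0 <= K * (2 * Q + C2) ^+ 3.
    by rewrite mulr_ge0// exprn_ge0// addr_ge0// mulr_ge0.
  by rewrite !addr_ge0.
split=> [//||s t e U V s0 tgt0 tt0 st e0 UL VL H x x'].
  by rewrite invr_gt0.
have t1 : t * (1 + 2 * Q + C2) <= 1.
  by rewrite -ler_pdivlMr ?div1r.
have t_le1 : t <= 1.
  by apply: le_trans t1; rewrite ler_peMr ?(ltW tgt0)// -addrA lerDl addr_ge0// mulr_ge0.
set r := x - x'; set sg := 1 - s.
have -> : 1 - (s + t ^+ 2) = sg - t ^+ 2 by rewrite /sg opprD addrA.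
have sgt' : tau <= sg - t ^+ 2 by move: st; rewrite /sg; clear; lra.
have sg'1 : sg - t ^+ 2 <= 1.
  by move: s0 (sqr_ge0 t); rewrite /sg; clear; lra.
have sgt : tau <= sg by rewrite (le_trans sgt')// gerBl sqr_ge0.
have sg0 : 0 < sg by exact: lt_le_trans sgt.
have sg0' : 0 < sg - t ^+ 2 by exact: lt_le_trans sgt'.
have TU := walk_bound t UL x'; have TV := walk_bound t VL x.
set C := La * _.
have Ct0 : 0 <= C * t ^+ 3.
  rewrite mulr_ge0 ?exprn_ge0 ?(ltW tgt0)//.
(* For far points the profile is at most [- (2 * L)] and the bounds on the walks suffice; for near
   points [|r|] is bounded. *)
have [far|near] := leP (E - r ^+ 2 / (sg - t ^+ 2)) (- l ^+ 2 - 4 * L * l).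
  have := gprofile_leN l0 L0 far.
  move: TU TV e0 Ct0; rewrite !ler_norml; clear.
  by move=> /andP[_ ?] /andP[? _]; lra.
have rrho : `|r| <= rho.
  have r2 : r ^+ 2 <= rho.
    apply: le_trans rho_le.
    have h : r ^+ 2 / (sg - t ^+ 2) <= `|E| + l ^+ 2 + 4 * L * l.
      by move: near (ler_norm E); clear; lra.
    by apply: le_trans h; rewrite ler_pdivlMr// ler_piMr// sqr_ge0.
  move: r2 rho1; rewrite -real_normK ?num_real//; have := normr_ge0 r; clear.
  by nra.
set w := E - r ^+ 2 / sg; set lam := gplam l w; set g := gprofile l w.
have lam_l : l <= lam by exact: le_gplam.
have lam0 : 0 < lam by exact: gplam_gt0.
have lamLa : lam <= La.
  rewrite /lam; have [[wl ->]|[lw sE ls]] := gplamP w l0.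
    by rewrite /La -addrA lerDl addr_ge0.
  have wE : w <= `|E|.
    by rewrite (le_trans _ (ler_norm E))// gerBl divr_ge0 ?sqr_ge0 ?(ltW sg0).
  by move: sE wE l0 (normr_ge0 E); rewrite /La; clear; nra.
have g_lam : g <= lam by exact: gprofile_le.
pose q := `|r| / (sg * lam).
have q0 : 0 <= q by rewrite /q divr_ge0 ?mulr_ge0 ?(ltW sg0) ?(ltW lam0).
have qQ : q <= Q.
  apply: ler_pM => //.
    by rewrite invr_ge0 mulr_ge0 ?(ltW sg0) ?(ltW lam0).
  by rewrite lef_pV2 ?posrE ?mulr_gt0// ler_pM ?(ltW tau0) ?(ltW l0).
pose b := 2 * t * q + C2 * t ^+ 2.
have b0 : 0 <= b.
  rewrite /b -mulrA addr_ge0// mulr_ge0// ?sqr_ge0//.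
  by rewrite mulr_ge0// ltW.
have b1 : b <= 1.
  apply: le_trans t1; rewrite /b.
  have h1 : C2 * t ^+ 2 <= C2 * t by rewrite ler_wpM2l// expr2 ler_piMr// ltW.
  have h2 : q * t <= Q * t by rewrite ler_wpM2r// ltW.
  by move: h1 h2 tgt0; clear; lra.
(* The crossed pairs [x - t], [x' + t] and [x + t], [x' - t] are also comparable, with a profile
   lower by at most [b]. This is what allows the increments of [U] to be flattened to [b]. *)
have nbr (r' : R) : `|r - r'| = 2 * t -> g - b <= gprofile l (E - r' ^+ 2 / sg).
  exact: gprofile_step.
have [u' [v' [[uu' vv'] uL' vL' uvb [h1 h2]]]] :
  exists u' v', [/\ U (x' - t) <= u' /\ U (x' + t) <= v', `|u'| <= L, `|v'| <= L,
    `|u' - v'| <= b & u' + (g - e) <= V (x - t) /\ v' + (g - e) <= V (x + t)].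
  have Hr y y' : y - y' = r -> U y' + (g - e) <= V y.
    by move=> yE; have := H y y'; rewrite yE addrA.
  have Hn y y' : `|r - (y - y')| = 2 * t -> U y' + (g - e - b) <= V y.
    move=> yE; apply: le_trans (H y y'); rewrite -/sg.
    by have := nbr _ yE; clear; lra.
  have t2 : 0 <= 2 * t by rewrite mulr_ge0// ltW.
  apply: flatten_pair => //.
  - by apply: Hr; rewrite /r; clear; ring.
  - apply: Hn; rewrite (_ : r - _ = 2 * t) ?ger0_norm//.
    by rewrite /r; clear; ring.
  - by apply: Hr; rewrite /r; clear; ring.
  - apply: Hn; rewrite (_ : r - _ = - (2 * t)) ?normrN ?ger0_norm//.
    by rewrite /r; clear; ring.
have TUm : walk t U x' <= gmean u' v' by exact: le_gmean.
have TVm : gmean (u' + (g - e)) (v' + (g - e)) <= walk t V x by exact: le_gmean.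
have decay : gprofile l (E - r ^+ 2 / (sg - t ^+ 2)) <=
    g - lam * (t ^+ 2 * q ^+ 2 / 2) by exact: gprofile_decay.
have [c0|/ltW c0] := leP 0 (g - e); last first.
  have cs := gmean_shift_le0 u' v' c0.
  have d0 : 0 <= lam * (t ^+ 2 * q ^+ 2 / 2).
    by rewrite mulr_ge0 ?(ltW lam0)// divr_ge0// mulr_ge0 ?sqr_ge0.
  by move: TUm TVm decay cs d0 Ct0; clear; lra.
have clam : g - e <= lam by move: g_lam e0; clear; lra.
have cLa : g - e <= La by exact: le_trans lamLa.
have shift := gmean_shift_ge0 c0 (lerD uL' cLa) (lerD vL' cLa) uvb b1.
rewrite -/K in shift.
have err := step_error K0 Q0 C20 q0 qQ (ltW tgt0) t_le1 c0 clam lamLa.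
rewrite -/b -/C in err.
by move: TUm TVm decay shift err; clear; lra.
Qed.

End random_walk.

(** * Iteration of the walk *)

Section random_walk_iterate.
Context {R : realType}.
Implicit Types (U V h : R -> R) (s t x r e : R).

Lemma walk_iter_bound t L U N : (forall x, `|U x| <= L) ->
  forall x, `|iter N (walk t) U x| <= L.
Proof. by move=> UL; elim: N => //= N IH; exact: walk_bound. Qed.

(** The errors [C * t ^+ 3] of [N] steps add up to [C * t * (N%:R * t ^+ 2)], at most [C * t]. Only
    the diagonal [x = x'] is kept at the end; [tau] keeps the constants of a single step uniform. *)
Lemma walk_iter (E l tau L : R) : 0 < l -> 0 < tau -> 0 <= L ->
  exists C t0, [/\ 0 <= C, 0 < t0 & forall N t U V,
    0 < t -> t <= t0 -> N%:R * t ^+ 2 <= 1 - tau ->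
    (forall x, `|U x| <= L) -> (forall x, `|V x| <= L) ->
    shifted_above E l 0 0 U V ->
    forall x, iter N (walk t) U x + gprofile l E - C * t <= iter N (walk t) V x].
Proof.
move=> l0 tau0 L0; have [C [t0 [C0 t00 H]]] := walk_step E l0 tau0 L0.
exists C, t0; split=> // N t U V tgt0 tt0 Nt UL VL UV x.
have step k : (k <= N)%N ->
    shifted_above E l (k%:R * t ^+ 2) (k%:R * (C * t ^+ 3))
      (iter k (walk t) U) (iter k (walk t) V).
  elim: k => [_|k IH kN]; first by rewrite !mul0r.
  rewrite -natr1 !mulrDl !mul1r !iterS; apply: H => //.
  - by rewrite mulr_ge0// sqr_ge0.
  - rewrite -{2}[t ^+ 2]mul1r -mulrDl natr1 (le_trans _ Nt)//.
    by rewrite ler_wpM2r ?sqr_ge0// ler_nat.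
  - by rewrite mulr_ge0// mulr_ge0// exprn_ge0// ltW.
  - exact: walk_iter_bound.
  - exact: walk_iter_bound.
  - by apply: IH; exact: ltnW.
have := step N (leqnn _) x x; rewrite subrr expr0n mul0r subr0.
have : N%:R * (C * t ^+ 3) <= C * t.
  have -> : N%:R * (C * t ^+ 3) = C * t * (N%:R * t ^+ 2) by ring.
  by rewrite ler_piMr ?mulr_ge0 ?(ltW tgt0)//; lra.
lra.
Qed.

Definition bern t h x : R := (h (x - t) + h (x + t)) / 2.

Lemma Phi_walk_iter t U N x :
  Phi (iter N (walk t) U x) = iter N (bern t) (@Phi R \o U) x.
Proof. by elim: N x => //= N IH x; rewrite Phi_gmean !IH. Qed.

Lemma bern_iter_dist t h h' c N : (forall x, `|h x - h' x| <= c) ->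
  forall x, `|iter N (bern t) h x - iter N (bern t) h' x| <= c.
Proof.
move=> hh'; elim: N => //= N IH x.
have := IH (x - t); have := IH (x + t); rewrite /bern !ler_norml.
by move=> /andP[? ?] /andP[? ?]; apply/andP; split; lra.
Qed.

End random_walk_iterate.

(** * Two-point averages of Gaussian kernels *)

Section heat_kernel.
Context {R : realType}.
Implicit Types (h : R -> R) (s t x y z r e : R).

Lemma expR_le_quad s : expR s <= 1 + s + s ^+ 2 / 2 * expR `|s|.
Proof.
have [s0|/ltW s0] := leP 0 s.
  rewrite ger0_norm//.
  pose f (u : R) := 1 + u + u ^+ 2 / 2 * expR u - expR u.
  pose df (u : R) := 1 + u * expR u + u ^+ 2 / 2 * expR u - expR u.
  have fdf (u : R) : is_derive u 1 f (df u).
    by rewrite /f /df; apply: is_derive_eq; rewrite /GRing.scale/=; field.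
  have ddf (u : R) : is_derive u 1 df ((2 * u + u ^+ 2 / 2) * expR u).
    by rewrite /df; apply: is_derive_eq; rewrite /GRing.scale/=; field.
  have df0 u : 0 <= u -> 0 <= df u.
    move=> u0; have <- : df 0 = 0 by rewrite /df expR0; lra.
    apply: (is_derive_le u0 (fun v _ => ddf v)) => v /andP[/ltW v0 _].
    by rewrite mulr_ge0 ?expR_ge0// addr_ge0 ?divr_ge0 ?sqr_ge0// mulr_ge0.
  have : f 0 <= f s.
    by apply: (is_derive_le s0 (fun v _ => fdf v)) => v /andP[/ltW v0 _]; exact: df0.
  by rewrite /f expR0 expr0n/=; lra.
have e1 : 1 <= expR `|s| by rewrite -[leLHS]expR0 ler_expR.
suff : expR s <= 1 + s + s ^+ 2 / 2.
  by move=> /le_trans; apply; rewrite lerD2l ler_peMr// divr_ge0// sqr_ge0.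
pose f (u : R) := expR u - (1 + u + u ^+ 2 / 2).
have df (u : R) : is_derive u 1 f (expR u - (1 + u)).
  by rewrite /f; apply: is_derive_eq; rewrite /GRing.scale/=; field.
have : f s <= f 0.
  apply: (is_derive_le s0 (fun u _ => df u)) => u _.
  by rewrite subr_ge0 expR_ge1Dx.
by rewrite /f expR0 expr0n/=; lra.
Qed.

(** The subgaussian bound for a fair sign: the quotient of the two sides decreases for [z >= 0]. *)
Lemma cosh_le_expR z : (expR z + expR (- z)) / 2 <= expR (z ^+ 2 / 2).
Proof.
wlog z0 : z / 0 <= z => [H|].
  have [/H//|/ltW zN] := leP 0 z.
  by have := H (- z); rewrite sqrrN opprK addrC; apply; rewrite oppr_ge0.
pose f (u : R) := (expR u + expR (- u)) * expR (- (u ^+ 2 / 2)).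
pose k (u : R) := u * (expR u + expR (- u)) - (expR u - expR (- u)).
have dk (u : R) : is_derive u 1 k (u * (expR u - expR (- u))).
  by rewrite /k; apply: is_derive_eq; rewrite /GRing.scale/=; ring.
have df (u : R) : is_derive u 1 f (- (k u * expR (- (u ^+ 2 / 2)))).
  by rewrite /f /k; apply: is_derive_eq; rewrite /GRing.scale/=;
    move: (expR _) (expR _) (expR _) => e1 e2 e3; field.
have k0 u : 0 <= u -> 0 <= k u.
  move=> u0; have <- : k 0 = 0 by rewrite /k oppr0; lra.
  apply: (is_derive_le u0 (fun v _ => dk v)) => v /andP[/ltW v0 _].
  by rewrite mulr_ge0// subr_ge0 ler_expR; lra.
have : - f 0 <= - f z.
  apply: (@is_derive_le _ (fun u => - f u) _ _ _ z0 (fun v _ => is_deriveN (df v))).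
  by move=> v /andP[/ltW v0 _]; rewrite opprK mulr_ge0 ?expR_ge0 ?k0.
rewrite /f oppr0 expr0n/= mul0r oppr0 expR0 (expRN (z ^+ 2 / 2)).
by rewrite lerN2 ler_pdivrMr ?expR_gt0//; lra.
Qed.

Lemma cosh_ge z : 1 + z ^+ 2 / 2 <= (expR z + expR (- z)) / 2.
Proof.
wlog z0 : z / 0 <= z => [H|].
  have [/H//|/ltW zN] := leP 0 z.
  by have := H (- z); rewrite sqrrN opprK (addrC (expR (- z))); apply; rewrite oppr_ge0.
pose f (u : R) := expR u + expR (- u) - u ^+ 2.
pose df (u : R) := expR u - expR (- u) - 2 * u.
have fdf (u : R) : is_derive u 1 f (df u).
  by rewrite /f /df; apply: is_derive_eq; rewrite /GRing.scale/=; ring.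
have ddf (u : R) : is_derive u 1 df (expR u + expR (- u) - 2).
  by rewrite /df; apply: is_derive_eq; rewrite /GRing.scale/=; ring.
have df0 u : 0 <= u -> 0 <= df u.
  move=> u0; have <- : df 0 = 0 by rewrite /df oppr0 subrr mulr0 subr0.
  apply: (is_derive_le u0 (fun v _ => ddf v)) => v _.
  by have := expR_ge1Dx v; have := expR_ge1Dx (- v); lra.
have : f 0 <= f z.
  by apply: (is_derive_le z0 (fun v _ => fdf v)) => v /andP[/ltW v0 _]; exact: df0.
by rewrite /f oppr0 expR0 expr0n/=; lra.
Qed.

(* With [z = (y - x) / s] and [r = t / s], this is the estimate of [normal_pdf_bern]
   divided by [normal_pdf x s y]. *)
Let bern_heat_ratio r z : r ^+ 2 <= 2^-1 ->
  `|expR (- (r ^+ 2 / 2)) * ((expR (r * z) + expR (- (r * z))) / 2)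
    - (Num.sqrt (1 + r ^+ 2))^-1 * expR (r ^+ 2 * z ^+ 2 / (2 * (1 + r ^+ 2)))|
  <= 150 * (r ^+ 2) ^+ 2 * expR (3 * z ^+ 2 / 8).
Proof.
have coshw := cosh_le_expR (r * z); have coshw' := cosh_ge (r * z).
rewrite exprMn in coshw coshw'.
set ch := (_ + _) / 2 in coshw coshw' *; clearbody ch.
have rho0 := sqr_ge0 r; set rho := r ^+ 2 in rho0 coshw coshw' * => rho1.
(* Powers of [z] and exponentials are all absorbed into powers of [F], up to
   [F ^+ 6 = expR (3 * z ^+ 2 / 8)], the exponential factor between the kernels of deviations
   [2 * s] and [s]. *)
set F := expR (z ^+ 2 / 16).
have F1 : 1 <= F by rewrite -[leLHS]expR0 ler_expR divr_ge0// sqr_ge0.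
have F0 : 0 <= F by exact: le_trans F1.
have zz0 := sqr_ge0 z.
have zF : z ^+ 2 <= 16 * F.
  by have := expR_ge1Dx (z ^+ 2 / 16); rewrite -/F; lra.
have FE n : F ^+ n = expR (z ^+ 2 / 16 * n%:R) by rewrite /F expRM_natr.
clearbody F.
have F6 : expR (3 * z ^+ 2 / 8) = F ^+ 6 by rewrite FE; congr expR; field.
have z4F : (z ^+ 2) ^+ 2 <= 256 * F ^+ 2 by nra.
set v := rho * z ^+ 2 / 2.
have v0 : 0 <= v by rewrite divr_ge0// mulr_ge0.
have vz : v <= z ^+ 2 / 4 by rewrite /v; nra.
have v2 : v ^+ 2 <= rho ^+ 2 * (64 * F ^+ 2).
  by have := sqr_ge0 rho; rewrite /v; nra.
have ev : expR v <= F ^+ 4 by rewrite FE ler_expR; lra.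
have F2 : 1 <= F ^+ 2 by rewrite exprn_ege1.
have F4 : 1 <= F ^+ 4 by rewrite exprn_ege1.
have F12 : F <= F ^+ 6 by rewrite ler_eXnr.
have F62 : F ^+ 6 = F ^+ 2 * F ^+ 4 by rewrite -exprD.
have rr0 := sqr_ge0 rho.
(* The common first-order expansion in [rho] of both terms; each of them is then shown to lie within
   [rho ^+ 2] times a multiple of [F ^+ 6] of it. *)
pose T := 1 - rho / 2 + v.
have e4 : expR (4^-1) <= 2 :> R.
  have := @expR_le_quad 4^-1; rewrite ger0_norm//.
  by have := expR_gt0 (4^-1 : R); nra.
set a := expR (- (rho / 2)) * ch.
have a_lo : T - rho ^+ 2 * (4 * F ^+ 6) <= a.
  have h1 := expR_ge1Dx (- (rho / 2)).
  have h2 : (1 - rho / 2) * (1 + v) <= a.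
    by rewrite /a; apply: ler_pM => //; move: rho1 v0; clear; lra.
  by apply: le_trans h2; rewrite /T /v; nra.
have a_up : a <= T + rho ^+ 2 * (65 * F ^+ 6).
  have h1 : a <= expR (- (rho / 2) + v).
    by rewrite expRD /a ler_wpM2l ?expR_ge0.
  apply: le_trans h1 _; apply: le_trans (expR_le_quad _) _.
  set s := - (rho / 2) + v.
  have es : expR `|s| <= 2 * F ^+ 4.
    apply: (@le_trans _ _ (expR (4^-1 + z ^+ 2 / 16 * 4%:R))).
      by rewrite ler_expR ler_norml /s; apply/andP; split; move: rho0 rho1 v0 vz zz0; clear; lra.
    by rewrite expRD -FE ler_wpM2r// exprn_ge0.
  have s2 : s ^+ 2 / 2 <= rho ^+ 2 * (32 * F ^+ 2 + 1 / 8).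
    have : s ^+ 2 <= v ^+ 2 + rho ^+ 2 / 4 by rewrite /s; nra.
    by move: v2; clear; lra.
  have : s ^+ 2 / 2 * expR `|s| <= rho ^+ 2 * (32 * F ^+ 2 + 1 / 8) * (2 * F ^+ 4).
    by apply: ler_pM; rewrite ?divr_ge0 ?sqr_ge0 ?expR_ge0.
  by rewrite F62 /s /T; nra.
have vF : rho * v <= rho ^+ 2 * (8 * F ^+ 6).
  rewrite (_ : rho * v = rho ^+ 2 * (z ^+ 2 / 2)); last by rewrite /v; field.
  by rewrite ler_wpM2l//; move: zF F12; clear; lra.
have v4F : v <= 4 * F ^+ 6 by move: vz zF F12; clear; lra.
have v2F : v ^+ 2 / 2 * F ^+ 4 <= rho ^+ 2 * (32 * F ^+ 6).
  rewrite F62 (_ : rho ^+ 2 * _ = rho ^+ 2 * (64 * F ^+ 2) / 2 * F ^+ 4); last by field.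
  by rewrite ler_wpM2r ?exprn_ge0//; move: v2; clear; lra.
have F61 : 1 <= F ^+ 6 by rewrite exprn_ege1.
set S := Num.sqrt (1 + rho).
have S0 : 0 < S by rewrite sqrtr_gt0 ltr_pwDl.
have S2 : S ^+ 2 = 1 + rho by rewrite sqr_sqrtr// addr_ge0.
have i0 : 0 < S^-1 by rewrite invr_gt0.
have i2 : (S^-1) ^+ 2 * (1 + rho) = 1 by rewrite -S2 exprVn mulVf// gt_eqF// exprn_gt0.
have i_lo : 1 - rho / 2 <= S^-1.
  rewrite leNgt; apply/negP => i_lt.
  have : (S^-1) ^+ 2 < (1 - rho / 2) ^+ 2 by rewrite ltrXn2r// ltW.
  move: i2 rho0 rho1; clear; move: (S^-1 ^+ 2) => i i2 rho0 rho1 i_lt.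
  have : i * (1 + rho) < (1 - rho / 2) ^+ 2 * (1 + rho) by rewrite ltr_pM2r//; lra.
  by rewrite i2; nra.
have i_up : S^-1 <= 1 - rho / 2 + rho ^+ 2 / 2.
  rewrite leNgt; apply/negP => i_lt.
  have j0 : 0 < 1 - rho / 2 + rho ^+ 2 / 2 by move: rho1 rr0; clear; lra.
  have : (1 - rho / 2 + rho ^+ 2 / 2) ^+ 2 < (S^-1) ^+ 2 by rewrite ltrXn2r// ltW.
  move: i2 rho0 rho1; clear; move: (S^-1 ^+ 2) => i i2 rho0 rho1 i_lt.
  have : (1 - rho / 2 + rho ^+ 2 / 2) ^+ 2 * (1 + rho) < i * (1 + rho).
    by rewrite ltr_pM2r//; lra.
  have r3 := exprn_ge0 3 rho0; have r4 := exprn_ge0 4 rho0; have r5 := exprn_ge0 5 rho0.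
  have -> : (1 - rho / 2 + rho ^+ 2 / 2) ^+ 2 * (1 + rho) =
    1 + rho ^+ 2 / 4 + rho ^+ 3 * (3 - rho) / 4 + rho ^+ 5 / 4 by field.
  have : 0 <= rho ^+ 3 * (3 - rho) by rewrite mulr_ge0//; lra.
  by have := sqr_ge0 rho; lra.
rewrite (_ : rho * z ^+ 2 / (2 * (1 + rho)) = v / (1 + rho)); last first.
  by rewrite /v; field; rewrite gt_eqF// ltr_pwDl.
have rho10 : 0 < 1 + rho by rewrite ltr_pwDl.
have v'v : v / (1 + rho) <= v by rewrite ler_pdivrMr// ler_peMr// lerDl.
have v'v' : v - rho * v <= v / (1 + rho).
  by rewrite ler_pdivlMr//; move: rho0 v0; clear; clearbody v; nra.
set b := S^-1 * _.
have b_lo : T - rho ^+ 2 * (12 * F ^+ 6) <= b.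
  have h1 := expR_ge1Dx (v / (1 + rho)).
  have h2 : (1 - rho / 2) * (1 + v - rho * v) <= b.
    apply: ler_pM => //; last by rewrite (le_trans _ h1)// -addrA lerD2l.
      by move: rho1; clear; lra.
    by move: rho0 rho1 v0; clear; clearbody v; nra.
  apply: le_trans h2; rewrite /T.
  have rv : 0 <= rho ^+ 2 * v by exact: mulr_ge0.
  by move: vF rv; clear; clearbody v; lra.
have G0 : 0 <= rho ^+ 2 * F ^+ 6 by rewrite mulr_ge0// exprn_ge0.
have b_up : b <= T + rho ^+ 2 * (35 * F ^+ 6).
  have h1 : expR (v / (1 + rho)) <= 1 + v + v ^+ 2 / 2 * F ^+ 4.
    apply: (@le_trans _ _ (expR v)); first by rewrite ler_expR.
    apply: le_trans (expR_le_quad _) _; rewrite ger0_norm// lerD2l.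
    by rewrite ler_wpM2l// divr_ge0// sqr_ge0.
  have h2 : b <= (1 - rho / 2 + rho ^+ 2 / 2) * (1 + v + v ^+ 2 / 2 * F ^+ 4).
    by apply: ler_pM; rewrite ?(ltW i0) ?expR_ge0.
  apply: le_trans h2 _.
  have h3 : (1 - rho / 2 + rho ^+ 2 / 2) * (1 + v + v ^+ 2 / 2 * F ^+ 4) <=
     (1 - rho / 2 + rho ^+ 2 / 2) * (1 + v) + v ^+ 2 / 2 * F ^+ 4.
    rewrite [leLHS]mulrDr lerD2l; apply: ler_piMl.
      by rewrite mulr_ge0 ?exprn_ge0// divr_ge0// sqr_ge0.
    by move: rho0 rho1; clear; nra.
  apply: le_trans h3 _.
  have h4 : rho ^+ 2 * (1 + v) <= rho ^+ 2 * (5 * F ^+ 6).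
    by rewrite ler_wpM2l//; move: v4F F61; clear; lra.
  have h5 : 0 <= rho * v by rewrite mulr_ge0.
  by rewrite /T; move: v2F h4 h5 G0; clear; clearbody v; lra.
rewrite F6 ler_norml; move: a_lo a_up b_lo b_up G0; clear => ? ? ? ? ?.
by apply/andP; split; lra.
Qed.

(** Twice the 150 of [bern_heat_ratio], since the peak of the kernel halves when the deviation
    doubles. It is locked so that arithmetic treats it as an atom. *)
Definition bern_cst : R := locked 300.

Lemma bern_cst_gt0 : 0 < bern_cst.
Proof. by rewrite /bern_cst -lock ltr0n. Qed.

(** A two-point step and an added variance [t ^+ 2] have the same second moment, so the kernels
    agree to first order in [(t / s) ^+ 2]. The wider kernel serves as a majorant of total mass
    1. *)
Lemma normal_pdf_bern s t x y : 0 < s -> (t / s) ^+ 2 <= 2^-1 ->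
  `|(normal_pdf (x - t) s y + normal_pdf (x + t) s y) / 2
    - normal_pdf x (Num.sqrt (s ^+ 2 + t ^+ 2)) y|
  <= bern_cst * ((t / s) ^+ 2) ^+ 2 * normal_pdf x (2 * s) y.
Proof.
move=> s0 ts; have s20 : 0 < s ^+ 2 by rewrite exprn_gt0.
have st0 : 0 < s ^+ 2 + t ^+ 2 by rewrite ltr_wpDr ?sqr_ge0.
have sn0 : s != 0 by rewrite gt_eqF.
have sqn0 : Num.sqrt (s ^+ 2 + t ^+ 2) != 0 by rewrite gt_eqF ?sqrtr_gt0.
rewrite !normal_pdfE//; last by rewrite mulf_neq0.
set z := (y - x) / s; set r := t / s in ts *.
rewrite /normal_fun.
have peak2 : normal_peak (2 * s) = normal_peak s / 2.
  rewrite /normal_peak.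
  have -> : (2 * s) ^+ 2 * pi *+ 2 = 2 ^+ 2 * (s ^+ 2 * pi *+ 2) :> R by ring.
  by rewrite sqrtrM ?sqr_ge0// sqrtr_sqr invfM mulrC ger0_norm.
have peakst : normal_peak (Num.sqrt (s ^+ 2 + t ^+ 2)) =
    normal_peak s * (Num.sqrt (1 + r ^+ 2))^-1.
  rewrite /normal_peak sqr_sqrtr ?(ltW st0)//.
  have -> : s ^+ 2 + t ^+ 2 = (1 + r ^+ 2) * s ^+ 2.
    by rewrite /r; field.
  have -> : (1 + r ^+ 2) * s ^+ 2 * pi *+ 2 =
    (1 + r ^+ 2) * (s ^+ 2 * pi *+ 2) by ring.
  by rewrite sqrtrM ?addr_ge0 ?sqr_ge0// invfM mulrC.
rewrite peak2 peakst.
have -> : - (y - (x - t)) ^+ 2 / (s ^+ 2 *+ 2) =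
    - (z ^+ 2 / 2) + (- (r ^+ 2 / 2) + - (r * z)).
  by rewrite /z /r -mulr_natr; field.
have -> : - (y - (x + t)) ^+ 2 / (s ^+ 2 *+ 2) =
    - (z ^+ 2 / 2) + (- (r ^+ 2 / 2) + r * z).
  by rewrite /z /r -mulr_natr; field.
have -> : - (y - x) ^+ 2 / (Num.sqrt (s ^+ 2 + t ^+ 2) ^+ 2 *+ 2) =
    - (z ^+ 2 / 2) + r ^+ 2 * z ^+ 2 / (2 * (1 + r ^+ 2)).
  rewrite sqr_sqrtr ?(ltW st0)// /z /r -mulr_natr; field.
  by rewrite sn0 gt_eqF.
have -> : - (y - x) ^+ 2 / ((2 * s) ^+ 2 *+ 2) =
    - (z ^+ 2 / 2) + 3 * z ^+ 2 / 8.
  by rewrite /z -mulr_natr; field.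
rewrite !expRD; set e0 := expR (- (z ^+ 2 / 2)).
have -> : normal_peak s / 2 * (e0 * expR (3 * z ^+ 2 / 8)) =
  normal_peak s * e0 * (expR (3 * z ^+ 2 / 8) / 2) by ring.
have pe0 : 0 <= normal_peak s * e0 by rewrite mulr_ge0 ?normal_peak_ge0 ?expR_ge0.
set A := expR (- (r ^+ 2 / 2)); set B := expR (r * z); set B' := expR (- (r * z)).
set D := expR (_ / _); set S := Num.sqrt (1 + r ^+ 2).
have -> : (normal_peak s * (e0 * (A * B')) + normal_peak s * (e0 * (A * B))) / 2
    - normal_peak s * S^-1 * (e0 * D) =
    normal_peak s * e0 * (A * ((B + B') / 2) - S^-1 * D) by ring.
rewrite normrM (ger0_norm pe0) [leRHS]mulrCA ler_wpM2l//.
apply: le_trans (bern_heat_ratio _ ts) _; rewrite -/D /bern_cst -lock.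
by lra.
Qed.

(** After scaling this is [|z| <= expR (3 * z ^+ 2 / 8)], which follows from
    [(3 * |z| - 4) ^+ 2 >= 0]. *)
Lemma normal_pdf_dist s x y : 0 < s ->
  `|y - x| * normal_pdf x s y <= 2 * s * normal_pdf x (2 * s) y.
Proof.
move=> s0; have sn0 : s != 0 by rewrite gt_eqF.
rewrite !normal_pdfE//; last by rewrite mulf_neq0.
rewrite /normal_fun; set z := (y - x) / s.
have peak2 : normal_peak (2 * s) = normal_peak s / 2.
  rewrite /normal_peak.
  have -> : (2 * s) ^+ 2 * pi *+ 2 = 2 ^+ 2 * (s ^+ 2 * pi *+ 2) :> R by ring.
  by rewrite sqrtrM ?sqr_ge0// sqrtr_sqr invfM mulrC ger0_norm.
have -> : - (y - x) ^+ 2 / (s ^+ 2 *+ 2) = - (z ^+ 2 / 2).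
  by rewrite /z -mulr_natr; field.
have -> : - (y - x) ^+ 2 / ((2 * s) ^+ 2 *+ 2) =
    - (z ^+ 2 / 2) + 3 * z ^+ 2 / 8.
  by rewrite /z -mulr_natr; field.
have -> : `|y - x| = s * `|z|.
  by rewrite /z normrM normfV (gtr0_norm s0) mulrC divfK.
rewrite expRD peak2; set e0 := expR (- _); set p := normal_peak s.
have -> : 2 * s * (p / 2 * (e0 * expR (3 * z ^+ 2 / 8))) =
  s * expR (3 * z ^+ 2 / 8) * (p * e0) by field.
rewrite ler_wpM2r ?mulr_ge0 ?normal_peak_ge0 ?expR_ge0// ler_pM2l//.
apply: le_trans (expR_ge1Dx _).
rewrite -[z ^+ 2]real_normK ?num_real//; have := sqr_ge0 (3 * `|z| - 4).
by nra.
Qed.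

End heat_kernel.

(** * From the random walk to the Gaussian law of the line *)

Section heat_semigroup.
Context {R : realType}.
Notation mu := (@lebesgue_measure R).
Implicit Types (h : R -> R) (s t x y z r e K : R).

Definition heat s h x : R := \int[mu]_y (h y * normal_pdf x s y).

Lemma integrable_mul_pdf h s x c : measurable_fun setT h ->
  (forall y, `|h y| <= c) ->
  mu.-integrable setT (fun y => (h y * normal_pdf x s y)%:E).
Proof.
move=> mh hc; apply: (@le_integrable _ _ _ mu setT measurableT _
    (fun y => (c * normal_pdf x s y)%:E)).
- by apply/measurable_EFinP; apply: measurable_funM => //; exact: measurable_normal_pdf.
- move=> y _ /=; rewrite lee_fin !normrM ler_wpM2r// (le_trans (hc y))//.
  exact: ler_norm.
- exact: (integrableZl measurableT c (@integrable_normal_pdf R x s)).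
Qed.

Lemma Rintegral_cst_pdf s x c : \int[mu]_y (c * normal_pdf x s y) = c.
Proof.
rewrite RintegralZl//; last exact: integrable_normal_pdf.
by rewrite /Rintegral integral_normal_pdf mulr1.
Qed.

Lemma heat_le h h' s x c : measurable_fun setT h -> measurable_fun setT h' ->
  (forall y, `|h y| <= c) -> (forall y, `|h' y| <= c) ->
  (forall y, h y <= h' y) -> heat s h x <= heat s h' x.
Proof.
move=> mh mh' hc hc' hh'; apply: le_Rintegral => //.
- exact: integrable_mul_pdf hc.
- exact: integrable_mul_pdf hc'.
- by move=> y _; rewrite ler_wpM2r ?normal_pdf_ge0.
Qed.

Lemma heat_cst c s x : heat s (cst c) x = c.
Proof. exact: Rintegral_cst_pdf. Qed.

Lemma Rintegral_pdf_le (f : R -> R) s x c : measurable_fun setT f ->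
  (forall y, `|f y| <= c * normal_pdf x s y) -> `|\int[mu]_y f y| <= c.
Proof.
move=> mf fc.
have ig : mu.-integrable setT (fun y => (c * normal_pdf x s y)%:E).
  exact: (integrableZl measurableT c (@integrable_normal_pdf R x s)).
have if_ : mu.-integrable setT (EFin \o f).
  apply: (@le_integrable _ _ _ mu setT measurableT _ _ _ _ ig).
  - exact/measurable_EFinP.
  - by move=> y _ /=; rewrite lee_fin (le_trans (fc y))// ler_norm.
apply: le_trans (le_normr_Rintegral measurableT if_) _.
rewrite -[leRHS](Rintegral_cst_pdf s x); apply: le_Rintegral => //.
exact: (integrable_norm if_).
Qed.

Lemma bern_heat h s t x : measurable_fun setT h -> (forall y, `|h y| <= 1) ->
  0 < s -> (t / s) ^+ 2 <= 2^-1 ->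
  `|bern t (heat s h) x - heat (Num.sqrt (s ^+ 2 + t ^+ 2)) h x|
    <= bern_cst * ((t / s) ^+ 2) ^+ 2.
Proof.
move=> mh h1 s0 ts; set s' := Num.sqrt _.
have ih x' s'' := integrable_mul_pdf s'' x' mh h1.
have -> : bern t (heat s h) x - heat s' h x = \int[mu]_y (h y *
    ((normal_pdf (x - t) s y + normal_pdf (x + t) s y) / 2 - normal_pdf x s' y)).
  have i2 : mu.-integrable setT (EFin \o
      (fun y => h y * normal_pdf (x - t) s y + h y * normal_pdf (x + t) s y)).
    exact: (integrableD measurableT (ih _ _) (ih _ _)).
  have i3 : mu.-integrable setT (EFin \o (fun y => 2^-1 *
      (h y * normal_pdf (x - t) s y + h y * normal_pdf (x + t) s y))).
    exact: (integrableZl measurableT 2^-1 i2).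
  transitivity (\int[mu]_y (2^-1 * (h y * normal_pdf (x - t) s y +
      h y * normal_pdf (x + t) s y) - h y * normal_pdf x s' y)).
    rewrite RintegralB//; last exact: ih.
    rewrite RintegralZl// RintegralD//; try exact: ih.
    by rewrite mulrC.
  by apply: eq_Rintegral => y _; field.
apply: (@Rintegral_pdf_le _ (2 * s) x).
  apply: measurable_funM => //; apply: measurable_funB.
    apply: measurable_funM => //; apply: measurable_funD;
      exact: measurable_normal_pdf.
  exact: measurable_normal_pdf.
move=> y; rewrite normrM; apply: le_trans (normal_pdf_bern _ _ s0 ts).
by rewrite ler_piMl.
Qed.

Lemma heat_initial h s x K : measurable_fun setT h -> (forall y, `|h y| <= 1) ->
  0 < s -> (forall y z, `|h y - h z| <= K * `|y - z|) ->
  `|heat s h x - h x| <= 2 * K * s.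
Proof.
move=> mh h1 s0 hK.
have K0 : 0 <= K.
  by have := le_trans (normr_ge0 _) (hK 1 0); rewrite subr0 normr1 mulr1.
have ih := integrable_mul_pdf s x mh h1.
rewrite -{1}(Rintegral_cst_pdf s x (h x)) -RintegralB//; last first.
  exact: (integrableZl measurableT (h x) (@integrable_normal_pdf R x s)).
apply: (@Rintegral_pdf_le _ (2 * s) x).
  by apply: measurable_funB; apply: measurable_funM => //;
    exact: measurable_normal_pdf.
move=> y; rewrite -mulrBl normrM (ger0_norm (normal_pdf_ge0 _ _ _)).
apply: (@le_trans _ _ (K * (`|y - x| * normal_pdf x s y))).
  by rewrite mulrA ler_wpM2r ?normal_pdf_ge0.
have := ler_wpM2l K0 (normal_pdf_dist x y s0); lra.
Qed.

(** Starting from a function already smoothed at variance [tau] keeps [t / s] small at every step.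
    The errors of the steps simply add, because [bern] contracts the sup distance. *)
Lemma bern_iter_heat h tau t N x : measurable_fun setT h ->
  (forall y, `|h y| <= 1) -> 0 < tau -> t ^+ 2 / tau <= 2^-1 ->
  `|iter N (bern t) (heat (Num.sqrt tau) h) x
    - heat (Num.sqrt (tau + N%:R * t ^+ 2)) h x|
  <= N%:R * (bern_cst * (t ^+ 2 / tau) ^+ 2).
Proof.
move=> mh h1 tau0 ttau; elim: N x => [|N IH] x.
  by rewrite /= !mul0r addr0 subrr normr0.
rewrite iterS; set g := iter _ _ _; set s := Num.sqrt (tau + N%:R * t ^+ 2).
have tN0 : 0 < tau + N%:R * t ^+ 2 by rewrite ltr_wpDr// mulr_ge0// sqr_ge0.
have s0 : 0 < s by rewrite sqrtr_gt0.
have s2 : s ^+ 2 = tau + N%:R * t ^+ 2 by rewrite sqr_sqrtr// ltW.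
have ss : (t / s) ^+ 2 <= t ^+ 2 / tau.
  rewrite expr_div_n ler_wpM2l ?sqr_ge0// lef_pV2 ?posrE ?exprn_gt0// s2.
  by rewrite lerDl mulr_ge0// sqr_ge0.
have step := bern_heat x mh h1 s0 (le_trans ss ttau).
rewrite s2 -addrA -{2}[t ^+ 2]mul1r -mulrDl natr1 in step.
have step' : `|bern t g x - bern t (heat s h) x| <= N%:R * (bern_cst * (t ^+ 2 / tau) ^+ 2).
  by have /= := bern_iter_dist t 1 IH x.
rewrite -[in leRHS]natr1 mulrDl mul1r.
apply: le_trans (ler_distD (bern t (heat s h) x) _ _) _; apply: lerD step' _.
apply: le_trans step _; rewrite ler_wpM2l ?(ltW (@bern_cst_gt0 R))//.
rewrite lerXn2r ?nnegrE ?sqr_ge0//.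
by rewrite divr_ge0 ?sqr_ge0// ltW.
Qed.

(** A quantitative central limit theorem: the initial smoothing costs [2 * K * Num.sqrt tau], and
    since [N%:R * t ^+ 2 <= 1] the kernel errors sum to order [t ^+ 2 / tau ^+ 2]. *)
Lemma bern_clt h tau t N K x : measurable_fun setT h ->
  (forall y, `|h y| <= 1) -> (forall y z, `|h y - h z| <= K * `|y - z|) ->
  0 < tau -> t ^+ 2 / tau <= 2^-1 -> tau + N%:R * t ^+ 2 = 1 ->
  `|iter N (bern t) h x - heat 1 h x| <=
    2 * K * Num.sqrt tau + bern_cst * t ^+ 2 / tau ^+ 2.
Proof.
move=> mh h1 hK tau0 ttau tN.
have := bern_iter_heat N x mh h1 tau0 ttau; rewrite tN sqrtr1 => e2.
have st0 : 0 < Num.sqrt tau by rewrite sqrtr_gt0.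
have e1 := bern_iter_dist t N (fun x => heat_initial x mh h1 st0 hK) x.
rewrite distrC in e1.
apply: le_trans (ler_distD (iter N (bern t) (heat (Num.sqrt tau) h) x) _ _) _.
apply: lerD e1 _; apply: le_trans e2 _.
have -> : N%:R * (bern_cst * (t ^+ 2 / tau) ^+ 2) =
   (N%:R * t ^+ 2) * (bern_cst * t ^+ 2 / tau ^+ 2) by field; rewrite gt_eqF.
apply: ler_piMl; last by rewrite -[leRHS]tN lerDr ltW.
by rewrite divr_ge0 ?sqr_ge0// mulr_ge0 ?sqr_ge0// ltW// bern_cst_gt0.
Qed.

(** Under [Phi] the walk becomes plain averaging, which [bern_clt] compares with [heat 1]. So
    [walk_iter] passes to the limit, [tau] being chosen first and the step afterwards. *)
Lemma gaussian_sup_convolution (E l L K : R) (U V : R -> R) x :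
  0 < l -> 0 <= L -> (forall y, `|U y| <= L) -> (forall y, `|V y| <= L) ->
  (forall y z, `|Phi (U y) - Phi (U z)| <= K * `|y - z|) ->
  (forall y z, `|Phi (V y) - Phi (V z)| <= K * `|y - z|) ->
  measurable_fun setT (@Phi R \o U) -> measurable_fun setT (@Phi R \o V) ->
  (forall y z, U z + gprofile l (E - (y - z) ^+ 2) <= V y) ->
  iPhi (heat 1 (@Phi R \o U) x) + gprofile l E <= iPhi (heat 1 (@Phi R \o V) x).
Proof.
move=> l0 L0 UL VL UK VK mU mV UV.
have Phi1 W (y : R) : `|(@Phi R \o W) y| <= 1.
  by rewrite /= ger0_norm ?(ltW (Phi_gt0 _))// ltW// Phi_lt1.
have K0 : 0 <= K.
  by have := le_trans (normr_ge0 _) (UK 1 0); rewrite subr0 normr1 mulr1.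
have heat01 W : measurable_fun setT (@Phi R \o W) -> (forall y, `|W y| <= L) ->
    0 < heat 1 (@Phi R \o W) x < 1.
  move=> mW WL.
  have lo : Phi (- L) <= heat 1 (@Phi R \o W) x.
    rewrite -[leLHS](heat_cst _ 1 x); apply: (@heat_le _ _ _ _ 1) => //.
      by move=> y; rewrite /= ger0_norm ?(ltW (Phi_gt0 _))// ltW// Phi_lt1.
    by move=> y; rewrite /= Phi_mono; have := WL y; rewrite ler_norml => /andP[].
  have hi : heat 1 (@Phi R \o W) x <= Phi L.
    rewrite -[leRHS](heat_cst _ 1 x); apply: (@heat_le _ _ _ _ 1) => //.
      by move=> y; rewrite /= ger0_norm ?(ltW (Phi_gt0 _))// ltW// Phi_lt1.
    by move=> y; rewrite /= Phi_mono; have := WL y; rewrite ler_norml => /andP[].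
  by rewrite (lt_le_trans (Phi_gt0 _) lo) (le_lt_trans hi (Phi_lt1 _)).
have P01 := heat01 _ mU UL; have P'01 := heat01 _ mV VL.
set P := heat 1 (@Phi R \o U) x in P01 *.
set P' := heat 1 (@Phi R \o V) x in P'01 *.
set G := gprofile l E.
(* The approximation errors live on the scale of [Phi]. The margins [c < iPhi P] and [e] absorb them
   there, which avoids a modulus of continuity for [iPhi]. *)
have main c e : c < iPhi P -> 0 < e -> Phi (c + G) <= P' + e.
  rewrite -Phi_lt_mono iPhiK// => cP e0.
  pose d := Num.min (e / 2) (P - Phi c).
  have d0 : 0 < d by rewrite lt_min divr_gt0//= subr_gt0.
  have de : d <= e / 2 by rewrite ge_min lexx.
  have dP : d <= P - Phi c by rewrite ge_min lexx orbT.
  (* [st] is the square root of [tau]; its size makes the smoothing cost [2 * K * st] at most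
     [d / 2], leaving the other half of [d] to the kernel errors. *)
  pose st := Num.min 2^-1 (d / (4 * K + 1)).
  have K40 : 0 < 4 * K + 1 by lra.
  have st0 : 0 < st by rewrite lt_min invr_gt0 ltr0n/= divr_gt0.
  have st1 : st <= 2^-1 by rewrite ge_min lexx.
  have stK : 2 * K * st <= d / 2.
    have : st <= d / (4 * K + 1) by rewrite ge_min lexx orbT.
    by rewrite ler_pdivlMr//; nra.
  pose tau := st ^+ 2.
  have tau0 : 0 < tau by rewrite exprn_gt0.
  have tau1 : tau <= 4^-1 by rewrite /tau; nra.
  have [C [t0 [C0 t00 H]]] := walk_iter E l0 tau0 L0.
  pose t1 := Num.min (Num.min t0 (e / (2 * (C + 1))))
    (Num.min (tau * 2^-1) (d * tau ^+ 2 / (2 * bern_cst))).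
  have C10 : 0 < C + 1 by rewrite ltr_wpDl.
  have t10 : 0 < t1.
    by rewrite !lt_min t00/= !divr_gt0 ?mulr_gt0 ?exprn_gt0 ?bern_cst_gt0.
  (* The number of steps is fixed before their length, so that the variance is exactly [1 - tau] and
     still [t <= t1]. *)
  have [N Nt1] : exists N : nat, t1 ^- 2 < N.+1%:R.
    exists (Num.truncn (t1 ^- 2)); exact: truncnS_gt.
  pose t := Num.sqrt ((1 - tau) / N.+1%:R).
  have N0 : 0 < N.+1%:R :> R by rewrite ltr0n.
  have t2 : t ^+ 2 = (1 - tau) / N.+1%:R.
    by rewrite sqr_sqrtr// divr_ge0//; move: tau1; clear; lra.
  have tgt0 : 0 < t by rewrite sqrtr_gt0 divr_gt0//; move: tau1; clear; lra.
  have tt1 : t <= t1.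
    rewrite -(@ler_pXn2r _ 2) ?nnegrE ?(ltW tgt0) ?(ltW t10)// t2.
    rewrite ler_pdivrMr// -ler_pdivrMl ?exprn_gt0//.
    apply: le_trans (ltW Nt1); rewrite ler_piMr ?invr_ge0 ?sqr_ge0//.
    by move: tau0; clear; lra.
  have tt0 : t <= t0 by rewrite (le_trans tt1)// !ge_min lexx.
  have tC : C * t <= e / 2.
    have : t <= e / (2 * (C + 1)) by rewrite (le_trans tt1)// !ge_min lexx orbT.
    by rewrite ler_pdivlMr ?mulr_gt0//; move: C0 tgt0; clear; nra.
  have tt1' : t <= 1.
    rewrite (le_trans tt1)// !ge_min (_ : tau * 2^-1 <= 1) ?orbT//.
    by move: tau1; clear; lra.
  have tsq : t ^+ 2 <= t by rewrite expr2 ler_piMr// ltW.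
  have ttau : t ^+ 2 / tau <= 2^-1.
    rewrite ler_pdivrMr// mulrC (le_trans tsq)// (le_trans tt1)//.
    by rewrite !ge_min lexx !orbT.
  have tdtau : bern_cst * t ^+ 2 / tau ^+ 2 <= d / 2.
    rewrite ler_pdivrMr ?exprn_gt0//.
    have : t <= d * tau ^+ 2 / (2 * bern_cst).
      by rewrite (le_trans tt1)// !ge_min lexx !orbT.
    rewrite ler_pdivlMr ?mulr_gt0 ?bern_cst_gt0// => tB.
    have : bern_cst * t ^+ 2 <= bern_cst * t.
      by rewrite ler_wpM2l ?(ltW (@bern_cst_gt0 R)).
    by move: tB; clear; lra.
  have Nt : N.+1%:R * t ^+ 2 = 1 - tau by rewrite t2 mulrCA divff ?mulr1// gt_eqF.
  have tN : tau + N.+1%:R * t ^+ 2 = 1 by rewrite Nt subrKC.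
  have sttau : Num.sqrt tau = st by rewrite sqrtr_sqr ger0_norm// ltW.
  have cltU := bern_clt x mU (Phi1 U) UK tau0 ttau tN.
  have cltV := bern_clt x mV (Phi1 V) VK tau0 ttau tN.
  rewrite sttau -!Phi_walk_iter in cltU cltV.
  have UVs : shifted_above E l 0 0 U V.
    by move=> y z; rewrite !subr0 divr1; exact: UV.
  have := H N.+1 t U V tgt0 tt0 _ UL VL UVs x; rewrite Nt lexx => /(_ isT).
  set u := iter _ _ U x in cltU *; set v := iter _ _ V x in cltV * => uv.
  have cu : c <= u.
    rewrite -Phi_mono; move: cltU; rewrite ler_norml => /andP[+ _].
    by rewrite -/P; move: stK tdtau dP; clear; lra.
  have vP : Phi v <= P' + e / 2.
    move: cltV; rewrite ler_norml => /andP[_]; rewrite -/P'.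
    by move: stK tdtau de; clear; lra.
  have : Phi (c + G) <= Phi (v + C * t).
    by rewrite Phi_mono; move: uv cu; rewrite -/G; clear; lra.
  have := Phi_lipschitz (v + C * t) v; rewrite addrAC subrr add0r.
  rewrite [X in _ <= X]ger0_norm ?mulr_ge0 ?(ltW tgt0)// ler_norml => /andP[_].
  by move: vP tC; clear; lra.
clearbody P P' G; rewrite leNgt; apply/negP => lt.
pose c := (iPhi P' - G + iPhi P) / 2.
have [cP Pc] : c < iPhi P /\ iPhi P' < c + G.
  by move: lt; rewrite /c; clear; move: (iPhi P) (iPhi P') G => u v g; split; lra.
have : P' < Phi (c + G) by rewrite -[ltLHS]iPhiK// Phi_lt_mono.
rewrite -subr_gt0 => d0.
have := main c ((Phi (c + G) - P') / 2) cP; rewrite divr_gt0// => /(_ isT).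
by lra.
Qed.

End heat_semigroup.

(** * Gaussian isoperimetry in higher dimension *)

Section euclidean_norm.
Context {R : realType} {n : nat}.
Implicit Types (x y z : 'rV[R]_n) (c e : R).

Lemma dotrC x y : dotr x y = dotr y x.
Proof. by apply: eq_bigr => i _; rewrite mulrC. Qed.

Lemma dotrDl x y z : dotr (x + y) z = dotr x z + dotr y z.
Proof. by rewrite -big_split; apply: eq_bigr => i _; rewrite mxE mulrDl. Qed.

Lemma dotrZl c x y : dotr (c *: x) y = c * dotr x y.
Proof. by rewrite mulr_sumr; apply: eq_bigr => i _; rewrite mxE mulrA. Qed.

Lemma dotrNl x y : dotr (- x) y = - dotr x y.
Proof. by rewrite -scaleN1r dotrZl mulN1r. Qed.

Lemma dotrBl x y z : dotr (x - y) z = dotr x z - dotr y z.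
Proof. by rewrite dotrDl dotrNl. Qed.

Lemma dotrDr x y z : dotr x (y + z) = dotr x y + dotr x z.
Proof. by rewrite dotrC dotrDl !(dotrC _ x). Qed.

Lemma dotrZr c x y : dotr x (c *: y) = c * dotr x y.
Proof. by rewrite dotrC dotrZl dotrC. Qed.

Lemma dotrNr x y : dotr x (- y) = - dotr x y.
Proof. by rewrite dotrC dotrNl dotrC. Qed.

Lemma dotrBr x y z : dotr x (y - z) = dotr x y - dotr x z.
Proof. by rewrite dotrDr dotrNr. Qed.

Lemma dotr_ge0 x : 0 <= dotr x x.
Proof. by apply: sumr_ge0 => i _; rewrite -expr2 sqr_ge0. Qed.

Lemma enorm_ge0 x : 0 <= enorm x.
Proof. exact: sqrtr_ge0. Qed.

Lemma sqr_enorm x : enorm x ^+ 2 = dotr x x.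
Proof. by rewrite sqr_sqrtr// dotr_ge0. Qed.

Lemma enormN x : enorm (- x) = enorm x.
Proof. by rewrite /enorm dotrNl dotrNr opprK. Qed.

Lemma enormB x y : enorm (x - y) = enorm (y - x).
Proof. by rewrite -enormN opprB. Qed.

Lemma enormZ c x : enorm (c *: x) = `|c| * enorm x.
Proof.
by rewrite /enorm dotrZl dotrZr mulrA -expr2 sqrtrM ?sqr_ge0// sqrtr_sqr.
Qed.

Lemma enorm0 : enorm (0 : 'rV[R]_n) = 0.
Proof. by rewrite -(scale0r (0 : 'rV_n)) enormZ normr0 mul0r. Qed.

Lemma enorm_eq0 x : enorm x = 0 -> x = 0.
Proof.
move=> /(congr1 (fun u => u ^+ 2)); rewrite sqr_enorm expr0n/= => /eqP.
rewrite psumr_eq0; last by move=> i _; rewrite -expr2 sqr_ge0.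
move=> /allP x0; apply/rowP => i; rewrite mxE.
by have := x0 i (mem_index_enum _); rewrite /= mulf_eq0 orbb => /eqP.
Qed.

Lemma cauchy_schwarz x y : dotr x y <= enorm x * enorm y.
Proof.
have [/enorm_eq0 ->|y0] := eqVneq (enorm y) 0.
  by rewrite -[X in dotr x X](scale0r x) dotrZr mul0r mulr_ge0 ?enorm_ge0.
have {}y0 : 0 < enorm y by rewrite lt_neqAle eq_sym y0 enorm_ge0.
have := dotr_ge0 (enorm y ^+ 2 *: x - dotr x y *: y).
rewrite dotrBl !dotrBr !dotrZl !dotrZr (dotrC y x) -!sqr_enorm.
set A := enorm x; set B := dotr x y; set C := enorm y in y0 * => h.
have {}h : 0 <= C ^+ 2 * ((A * C) ^+ 2 - B ^+ 2) by move: h; rewrite exprMn; lra.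
have AC : 0 <= A * C by rewrite mulr_ge0 ?enorm_ge0.
rewrite leNgt; apply/negP => lt; move: h; apply/negP; rewrite -ltNge.
by rewrite pmulr_rlt0 ?exprn_gt0// subr_lt0 ltrXn2r.
Qed.

Lemma enormD x y : enorm (x + y) <= enorm x + enorm y.
Proof.
rewrite -(@ler_pXn2r _ 2) ?nnegrE ?addr_ge0 ?enorm_ge0//.
rewrite sqr_enorm dotrDl !dotrDr (dotrC y x) -!sqr_enorm sqrrD.
by have := cauchy_schwarz x y; lra.
Qed.

Lemma enorm_distD z x y : enorm (x - y) <= enorm (x - z) + enorm (z - y).
Proof. by rewrite -[x - y](subrKA z) enormD. Qed.

(** The crude factor [n] suffices, as this only transfers Euclidean Lipschitz bounds to the topology
    of the sup norm. *)
Lemma enorm_le_coord x e : (forall i, `|x 0 i| <= e) -> enorm x <= n%:R * e.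
Proof.
move=> xe; have [i0 _|noI] := pickP [pred i : 'I_n | true]; last first.
  have n0 : n = 0%N by case: (posnP n) => // n0; have := noI (Ordinal n0).
  rewrite /enorm /dotr big_pred0 ?sqrtr0 => [|i]; last by have := noI i.
  by rewrite [X in X%:R]n0 mul0r.
have e0 : 0 <= e by exact: le_trans (xe i0).
have ne0 : 0 <= n%:R * e by rewrite mulr_ge0.
rewrite -(@ler_pXn2r _ 2) ?nnegrE ?enorm_ge0// sqr_enorm.
apply: (@le_trans _ _ (\sum_(i < n) e ^+ 2)).
  apply: ler_sum => i _; rewrite -expr2 -real_normK ?num_real//.
  by rewrite lerXn2r ?nnegrE.
rewrite sumr_const card_ord -[e ^+ 2 *+ _]mulr_natl exprMn ler_wpM2r ?sqr_ge0//.
by rewrite expr2 ler_peMr ?ler0n// ler1n (leq_ltn_trans _ (ltn_ord i0)).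
Qed.

Definition enorm_lipschitz (K : R) (f : 'rV[R]_n -> R) :=
  forall x y, `|f x - f y| <= K * enorm (x - y).

Lemma enorm_lipschitz_continuous K f : enorm_lipschitz K f -> continuous f.
Proof.
move=> fK x P /nbhs_ballP[e /= e0 eP].
have K0 : 0 < `|K| + 1 by rewrite ltr_wpDl.
(* The successor and the added 1 keep the radius meaningful for [n = 0] and [K = 0]. *)
have d0 : 0 < e / ((`|K| + 1) * n.+1%:R) by rewrite divr_gt0// mulr_gt0.
apply/nbhs_ballP; exists (e / ((`|K| + 1) * n.+1%:R)) => //= y [_ xy'].
apply: eP; rewrite /ball/=.
have xy i : `|(x - y) 0 i| <= e / ((`|K| + 1) * n.+1%:R).
  by have := xy' 0 i; rewrite !mxE => /ltW.
apply: le_lt_trans (fK x y) _.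
apply: (@le_lt_trans _ _ (`|K| * (n%:R * (e / ((`|K| + 1) * n.+1%:R))))).
  apply: (@le_trans _ _ (`|K| * enorm (x - y))).
    by rewrite ler_wpM2r ?enorm_ge0// ler_norm.
  by rewrite ler_wpM2l// enorm_le_coord.
have -> : `|K| * (n%:R * (e / ((`|K| + 1) * n.+1%:R))) =
    e * (`|K| / (`|K| + 1)) * (n%:R / n.+1%:R).
  by rewrite invfM; move: (_^-1) (_^-1) (n%:R : R) => u v w; ring.
rewrite -mulrA gtr_pMr// -[ltRHS]mulr1.
have Kl : `|K| / (`|K| + 1) < 1 by rewrite ltr_pdivrMr// mul1r ltrDl.
have nl : n%:R / n.+1%:R <= 1 :> R by rewrite ler_pdivrMr ?ltr0n// mul1r ler_nat.
apply: (@le_lt_trans _ _ (`|K| / (`|K| + 1))); last by rewrite mulr1.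
by rewrite ler_piMr// divr_ge0// ltW.
Qed.

Lemma continuous_measurable_borelRn (f : 'rV[R]_n -> R) :
  continuous f -> measurable_fun setT (f : borelRn R n -> R).
Proof.
move=> cf; apply: (measurability _ (RGenOpens.measurableE R)).
move=> _ [_ [x [y ->]] <-].
rewrite setTI; apply: sub_sigma_algebra.
by apply: open_comp; [move=> v _; exact: cf|exact: interval_open].
Qed.

Lemma enorm_lipschitz_measurable K f : enorm_lipschitz K f ->
  measurable_fun setT (f : borelRn R n -> R).
Proof.
move=> fK; apply: continuous_measurable_borelRn.
exact: enorm_lipschitz_continuous fK.
Qed.

Lemma measurable_coord (i : 'I_n) :
  measurable_fun setT ((fun x => x 0 i) : borelRn R n -> R).
Proof.
by apply: continuous_measurable_borelRn => v; exact: coord_continuous.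
Qed.

Lemma measurable_dotr (y : 'rV[R]_n) :
  measurable_fun setT ((fun x => dotr x y) : borelRn R n -> R).
Proof.
by apply: measurable_sum => i; apply: measurable_funM => //; exact: measurable_coord.
Qed.

Lemma gauss_densityE (x : 'rV[R]_n) : gauss_density x =
  (2 * pi) `^ (- (n%:R / 2)) * expR (- (dotr x x / 2)).
Proof. by rewrite /gauss_density sqr_enorm. Qed.

Lemma gauss_density_gt0 (x : 'rV[R]_n) : 0 < gauss_density x.
Proof. by rewrite mulr_gt0 ?expR_gt0// powR_gt0// mulr_gt0// pi_gt0. Qed.

Lemma measurable_gauss_density (a : 'rV[R]_n) :
  measurable_fun setT ((fun x => gauss_density (x - a)) : borelRn R n -> R).
Proof.
under eq_fun do rewrite gauss_densityE.
apply: measurable_funM => //; apply: measurableT_comp => //.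
apply: measurableT_comp => //; apply: measurable_funM => //.
apply: measurable_sum => i; apply: measurable_funM.
  under eq_fun do rewrite !mxE.
  by apply: measurable_funB => //; exact: measurable_coord.
under eq_fun do rewrite !mxE.
by apply: measurable_funB => //; exact: measurable_coord.
Qed.

End euclidean_norm.

Section density_average.
Context d (T : measurableType d) (R : realType) (mu : {measure set T -> \bar R}).
Variable rho : T -> R.
Hypothesis rho_ge0 : forall x, 0 <= rho x.
Hypothesis mrho : measurable_fun setT rho.
Hypothesis irho : (\int[mu]_x (rho x)%:E = 1)%E.
Implicit Types (k : T -> R) (c l u e : R).

Let integrable_rho : mu.-integrable setT (EFin \o rho).
Proof.
apply/integrableP; split; first exact/measurable_EFinP.
under eq_integral do rewrite /= ger0_norm//.
by rewrite irho ltry.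
Qed.

Lemma integrable_density k c : measurable_fun setT k ->
  (forall x, `|k x| <= c) -> mu.-integrable setT (fun x => (k x * rho x)%:E).
Proof.
move=> mk kc; apply: (@le_integrable _ _ _ mu setT measurableT _
    (fun y => (c * rho y)%:E)).
- by apply/measurable_EFinP; exact: measurable_funM.
- move=> y _ /=; rewrite lee_fin !normrM ler_wpM2r// (le_trans (kc y))//.
  exact: ler_norm.
- exact: (integrableZl measurableT c integrable_rho).
Qed.

Lemma davg_cst c : \int[mu]_x (c * rho x) = c.
Proof. by rewrite RintegralZl// /Rintegral irho mulr1. Qed.

Lemma davg_le k k' c : measurable_fun setT k -> measurable_fun setT k' ->
  (forall x, `|k x| <= c) -> (forall x, `|k' x| <= c) ->
  (forall x, k x <= k' x) ->
  \int[mu]_x (k x * rho x) <= \int[mu]_x (k' x * rho x).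
Proof.
move=> mk mk' kc kc' kk'; apply: le_Rintegral => //.
- exact: integrable_density kc.
- exact: integrable_density kc'.
- by move=> y _; rewrite ler_wpM2r.
Qed.

Lemma davg_bounds k l u : measurable_fun setT k -> (forall x, l <= k x <= u) ->
  l <= \int[mu]_x (k x * rho x) <= u.
Proof.
move=> mk kb.
have kc x : `|k x| <= `|l| + `|u|.
  have /andP[lk ku] := kb x; rewrite ler_norml.
  have := ler_norm u; have := ler_norm (- l); rewrite normrN.
  have := normr_ge0 l; have := normr_ge0 u.
  by move=> ? ? ? ?; apply/andP; split; lra.
rewrite -{1}(davg_cst l) -{1}(davg_cst u); apply/andP; split.
  apply: (@davg_le (cst l) k (`|l| + `|u|)) => // x; first by rewrite lerDl.
  by have /andP[] := kb x.
apply: (@davg_le k (cst u) (`|l| + `|u|)) => // x; first by rewrite lerDr.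
by have /andP[] := kb x.
Qed.

Lemma davg_dist k k' c e : measurable_fun setT k -> measurable_fun setT k' ->
  (forall x, `|k x| <= c) -> (forall x, `|k' x| <= c) ->
  (forall x, `|k x - k' x| <= e) ->
  `|\int[mu]_x (k x * rho x) - \int[mu]_x (k' x * rho x)| <= e.
Proof.
move=> mk mk' kc kc' kk'.
have shift (f g : T -> R) : measurable_fun setT f -> measurable_fun setT g ->
    (forall x, `|f x| <= c) -> (forall x, `|g x| <= c) ->
    (forall x, `|f x - g x| <= e) ->
    \int[mu]_x (f x * rho x) <= \int[mu]_x (g x * rho x) + e.
  move=> mf mg fc gc fg.
  rewrite -{1}(davg_cst e) -RintegralD//.
  - under [leRHS]eq_Rintegral do rewrite -mulrDl.
    apply: (@davg_le _ (fun x => g x + e) (c + `|e|)) => // x.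
    + exact: measurable_funD.
    + by rewrite (le_trans (fc x))// lerDl.
    + by rewrite (le_trans (ler_normD _ _))// lerD2r.
    + by have := fg x; rewrite ler_norml => /andP[_]; lra.
  - exact: integrable_density gc.
  - exact: (integrableZl measurableT e integrable_rho).
rewrite ler_norml; apply/andP; split.
  rewrite lerBrDl lerBlDr; apply: shift => // x.
  by rewrite distrC.
by rewrite lerBlDl; exact: shift.
Qed.

End density_average.

Section gaussian_average.
Context {R : realType}.
Notation mu := (@lebesgue_measure R).

Definition hd n (a : 'rV[R]_n.+1) : R := a 0 ord0.
Definition tl n (a : 'rV[R]_n.+1) : 'rV[R]_n := \row_(j < n) a 0 (lift ord0 j).

Lemma dotr_cons n (t s : R) (v w : 'rV[R]_n) :
  dotr (consRn (t, v)) (consRn (s, w)) = t * s + dotr v w.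
Proof.
rewrite /dotr big_ord_recl !mxE unlift_none/=; congr (_ + _).
by apply: eq_bigr => i _; rewrite !mxE liftK.
Qed.

Lemma cons_hd_tl n (a : 'rV[R]_n.+1) : consRn (hd a, tl a) = a.
Proof.
by apply/rowP => i; rewrite mxE; case: unliftP => [j|] ->//=; rewrite mxE.
Qed.

Lemma consB n (t s : R) (v w : 'rV[R]_n) :
  consRn (t, v) - consRn (s, w) = consRn (t - s, v - w) :> 'rV[R]_n.+1.
Proof. by apply/rowP => i; rewrite !mxE; case: unliftP => [j|] _//=; rewrite !mxE. Qed.

Lemma gauss_density_cons n (t : R) (v : 'rV[R]_n) (a : 'rV[R]_n.+1) :
  gauss_density (consRn (t, v) - a) = gphi (t - hd a) * gauss_density (v - tl a).
Proof.
rewrite -{1}(cons_hd_tl a) consB !gauss_densityE dotr_cons /gphi.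
have pi20 : 0 < 2 * pi :> R by rewrite mulr_gt0// pi_gt0.
have -> : (2 * pi) `^ (- (n.+1%:R / 2)) =
    (Num.sqrt (2 * pi))^-1 * (2 * pi) `^ (- (n%:R / 2)) :> R.
  rewrite -[n.+1%:R]natr1.
  have -> : - ((n%:R + 1) / 2) = - 2^-1 + - (n%:R / 2) :> R by field.
  rewrite powRD; last by rewrite (gt_eqF pi20) implybT.
  by rewrite powRN powR12_sqrt ?(ltW pi20).
rewrite (mulrDl (_ * _)) opprD expRD expr2.
by move: (expR _) (expR _) (_^-1) (_ `^ _) => e1 e2 s p; ring.
Qed.

End gaussian_average.

(** * Gaussian averages in dimension [n], one coordinate at a time *)

Section gaussian_product.
Context {R : realType}.
Notation mu := (@lebesgue_measure R).

Lemma integral_lebesgue_Rn_cons n (f : borelRn R n.+1 -> \bar R) :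
  measurable_fun setT f -> (forall x, (0 <= f x)%E) ->
  (\int[lebesgue_Rn n.+1]_x f x =
   \int[mu]_t \int[lebesgue_Rn n]_v f (consRn (t, v)))%E.
Proof.
move=> mf f0.
transitivity (\int[(mu \x lebesgue_Rn n)%E]_z (f \o @consRn R n) z)%E.
  by apply: (ge0_integral_pushforward (@measurable_consRn R n) _ measurableT mf).
rewrite fubini_tonelli1//; last by move=> x; exact: f0.
exact: (measurableT_comp mf (@measurable_consRn R n)).
Qed.

Lemma measurable_cons_section n (f : borelRn R n.+1 -> R) t :
  measurable_fun setT f -> measurable_fun setT (fun v : borelRn R n => f (consRn (t, v))).
Proof.
move=> mf; apply: (measurableT_comp mf).
by apply: (measurableT_comp (@measurable_consRn R n)).
Qed.

Lemma integral_gauss_density n (a : 'rV[R]_n) :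
  (\int[lebesgue_Rn n]_x (gauss_density (x - a))%:E = 1)%E.
Proof.
elim: n a => [a|n IH a].
  rewrite integral_dirac//; last first.
    by apply/measurable_EFinP; exact: measurable_gauss_density.
  rewrite diracE in_setT mul1e.
  rewrite /gauss_density mul0r oppr0 powRr0 mul1r.
  by rewrite sqr_enorm /dotr big_ord0 mul0r oppr0 expR0.
rewrite integral_lebesgue_Rn_cons//; last 2 first.
- by apply/measurable_EFinP; exact: measurable_gauss_density.
- by move=> x; rewrite lee_fin ltW// gauss_density_gt0.
rewrite -[RHS](@integral_normal_pdf R (hd a) 1); apply: eq_integral => t _.
rewrite normal_pdf1E.
under eq_integral do rewrite gauss_density_cons EFinM.
rewrite ge0_integralZl//; last 3 first.
- by apply/measurable_EFinP; exact: measurable_gauss_density.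
- by move=> x _; rewrite lee_fin ltW// gauss_density_gt0.
- by rewrite lee_fin ltW// gphi_gt0.
by rewrite IH mule1.
Qed.

Definition gavg n (a : 'rV[R]_n) (k : 'rV[R]_n -> R) : R :=
  \int[lebesgue_Rn n]_x (k x * gauss_density (x - a)).

Lemma integrable_gavg n (a : 'rV[R]_n) (k : borelRn R n -> R) c :
  measurable_fun setT k -> (forall x, `|k x| <= c) ->
  (lebesgue_Rn n).-integrable setT (fun x => (k x * gauss_density (x - a))%:E).
Proof.
move=> mk kc; apply: (integrable_density _ _ _ mk kc).
- by move=> x; rewrite ltW// gauss_density_gt0.
- exact: measurable_gauss_density.
- exact: integral_gauss_density.
Qed.

Lemma EFin_gavg n (a : 'rV[R]_n) (k : borelRn R n -> R) c :
  measurable_fun setT k -> (forall x, `|k x| <= c) ->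
  (gavg a k)%:E = (\int[lebesgue_Rn n]_x (k x * gauss_density (x - a))%:E)%E.
Proof.
move=> mk kc; rewrite fineK//; apply: integrable_fin_num => //.
exact: integrable_gavg kc.
Qed.

(** Tonelli with the first coordinate outermost: the outer average is a [heat 1] on the line, to
    which the one-dimensional results apply. *)
Lemma gavg_cons n (a : 'rV[R]_n.+1) (k : borelRn R n.+1 -> R) c :
  measurable_fun setT k -> (forall x, 0 <= k x <= c) ->
  gavg a k = heat 1 (fun t => gavg (tl a) (fun v => k (consRn (t, v)))) (hd a).
Proof.
move=> mk kc.
have k0 x : 0 <= k x by have /andP[] := kc x.
have kc' x : `|k x| <= c by rewrite ger0_norm//; have /andP[] := kc x.
have g0 m (x : 'rV[R]_m) : 0 <= gauss_density x by rewrite ltW// gauss_density_gt0.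
rewrite /heat /gavg /Rintegral integral_lebesgue_Rn_cons; last 2 first.
- apply/measurable_EFinP; apply: measurable_funM => //.
  exact: measurable_gauss_density.
- by move=> x; rewrite lee_fin mulr_ge0.
congr fine; apply: eq_integral => t _; rewrite normal_pdf1E EFinM.
have mkt := measurable_cons_section t mk.
rewrite fineK; last first.
  by apply: integrable_fin_num => //; exact: (integrable_gavg _ mkt (fun v => kc' _)).
rewrite muleC -ge0_integralZl//; last 3 first.
- apply/measurable_EFinP; apply: measurable_funM => //.
  exact: measurable_gauss_density.
- by move=> x _; rewrite lee_fin mulr_ge0.
- by rewrite lee_fin ltW// gphi_gt0.
by apply: eq_integral => v _; rewrite gauss_density_cons -EFinM mulrCA.
Qed.

Lemma gavg_bounds n (a : 'rV[R]_n) (k : borelRn R n -> R) l u :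
  measurable_fun setT k -> (forall x, l <= k x <= u) -> l <= gavg a k <= u.
Proof.
move=> mk; apply: davg_bounds => //.
- by move=> x; rewrite ltW// gauss_density_gt0.
- exact: measurable_gauss_density.
- exact: integral_gauss_density.
Qed.

Lemma gavg_le n (a : 'rV[R]_n) (k k' : borelRn R n -> R) c :
  measurable_fun setT k -> measurable_fun setT k' ->
  (forall x, `|k x| <= c) -> (forall x, `|k' x| <= c) ->
  (forall x, k x <= k' x) -> gavg a k <= gavg a k'.
Proof.
apply: davg_le.
- by move=> x; rewrite ltW// gauss_density_gt0.
- exact: measurable_gauss_density.
- exact: integral_gauss_density.
Qed.

Lemma gavg_dist n (a : 'rV[R]_n) (k k' : borelRn R n -> R) c e :
  measurable_fun setT k -> measurable_fun setT k' ->
  (forall x, `|k x| <= c) -> (forall x, `|k' x| <= c) ->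
  (forall x, `|k x - k' x| <= e) -> `|gavg a k - gavg a k'| <= e.
Proof.
apply: davg_dist.
- by move=> x; rewrite ltW// gauss_density_gt0.
- exact: measurable_gauss_density.
- exact: integral_gauss_density.
Qed.

Lemma sqr_enorm_cons n (t s : R) (v w : 'rV[R]_n) :
  enorm (consRn (t, v) - consRn (s, w) : 'rV_n.+1) ^+ 2 =
  (t - s) ^+ 2 + enorm (v - w) ^+ 2.
Proof. by rewrite consB !sqr_enorm dotr_cons expr2. Qed.

Lemma lipschitz_measurable K (f : R -> R) :
  (forall x y, `|f x - f y| <= K * `|x - y|) -> measurable_fun setT f.
Proof.
move=> fK; apply: continuous_measurable_fun => x.
apply/cvgrPdist_lt => e e0.
have K0 : 0 < `|K| + 1 by rewrite ltr_wpDl.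
near=> y; apply: le_lt_trans (fK x y) _.
apply: (@le_lt_trans _ _ (`|K| * `|x - y|)); first by rewrite ler_wpM2r// ler_norm.
have : `|x - y| < e / (`|K| + 1).
  near: y; apply/nbhs_ballP; exists (e / (`|K| + 1)); first by rewrite /= divr_gt0.
  by [].
rewrite ltr_pdivlMr//; have := normr_ge0 (x - y); nra.
Unshelve. all: by end_near. Qed.

(* The sections at [y0] and [z0] of the first coordinate satisfy the hypothesis with
   [E - (y0 - z0) ^+ 2] in place of [E]. *)
Theorem gaussian_sup_convolution_Rn n (a : 'rV[R]_n) (E l L K : R)
    (U V : 'rV[R]_n -> R) :
  0 < l -> 0 <= L -> (forall y, `|U y| <= L) -> (forall y, `|V y| <= L) ->
  enorm_lipschitz K (@Phi R \o U) -> enorm_lipschitz K (@Phi R \o V) ->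
  (forall y z, U z + gprofile l (E - enorm (y - z) ^+ 2) <= V y) ->
  iPhi (gavg a (@Phi R \o U)) + gprofile l E <= iPhi (gavg a (@Phi R \o V)).
Proof.
move=> l0 L0.
have Phi01 (m : nat) (W : 'rV[R]_m -> R) : (forall y, `|W y| <= L) ->
    forall y, Phi (- L) <= (@Phi R \o W) y <= Phi L.
  by move=> WL y; have := WL y; rewrite ler_norml /= !Phi_mono.
have Phi1 (m : nat) (W : 'rV[R]_m -> R) y : `|(@Phi R \o W) y| <= 1.
  by rewrite /= ger0_norm ?(ltW (Phi_gt0 _))// ltW// Phi_lt1.
elim: n a E U V => [|n IH] a E U V UL VL UK VK UV.
  have all0 (x : 'rV[R]_0) : x = 0 by apply/rowP; case.
  have gavg0 (W : 'rV[R]_0 -> R) : gavg a (@Phi R \o W) = Phi (W 0).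
    have mW : measurable_fun setT (@Phi R \o W : borelRn R 0 -> R).
      by rewrite (_ : _ \o _ = cst (Phi (W 0)))//; apply/funext => x; rewrite (all0 x).
    apply/eqP; rewrite eq_le andbC; apply: gavg_bounds mW _ => x.
    by rewrite (all0 x) lexx.
  rewrite !gavg0 !PhiK; have := UV 0 0.
  by rewrite subrr enorm0 expr0n subr0.
have sec (W : 'rV[R]_n.+1 -> R) : (forall y, `|W y| <= L) ->
  enorm_lipschitz K (@Phi R \o W) -> exists W1 : R -> R,
  [/\ forall t, W1 t = iPhi (gavg (tl a) (@Phi R \o (fun v => W (consRn (t, v))))),
   forall t, `|W1 t| <= L,
   forall t s, `|Phi (W1 t) - Phi (W1 s)| <= K * `|t - s|,
   forall t, enorm_lipschitz K (@Phi R \o (fun v => W (consRn (t, v)))) &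
   gavg a (@Phi R \o W) = heat 1 (@Phi R \o W1) (hd a)].
  move=> WL WK.
  pose W1 t := iPhi (gavg (tl a) (@Phi R \o (fun v => W (consRn (t, v))))).
  have W1E t : W1 t = iPhi (gavg (tl a) (@Phi R \o (fun v => W (consRn (t, v))))) by [].
  have mW : measurable_fun setT (@Phi R \o W : borelRn R n.+1 -> R).
    exact: enorm_lipschitz_measurable WK.
  have mWt t := measurable_cons_section t mW.
  have bnd t : Phi (- L) <= gavg (tl a) (@Phi R \o (fun v => W (consRn (t, v)))) <= Phi L.
    by apply: gavg_bounds (mWt t) _ => v; exact: Phi01.
  have PW t : Phi (W1 t) = gavg (tl a) (@Phi R \o (fun v => W (consRn (t, v)))).
    rewrite W1E iPhiK//; have /andP[lo hi] := bnd t.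
    by rewrite (lt_le_trans (Phi_gt0 _) lo) (le_lt_trans hi (Phi_lt1 _)).
  clearbody W1; exists W1; split=> //.
  - by move=> t; rewrite ler_norml -Phi_mono -(Phi_mono _ L) PW.
  - move=> t s; rewrite (PW t) (PW s).
    apply: (@gavg_dist _ (tl a) _ _ 1 _ (mWt t) (mWt s)).
    + exact: Phi1.
    + exact: Phi1.
    + move=> v; apply: le_trans (WK _ _) _.
      rewrite le_eqVlt; apply/orP; left; apply/eqP; congr (K * _).
      apply/eqP; rewrite -(@eqrXn2 _ 2)// ?enorm_ge0// sqr_enorm_cons.
      by rewrite subrr enorm0 expr0n addr0 real_normK// num_real.
  - move=> t v w; apply: le_trans (WK _ _) _.
    rewrite le_eqVlt; apply/orP; left; apply/eqP; congr (K * _).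
    apply/eqP; rewrite -(@eqrXn2 _ 2)// ?enorm_ge0// sqr_enorm_cons.
    by rewrite subrr expr0n add0r.
  - rewrite (gavg_cons _ mW (c := 1)); last first.
      by move=> x; rewrite (ltW (Phi_gt0 _)) ltW// Phi_lt1.
    by congr heat; apply/funext => t; rewrite /= PW.
have [U1 [U1E UL1 UK1 UKt ->]] := sec U UL UK.
have [V1 [V1E VL1 VK1 VKt ->]] := sec V VL VK.
apply: (gaussian_sup_convolution (hd a) l0 L0 UL1 VL1 UK1 VK1).
- exact: lipschitz_measurable UK1.
- exact: lipschitz_measurable VK1.
move=> t s; rewrite (U1E s) (V1E t); apply: IH (UKt s) (VKt t) _ => // v w.
by rewrite -addrA -opprD -sqr_enorm_cons.
Qed.

End gaussian_product.

(** * Distance functions and neighbourhoods *)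

Section distance_to_set.
Context {R : realType} {n : nat}.
Implicit Types (x y z : 'rV[R]_n) (A : set 'rV[R]_n) (e : R).

(** For empty [A] the extended distance is infinite and [fine] returns 0; hence the nonemptiness
    assumptions that follow. *)
Definition rdist A x : R := fine (dist_set A x).

Lemma dist_setE A x : A !=set0 -> dist_set A x = (rdist A x)%:E.
Proof.
move=> [y Ay]; rewrite /rdist fineK//; rewrite ge0_fin_numE.
  by apply: (@le_lt_trans _ _ (enorm (x - y))%:E); [apply: ereal_inf_lbound; exists y|rewrite ltry].
by apply: le_ereal_inf_tmp => _ [z _ <-]; rewrite lee_fin enorm_ge0.
Qed.

Lemma rdist_le A x y : A y -> rdist A x <= enorm (x - y).
Proof.
move=> Ay; rewrite -lee_fin -dist_setE; last by exists y.
by apply: ereal_inf_lbound; exists y.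
Qed.

Lemma rdist_ge0 A x : 0 <= rdist A x.
Proof.
apply: fine_ge0; apply: le_ereal_inf_tmp => _ [z _ <-].
by rewrite lee_fin enorm_ge0.
Qed.

Lemma rdist_eq0 A x : A x -> rdist A x = 0.
Proof.
move=> Ax; apply/eqP; rewrite eq_le rdist_ge0 andbT.
by apply: le_trans (rdist_le x Ax) _; rewrite subrr enorm0.
Qed.

Lemma rdist_lt A x e : A !=set0 -> rdist A x < e -> exists2 y, A y & enorm (x - y) < e.
Proof.
move=> A0; rewrite -lte_fin -dist_setE// => /ereal_inf_lt[_ [y Ay <-]].
by rewrite lte_fin; exists y.
Qed.

Lemma rdist_leD A x y : A !=set0 -> rdist A x <= rdist A y + enorm (x - y).
Proof.
move=> A0; apply/ler_addgt0Pr => e e0.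
have [z Az yz] : exists2 z, A z & enorm (y - z) < rdist A y + e.
  by apply: rdist_lt => //; rewrite ltrDl.
apply: le_trans (rdist_le x Az) _; apply: le_trans (enorm_distD y _ _) _.
lra.
Qed.

Lemma rdist_lipschitz A x y : A !=set0 ->
  `|rdist A x - rdist A y| <= enorm (x - y).
Proof.
move=> A0; rewrite ler_norml; have := rdist_leD x y A0.
by have := rdist_leD y x A0; rewrite (enormB y); move=> ? ?; apply/andP; split; lra.
Qed.

Lemma nbhd_setE A e : A !=set0 -> nbhd_set A e = [set x | rdist A x < e].
Proof.
by move=> A0; apply/seteqP; split=> x; rewrite /nbhd_set/= dist_setE// lte_fin.
Qed.

Lemma measurable_nbhd_set (A : set (borelRn R n)) e : A !=set0 ->
  measurable (nbhd_set A e : set (borelRn R n)).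
Proof.
move=> A0; rewrite nbhd_setE//.
have mD : measurable_fun setT (rdist A : borelRn R n -> R).
  apply: (@enorm_lipschitz_measurable _ _ 1) => x y.
  by rewrite mul1r; exact: rdist_lipschitz.
rewrite (_ : [set x | _] = (rdist A : borelRn R n -> R) @^-1` `]-oo, e[).
  by rewrite -[X in measurable X]setTI; exact: mD.
by apply/seteqP; split=> x; rewrite /= in_itv.
Qed.

Lemma sub_nbhd_set A e : 0 < e -> A `<=` nbhd_set A e.
Proof.
move=> e0 x Ax; rewrite nbhd_setE; last by exists x.
by rewrite /= rdist_eq0.
Qed.

End distance_to_set.

(** * From functions to sets *)

Section gaussian_isoperimetry.
Context {R : realType} {n : nat}.
Implicit Types (a : 'rV[R]_n) (A : set (borelRn R n)) (e L : R).

Definition gpr a A : R := gavg a (\1_A : 'rV[R]_n -> R).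

Lemma norm_indic_le1 A (x : borelRn R n) : `|(\1_A x : R)| <= 1.
Proof. by rewrite ger0_norm// indicE; case: (_ \in _). Qed.

Lemma gavgZl a (k : borelRn R n -> R) b c : measurable_fun setT k ->
  (forall x, `|k x| <= b) -> gavg a (fun x => c * k x) = c * gavg a k.
Proof.
move=> mk kb; rewrite /gavg -RintegralZl//; last exact: (integrable_gavg _ mk kb).
by apply: eq_Rintegral => x _; rewrite mulrA.
Qed.

Lemma gavgD a (k k' : borelRn R n -> R) b : measurable_fun setT k ->
  measurable_fun setT k' -> (forall x, `|k x| <= b) -> (forall x, `|k' x| <= b) ->
  gavg a (fun x => k x + k' x) = gavg a k + gavg a k'.
Proof.
move=> mk mk' kb kb'; rewrite /gavg -RintegralD//.
- by apply: eq_Rintegral => x _; rewrite mulrDl.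
- exact: (integrable_gavg _ mk kb).
- exact: (integrable_gavg _ mk' kb').
Qed.

Lemma gavg_cst a c : gavg a (cst c) = c.
Proof.
by apply/eqP; rewrite eq_le andbC; apply: gavg_bounds => // x; rewrite lexx.
Qed.

Definition clamp (u : R) : R := Num.min 1 (Num.max 0 u).

Lemma clamp01 u : 0 <= clamp u <= 1.
Proof. by rewrite /clamp le_min ler01 le_max lexx/= ge_min lexx. Qed.

Lemma clamp_lip u v : `|clamp u - clamp v| <= `|u - v|.
Proof.
rewrite /clamp; wlog uv : u v / u <= v => [H|].
  have [|/ltW] := leP u v; first exact: H.
  by move=> /H; rewrite distrC [X in _ <= X]distrC.
rewrite [leRHS]distrC [leLHS]distrC [leRHS]ger0_norm ?subr_ge0//.
rewrite /Num.min /Num.max; do 4 case: ifPn; rewrite -?leNgt => *.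
all: rewrite ler_norml; apply/andP; split; lra.
Qed.

Lemma clamp1 u : 1 <= u -> clamp u = 1.
Proof.
by move=> u1; rewrite /clamp; apply/min_idPl; rewrite le_max u1 orbT.
Qed.

Lemma clamp0 u : u <= 0 -> clamp u = 0.
Proof.
move=> u0; rewrite /clamp (max_idPl u0).
by apply/min_idPr; exact: ler01.
Qed.

Lemma between_convex (s t c : R) : s <= t -> 0 <= c <= 1 -> s <= s + (t - s) * c <= t.
Proof. by move=> st /andP[c0 c1]; apply/andP; split; nra. Qed.

(** [U] equals [L] on [A] and [- L] beyond distance [dl], while [V] equals [L + e] up to distance
    [e1] and [e - L] beyond [e']. Ramps of width [dl], linear on the scale of [Phi], make both
    Lipschitz. The truncation at [L] causes the two losses in the statement. *)
Lemma gpr_expand a A e e' L : 0 < e -> e < e' -> 0 <= L -> measurable A -> A !=set0 ->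
  0 < gpr a A -> forall x, Phi x <= (Phi L - Phi (- L)) * gpr a A ->
  Phi (x + e) <= Phi (e - L) + gpr a (nbhd_set A e').
Proof.
move=> e0 ee' L0 mA A0 gA x xL.
pose dl := (e' - e) / 4.
have dl0 : 0 < dl by rewrite divr_gt0// subr_gt0.
pose e1 := e' - dl.
(* A point farther than [e1] from [A] and one nearer than [dl] are at least [e1 - dl > e] apart.
   [eta] is the excess of the squares, and [l] is taken so small that it brings the profile down to
   [- (2 * L)]. *)
pose eta := (e1 - dl) ^+ 2 - e ^+ 2.
have e1dl : e < e1 - dl by rewrite /e1 /dl; lra.
have eta0 : 0 < eta by rewrite subr_gt0 ltrXn2r// ?(ltW e0)// ltW// (lt_trans e0).
have L4 : 0 < 1 + 4 * L by lra.
pose l := Num.min e (Num.min 1 (eta / (1 + 4 * L))).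
have l0 : 0 < l by rewrite !lt_min e0 ltr01 divr_gt0.
have le : l <= e by rewrite ge_min lexx.
have l1 : l <= 1 by rewrite !ge_min lexx orbT.
have leta : l * (1 + 4 * L) <= eta.
  by rewrite -ler_pdivlMr// !ge_min lexx !orbT.
have lexp : l ^+ 2 + 4 * L * l <= eta by nra.
pose c0 y := clamp (1 - rdist A y / dl).
pose c1 y := clamp ((e' - rdist A y) / dl).
pose p y := Phi (- L) + (Phi L - Phi (- L)) * c0 y.
pose q y := Phi (e - L) + (Phi (L + e) - Phi (e - L)) * c1 y.
have pb y : Phi (- L) <= p y <= Phi L.
  by apply: between_convex; rewrite ?clamp01// Phi_mono; lra.
have qb y : Phi (e - L) <= q y <= Phi (L + e).
  by apply: between_convex; rewrite ?clamp01// Phi_mono; lra.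
pose U y := iPhi (p y); pose V y := iPhi (q y).
have PU y : Phi (U y) = p y.
  have /andP[lo hi] := pb y; rewrite iPhiK//.
  by rewrite (lt_le_trans (Phi_gt0 _) lo) (le_lt_trans hi (Phi_lt1 _)).
have PV y : Phi (V y) = q y.
  have /andP[lo hi] := qb y; rewrite iPhiK//.
  by rewrite (lt_le_trans (Phi_gt0 _) lo) (le_lt_trans hi (Phi_lt1 _)).
have Ub y : - L <= U y <= L by rewrite -(Phi_mono (- L)) -(Phi_mono (U y)) PU.
have Vb y : e - L <= V y <= L + e by rewrite -(Phi_mono (e - L)) -(Phi_mono (V y)) PV.
have UL y : `|U y| <= L + e.
  have /andP[] := Ub y; move: e0; rewrite ler_norml; clear.
  by move=> *; apply/andP; split; lra.
have VL y : `|V y| <= L + e.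
  have /andP[] := Vb y; move: e0; rewrite ler_norml; clear.
  by move=> *; apply/andP; split; lra.
have Dlip := fun y z => @rdist_lipschitz R n A y z A0.
have coef s t : `|Phi s - Phi t| <= 1 :> R.
  have := (Phi_gt0 s, Phi_gt0 t, Phi_lt1 s, Phi_lt1 t); rewrite ler_norml; clear.
  by move=> -[[[? ?] ?] ?]; apply/andP; split; lra.
have UK : enorm_lipschitz dl^-1 (@Phi R \o U).
  move=> y z; rewrite /= !PU /p opprD addrACA subrr add0r -mulrBr normrM.
  apply: (@le_trans _ _ `|c0 y - c0 z|); first by rewrite ler_piMl.
  apply: le_trans (clamp_lip _ _) _.
  rewrite opprD addrACA subrr add0r -opprD normrN -mulrBl normrM mulrC.
  by rewrite gtr0_norm ?invr_gt0// ler_wpM2l// invr_ge0 ltW.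
have VK : enorm_lipschitz dl^-1 (@Phi R \o V).
  move=> y z; rewrite /= !PV /q opprD addrACA subrr add0r -mulrBr normrM.
  apply: (@le_trans _ _ `|c1 y - c1 z|); first by rewrite ler_piMl.
  apply: le_trans (clamp_lip _ _) _.
  rewrite -mulrBl opprD addrACA subrr add0r -opprD normrM normrN mulrC.
  by rewrite gtr0_norm ?invr_gt0// ler_wpM2l// invr_ge0 ltW.
have G_le w : w <= e ^+ 2 -> gprofile l w <= e.
  move=> we; apply: le_trans (gprofile_tangent w l0 le) _.
  by rewrite ler_pdivrMr ?mulr_gt0//; nra.
have UV y z : U z + gprofile l (e ^+ 2 - enorm (y - z) ^+ 2) <= V y.
  have /andP[U1 U2] := Ub z; have /andP[V1 V2] := Vb y.
  have Ge : gprofile l (e ^+ 2 - enorm (y - z) ^+ 2) <= e.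
    by apply: G_le; rewrite gerBl sqr_ge0.
  (* Either [V y] has its largest value, or [U z] its smallest, or the points are so far apart that
     the condition is void. *)
  have [Dy|Dy] := leP (rdist A y) e1.
    have -> : V y = L + e.
      apply: Phi_inj; rewrite PV /q /c1 clamp1.
        by rewrite mulr1 addrC subrK.
      by rewrite ler_pdivlMr// mul1r lerBrDr addrC -lerBrDr.
    by move: U2 Ge; clear; lra.
  have [Dz|Dz] := leP dl (rdist A z).
    have -> : U z = - L.
      apply: Phi_inj; rewrite PU /p /c0 clamp0 ?mulr0 ?addr0//.
      by rewrite subr_le0 ler_pdivlMr// mul1r.
    by move: V1 Ge; clear; lra.
  have yz : e1 - dl <= enorm (y - z).
    have := Dlip y z; rewrite ler_norml => /andP[_].
    by move: Dy Dz; clear; lra.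
  have yz2 : (e1 - dl) ^+ 2 <= enorm (y - z) ^+ 2.
    by rewrite lerXn2r// ?nnegrE ?enorm_ge0// (ltW (lt_trans e0 e1dl)).
  have : gprofile l (e ^+ 2 - enorm (y - z) ^+ 2) <= - (2 * L).
    apply: gprofile_leN => //; move: lexp yz2; rewrite /eta; clear.
    by move: (enorm _) => w; lra.
  by move: U2 V1 e0; clear; lra.
have le' : 0 <= L + e by lra.
have := gaussian_sup_convolution_Rn a l0 le' UL VL UK VK UV.
rewrite gprofile_sqr//.
have mU : measurable_fun setT (@Phi R \o U : borelRn R n -> R).
  exact: enorm_lipschitz_measurable UK.
have mV : measurable_fun setT (@Phi R \o V : borelRn R n -> R).
  exact: enorm_lipschitz_measurable VK.
have Phi1 (W : 'rV[R]_n -> R) y : `|(@Phi R \o W) y| <= 1.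
  by rewrite /= ger0_norm ?(ltW (Phi_gt0 _))// ltW// Phi_lt1.
have pU : Phi x <= gavg a (@Phi R \o U).
  apply: le_trans xL _; rewrite /gpr -(gavgZl a _ (measurable_indic mA) (@norm_indic_le1 A)).
  apply: (@gavg_le _ _ a _ _ 1) => //.
  - by apply: measurable_funM => //; exact: measurable_indic.
  - by move=> y; rewrite normrM mulr_ile1// norm_indic_le1.
  - move=> y; rewrite /= PU indicE; case: (boolP (y \in A)) => [/set_mem Ay|_].
      rewrite /p /c0 (rdist_eq0 Ay) mul0r subr0 clamp1// !mulr1.
      by rewrite lerDr ltW// Phi_gt0.
    by rewrite mulr0 (le_trans _ (proj1 (andP (pb y))))// ltW// Phi_gt0.
have mN : measurable (nbhd_set A e' : set (borelRn R n)) by exact: measurable_nbhd_set.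
have pV : gavg a (@Phi R \o V) <= Phi (e - L) + gpr a (nbhd_set A e').
  rewrite -[X in X + _](gavg_cst a) /gpr -(@gavgD a (cst (Phi (e - L))) _ 1) //.
  - apply: (@gavg_le _ _ a _ _ 2) => //.
    + by apply: measurable_funD => //; exact: measurable_indic.
    + by move=> y; rewrite (le_trans (Phi1 V y))// ler1n.
    + move=> y; rewrite (le_trans (ler_normD _ _))//.
      rewrite (_ : 2 = 1 + 1)// lerD// ?norm_indic_le1//.
      by rewrite /= ger0_norm ?(ltW (Phi_gt0 _))// ltW// Phi_lt1.
    + move=> y; rewrite /= PV indicE nbhd_setE//.
      case: (boolP (y \in _)) => [_|].
        rewrite (le_trans (proj2 (andP (qb y))))// (le_trans (ltW (Phi_lt1 _)))//.
        by rewrite lerDr ltW// Phi_gt0.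
      move=> /negP; rewrite inE/= => /negP; rewrite -leNgt => ey.
      by rewrite /q /c1 clamp0 ?mulr0// ler_pdivrMr// mul0r subr_le0.
  - by move=> y; rewrite /= ger0_norm ?(ltW (Phi_gt0 _))// ltW// Phi_lt1.
  - exact: norm_indic_le1.
have gavg01 (W : 'rV[R]_n -> R) M : measurable_fun setT (@Phi R \o W : borelRn R n -> R) ->
    (forall y, `|W y| <= M) -> 0 < gavg a (@Phi R \o W) < 1.
  move=> mW WM.
  have /andP[lo hi] : Phi (- M) <= gavg a (@Phi R \o W) <= Phi M.
    by apply: gavg_bounds mW _ => y; have := WM y; rewrite ler_norml /= !Phi_mono.
  by rewrite (lt_le_trans (Phi_gt0 _) lo) (le_lt_trans hi (Phi_lt1 _)).
move=> iso; apply: le_trans pV; rewrite -[leRHS]iPhiK ?(gavg01 _ _ mV VL)//.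
rewrite Phi_mono; apply: le_trans iso; rewrite lerD2r.
by rewrite -Phi_mono iPhiK// (gavg01 _ _ mU UL).
Qed.

(** The losses of [gpr_expand] vanish as [L] grows, provided [x'] and [e'] lie strictly below their
    targets; the Lipschitz bound on [Phi] then removes both gaps. *)
Theorem gaussian_isoperimetry a A e : measurable A -> 0 < e ->
  0 < gpr a A < 1 -> Phi (iPhi (gpr a A) + e) <= gpr a (nbhd_set A e).
Proof.
move=> mA e0 /andP[g0 g1].
have A0 : A !=set0.
  apply/set0P/negP => /eqP A0; move: g0; rewrite /gpr A0 indic0.
  by rewrite gavg_cst ltxx.
set x := iPhi (gpr a A); set g' := gpr a (nbhd_set A e).
have PhiX : Phi x = gpr a A by rewrite iPhiK ?g0.
have main x' e' : x' < x -> 0 < e' -> e' < e -> Phi (x' + e') <= g'.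
  move=> x'x e'0 e'e; rewrite leNgt; apply/negP => lt.
  (* The first entry absorbs the additive loss [Phi (e' - L)], the second the factor
     [Phi L - Phi (- L) = 1 - 2 * Phi (- L)]. *)
  have d0 : 0 < Num.min (Phi (x' + e') - g') ((Phi x - Phi x') / 2).
    by rewrite lt_min subr_gt0 lt divr_gt0// subr_gt0 lt_Phi.
  have [u Pu] := exists_Phi_lt d0.
  pose L := Num.max 0 (e' - u).
  have L0 : 0 <= L by rewrite le_max lexx.
  have PL : Phi (e' - L) <= Phi u.
    by rewrite Phi_mono lerBlDr -lerBlDl le_max lexx orbT.
  have H := gpr_expand e'0 e'e L0 mA A0 g0 (x := x').
  have PL' : Phi (- L) <= Phi (e' - L) by rewrite Phi_mono lerDr ltW.
  move: Pu; rewrite lt_min => /andP[Pu1 Pu2].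
  have h1 : Phi x' <= (Phi L - Phi (- L)) * gpr a A.
    have PN := PhiN L; rewrite -PhiX PN.
    have h := ler_piMr (ltW (Phi_gt0 (- L))) (ltW (Phi_lt1 x)).
    move: PL PL' Pu2 h; rewrite PN; move: (Phi L) (Phi u) (Phi x) (Phi _) (gpr a A).
    by clear => ? ? ? ? ?; lra.
  move: (H h1); rewrite -/g' => h2.
  by move: Pu1; rewrite ltrBrDr ltNge => /negP; apply; apply: le_trans h2 _; rewrite lerD2r.
rewrite leNgt; apply/negP => lt.
pose s := Num.min (e / 2) ((Phi (x + e) - g') / 4).
have s0 : 0 < s by rewrite lt_min !divr_gt0// subr_gt0.
have se : s <= e / 2 by rewrite ge_min lexx.
have sg : s <= (Phi (x + e) - g') / 4 by rewrite ge_min lexx orbT.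
have := main (x - s) (e - s).
rewrite gtrBl s0 subr_gt0 => /(_ isT) H.
have {}H := H _ _.
have := Phi_lipschitz (x + e) (x - s + (e - s)).
have -> : x + e - (x - s + (e - s)) = 2 * s by ring.
rewrite [X in _ <= X]ger0_norm ?mulr_ge0 ?(ltW s0)// ler_norml => /andP[_].
by have := H; lra.
Qed.

End gaussian_isoperimetry.

(** * Half-spaces and the Neyman-Pearson lemma *)

Section heat_composition.
Context {R : realType}.
Notation mu := (@lebesgue_measure R).
Implicit Types (h : R -> R) (s t x y z m c K : R).

(** The formula of Bayes for a Gaussian pair: the joint density is the law of [y] times the
    conditional law of [t] given [y]. *)
Lemma normal_pdf_complete_square s al be a0 t y : 0 < s ->
  let s' := Num.sqrt (s ^+ 2 + al ^+ 2) in
  normal_pdf (al * t + be) s y * normal_pdf a0 1 t =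
  normal_pdf (al * a0 + be) s' y *
  normal_pdf (a0 + al * (y - (al * a0 + be)) / s' ^+ 2) (s / s') t.
Proof.
move=> s0 s'; have s20 : 0 < s ^+ 2 + al ^+ 2 by rewrite ltr_pwDl ?exprn_gt0// sqr_ge0.
have s'2 : s' ^+ 2 = s ^+ 2 + al ^+ 2 by rewrite sqr_sqrtr// ltW.
have s'0 : 0 < s' by rewrite sqrtr_gt0.
have ss0 : s / s' != 0 by rewrite gt_eqF// divr_gt0.
rewrite !normal_pdfE ?oner_eq0 ?(gt_eqF s0) ?(gt_eqF s'0)// /normal_fun.
rewrite mulrACA [RHS]mulrACA -!expRD; congr (_ * expR _).
  have peak (u : R) : 0 < u -> normal_peak u = u^-1 * normal_peak 1.
    move=> u0; rewrite /normal_peak expr1n mul1r -mulrnAr sqrtrM ?sqr_ge0//.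
    by rewrite sqrtr_sqr gtr0_norm// invfM.
  rewrite (peak s s0) (peak s' s'0) (peak (s / s')) ?divr_gt0//.
  by rewrite invf_div; field; rewrite !gt_eqF.
have s2n0 : s ^+ 2 != 0 by rewrite expf_neq0 ?gt_eqF.
rewrite expr1n expr_div_n s'2; field.
by rewrite ?(gt_eqF s20) ?s2n0 ?(gt_eqF s0).
Qed.

Lemma measurable_normal_pdf2 s al be : 0 < s ->
  measurable_fun setT (fun z : R * R => normal_pdf (al * z.1 + be) s z.2).
Proof.
move=> s0; under eq_fun do rewrite normal_pdfE ?(gt_eqF s0)// /normal_fun.
apply: measurable_funM => //; apply: measurableT_comp => //.
apply: measurable_funM => //; apply: measurableT_comp => //.
apply: measurable_funX; apply: measurable_funB => //.
by apply: measurable_funD => //; apply: measurable_funM.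
Qed.

Let mker h s al be : measurable_fun setT h -> 0 < s -> measurable_fun setT
  (fun z : R * R => h z.2 * normal_pdf (al * z.1 + be) s z.2).
Proof.
move=> mh s0; apply: measurable_funM; last exact: measurable_normal_pdf2.
exact: (measurableT_comp mh measurable_snd).
Qed.

Lemma EFin_heat h s x : measurable_fun setT h -> (forall y, 0 <= h y <= 1) ->
  ((heat s h x)%:E = \int[mu]_y (h y * normal_pdf x s y)%:E)%E.
Proof.
move=> mh h01; rewrite /heat /Rintegral fineK//; apply: integrable_fin_num => //.
apply: (@integrable_mul_pdf _ _ _ _ 1) => // y.
by have /andP[h0 h1] := h01 y; rewrite ger0_norm.
Qed.

Lemma measurable_heat h s al be : measurable_fun setT h ->
  (forall y, 0 <= h y <= 1) -> 0 < s ->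
  measurable_fun setT (fun t => heat s h (al * t + be)).
Proof.
move=> mh h01 s0; apply/measurable_EFinP.
rewrite (_ : _ \o _ = fun t => (\int[mu]_y (h y * normal_pdf (al * t + be) s y)%:E)%E).
  have := @measurable_fun_fubini_tonelli_F _ _ _ _ R mu
    (fun z : R * R => (h z.2 * normal_pdf (al * z.1 + be) s z.2)%:E).
  apply; first by apply/measurable_EFinP; exact: mker.
  move=> z; rewrite lee_fin mulr_ge0 ?normal_pdf_ge0//.
  by have /andP[] := h01 z.2.
by apply/funext => t; rewrite /= EFin_heat.
Qed.

Lemma heat01 h s x : measurable_fun setT h -> (forall y, 0 <= h y <= 1) ->
  0 <= heat s h x <= 1.
Proof.
move=> mh h01; rewrite -{1}(heat_cst 0 s x) -(heat_cst 1 s x).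
have h1 y : `|h y| <= 1 by have /andP[? ?] := h01 y; rewrite ger0_norm.
apply/andP; split; apply: (@heat_le _ _ _ _ _ 1) => // y;
  by rewrite ?normr0 ?normr1//; have /andP[] := h01 y.
Qed.

(** Variances of independent Gaussians add: after exchanging the integrals, the conditional law of
    [t] integrates to 1. *)
Lemma heat_heat h s al be a0 : measurable_fun setT h ->
  (forall y, 0 <= h y <= 1) -> 0 < s ->
  heat 1 (fun t => heat s h (al * t + be)) a0 =
  heat (Num.sqrt (s ^+ 2 + al ^+ 2)) h (al * a0 + be).
Proof.
move=> mh h01 s0.
have h0 y : 0 <= h y by have /andP[] := h01 y.
have mH := measurable_heat al be mh h01 s0.
have H01 t := heat01 s (al * t + be) mh h01.
set s' := Num.sqrt _; apply: EFin_inj.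
apply: etrans (EFin_heat 1 a0 mH H01) _; apply/esym.
apply: etrans (EFin_heat s' (al * a0 + be) mh h01) _; apply/esym.
transitivity (\int[mu]_t \int[mu]_y
    (h y * normal_pdf (al * t + be) s y * normal_pdf a0 1 t)%:E)%E.
  apply: eq_integral => t _; rewrite EFinM EFin_heat// muleC -ge0_integralZl//.
  - by apply: eq_integral => y _; rewrite -EFinM mulrC.
  - apply/measurable_EFinP; apply: measurable_funM => //.
    exact: measurable_normal_pdf.
  - by move=> y _; rewrite lee_fin mulr_ge0// normal_pdf_ge0.
  - by rewrite lee_fin normal_pdf_ge0.
have mk : measurable_fun setT (fun z : R * R =>
    (h z.2 * normal_pdf (al * z.1 + be) s z.2 * normal_pdf a0 1 z.1)%:E).
  apply/measurable_EFinP; apply: measurable_funM; first exact: mker.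
  exact: (measurableT_comp (measurable_normal_pdf a0 1) measurable_fst).
have k0 (z : R * R) :
    (0 <= (h z.2 * normal_pdf (al * z.1 + be) s z.2 * normal_pdf a0 1 z.1)%:E)%E.
  by rewrite lee_fin mulr_ge0 ?mulr_ge0 ?normal_pdf_ge0.
apply: etrans (@fubini_tonelli _ _ _ _ R mu mu _ mk k0) _.
apply: eq_integral => y _ /=.
under eq_integral do rewrite -mulrA normal_pdf_complete_square// mulrA EFinM.
rewrite ge0_integralZl//.
- by rewrite integral_normal_pdf mule1.
- by apply/measurable_EFinP; exact: measurable_normal_pdf.
- by move=> t _; rewrite lee_fin normal_pdf_ge0.
- by rewrite lee_fin mulr_ge0 ?normal_pdf_ge0.
Qed.

(* A random walk of variance [1 - tau] leads from [h] to [heat 1 h] and from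
   [heat (Num.sqrt (2 * tau)) h] to [heat (Num.sqrt (1 + tau)) h], up to small errors. *)
Lemma heat_variance_dist h K tau x : measurable_fun setT h ->
  (forall y, `|h y| <= 1) -> (forall y z, `|h y - h z| <= K * `|y - z|) ->
  0 < tau -> tau < 1 ->
  `|heat (Num.sqrt (1 + tau)) h x - heat 1 h x| <=
    2 * K * (Num.sqrt tau + Num.sqrt (2 * tau)).
Proof.
move=> mh h1 hK tau0 tau1; apply/ler_addgt0Pr => e e0.
pose B := bern_cst (R := R) / tau ^+ 2.
have B0 : 0 < B by rewrite divr_gt0 ?bern_cst_gt0 ?exprn_gt0.
pose d := Num.min (tau / 2) (e / (2 * B)).
have d0 : 0 < d by rewrite lt_min !divr_gt0// mulr_gt0.
pose N := (Num.truncn ((1 - tau) / d)).+1.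
have N0 : 0 < N%:R :> R by rewrite ltr0n.
pose t := Num.sqrt ((1 - tau) / N%:R).
have t2 : t ^+ 2 = (1 - tau) / N%:R.
  by rewrite sqr_sqrtr// divr_ge0 ?subr_ge0 ?(ltW tau1)// ltW.
have t2d : t ^+ 2 <= d.
  rewrite t2 ler_pdivrMr// mulrC -ler_pdivrMr// ltW//; exact: truncnS_gt.
have ttau : t ^+ 2 / tau <= 2^-1.
  by rewrite ler_pdivrMr// mulrC (le_trans t2d)// ge_min lexx.
have Nt : N%:R * t ^+ 2 = 1 - tau by rewrite t2 mulrCA divff ?mulr1// gt_eqF.
have tB : B * t ^+ 2 <= e / 2.
  have te : t ^+ 2 <= e / (2 * B) by rewrite (le_trans t2d)// ge_min lexx orbT.
  have B20 : 0 < 2 * B by rewrite mulr_gt0.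
  rewrite ler_pdivlMr// in te; rewrite ler_pdivlMr//.
  by rewrite (_ : B * t ^+ 2 * 2 = t ^+ 2 * (2 * B))//; ring.
have tN : tau + N%:R * t ^+ 2 = 1 by rewrite Nt subrKC.
have clt := bern_clt x mh h1 hK tau0 ttau tN.
have tau20 : 0 < 2 * tau by rewrite mulr_gt0.
have ttau2 : t ^+ 2 / (2 * tau) <= 2^-1.
  rewrite ler_pdivrMr// mulKf// (le_trans t2d)// ge_min; apply/orP; left.
  by rewrite ler_pdivrMr// ler_pMr// ler1n.
have it := bern_iter_heat N x mh h1 tau20 ttau2.
have t2N : 2 * tau + N%:R * t ^+ 2 = 1 + tau by rewrite Nt; ring.
rewrite t2N in it.
have sq0 : 0 < Num.sqrt (2 * tau) by rewrite sqrtr_gt0.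
have dist := bern_iter_dist t N (fun x => heat_initial x mh h1 sq0 hK) x.
have itB : N%:R * (bern_cst * (t ^+ 2 / (2 * tau)) ^+ 2) <= B * t ^+ 2.
  have -> : N%:R * (bern_cst * (t ^+ 2 / (2 * tau)) ^+ 2) =
      (N%:R * t ^+ 2 / 4) * (B * t ^+ 2) by rewrite /B; field; rewrite gt_eqF.
  apply: ler_piMl; first by rewrite mulr_ge0 ?(ltW B0) ?sqr_ge0.
  by rewrite Nt ler_pdivrMr// mul1r; move: tau0; clear; lra.
have cltB : bern_cst * t ^+ 2 / tau ^+ 2 = B * t ^+ 2 by rewrite /B mulrAC.
rewrite cltB in clt.
move: clt it dist itB tB.
set u := heat 1 h x; set v := heat _ h x; set p := iter N _ h x; set q := iter N _ _ x.
set sa := Num.sqrt tau; set sb := Num.sqrt (2 * tau); set w := B * _.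
set z := N%:R * _; clearbody u v p q w z sa sb; clear; rewrite !ler_norml.
move=> /andP[? ?] /andP[? ?] /andP[? ?] ? ?; apply/andP; split; lra.
Qed.

Lemma indic01 (A : set R) y : 0 <= (\1_A y : R) <= 1.
Proof. by rewrite indicE; case: (_ \in _); rewrite ?lexx ?ler01. Qed.

(** Both sides have the same derivative in [c]. The constant difference vanishes because the left
    side stays in the unit interval while [Phi] comes arbitrarily close to 0 and to 1. *)
Lemma heat_indic c x : heat 1 (\1_`]-oo, c]) x = Phi (c - x).
Proof.
have heatE b : heat 1 (\1_`]-oo, b]) x =
    \int[mu]_(y in `]-oo, b]) normal_pdf x 1 y.
  rewrite Rintegral_mkcond; apply: eq_Rintegral => y _.
  by rewrite patchE indicE; case: ifP => _; rewrite ?mul1r ?mul0r.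
pose D b := heat 1 (\1_`]-oo, b]) x - Phi (b - x).
have dD (b : R) : is_derive b 1 D 0.
  have dF : is_derive b 1 (fun b => heat 1 (\1_`]-oo, b]) x) (gphi (b - x)).
    rewrite (_ : (fun b => _) = fun b => \int[mu]_(y in `]-oo, b]) normal_pdf x 1 y);
      last by apply/funext => b'; exact: heatE.
    have cpdf : continuous (normal_pdf x 1 : R -> R).
      by apply: continuous_normal_pdf; exact: oner_neq0.
    have [||dx dE] := @continuous_FTC1 R (normal_pdf x 1) -oo%O b (b + 1) _ _
      (ltNyr _) (cpdf b).
    - by rewrite ltrDl.
    - apply: (@integrableS _ _ _ _ setT) => //.
      exact: integrable_normal_pdf.
    - by apply: DeriveDef; rewrite // -derive1E dE normal_pdf1E.
  by apply: is_derive_eq; rewrite /GRing.scale/=; ring.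
have DE b : D b = D c.
  apply/eqP; rewrite -subr_eq0 -normr_le0.
  have := @is_derive_lipschitz _ _ _ 0 b c dD.
  by rewrite mul0r; apply => z; rewrite normr0.
have H01 b : 0 <= heat 1 (\1_`]-oo, b]) x <= 1.
  by apply: heat01; [exact: measurable_indic|exact: indic01].
apply/eqP; rewrite -subr_eq0 -/(D c) eq_le; apply/andP; split.
  rewrite leNgt; apply/negP => D0.
  have [u Pu] : exists u, 1 - D c < Phi u by apply: exists_Phi_gt; rewrite gtrBl.
  have := DE (x + u); rewrite {1}/D addrAC subrr add0r => E.
  by have /andP[_ h1] := H01 (x + u); lra.
rewrite leNgt; apply/negP => D0.
have [u Pu] : exists u, Phi u < - D c by apply: exists_Phi_lt; rewrite oppr_gt0.
have := DE (x + u); rewrite {1}/D addrAC subrr add0r => E.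
by have /andP[h0 _] := H01 (x + u); lra.
Qed.

End heat_composition.

(** * One-dimensional marginals *)

Section gaussian_marginal.
Context {R : realType}.
Implicit Types (h : R -> R) (s c K : R).

Lemma gavg0 (a : 'rV[R]_0) k : gavg a k = k 0.
Proof.
have all0 (x : 'rV[R]_0) : x = 0 by apply/rowP; case.
have -> : k = cst (k 0) by apply/funext => x; rewrite (all0 x).
exact: gavg_cst.
Qed.

Lemma measurable_heat_dotr n (nu : 'rV[R]_n) h s be : measurable_fun setT h ->
  (forall y, 0 <= h y <= 1) -> 0 < s ->
  measurable_fun setT ((fun x => heat s h (dotr x nu + be)) : borelRn R n -> R).
Proof.
move=> mh h01 s0.
have := measurableT_comp (measurable_heat 1 be mh h01 s0) (measurable_dotr nu).
by apply: eq_measurable_fun => x _; rewrite /= mul1r.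
Qed.

(** Each coordinate adds the square of its coefficient to the variance. The initial [s > 0] keeps
    every kernel nondegenerate, even where a coefficient of [nu] is 0. *)
Lemma gavg_heat n (a nu : 'rV[R]_n) h s be : measurable_fun setT h ->
  (forall y, 0 <= h y <= 1) -> 0 < s ->
  gavg a (fun x => heat s h (dotr x nu + be)) =
  heat (Num.sqrt (s ^+ 2 + dotr nu nu)) h (dotr a nu + be).
Proof.
move=> mh h01 s0; elim: n a nu be => [|n IH] a nu be.
  rewrite gavg0 /dotr !big_ord0 addr0 sqrtr_sqr gtr0_norm//.
have mk := measurable_heat_dotr nu be mh h01 s0.
rewrite (gavg_cons _ mk (c := 1)); last by move=> x; exact: heat01.
have nuE := cons_hd_tl nu; have aE := cons_hd_tl a.
have nuE2 := dotr_cons (hd nu) (hd nu) (tl nu) (tl nu); rewrite nuE in nuE2.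
have anuE := dotr_cons (hd a) (hd nu) (tl a) (tl nu); rewrite nuE aE in anuE.
pose be' := dotr (tl a) (tl nu) + be.
pose s' := Num.sqrt (s ^+ 2 + dotr (tl nu) (tl nu)).
have s'0 : 0 < s' by rewrite sqrtr_gt0 ltr_pwDl ?exprn_gt0// dotr_ge0.
have inner : (fun t => gavg (tl a) (fun v => heat s h (dotr (consRn (t, v)) nu + be))) =
    (fun t => heat s' h (hd nu * t + be')).
  apply/funext => t.
  have -> : hd nu * t + be' = dotr (tl a) (tl nu) + (hd nu * t + be).
    by rewrite /be'; ring.
  apply: etrans (IH (tl a) (tl nu) (hd nu * t + be)).
  apply: (f_equal (gavg (tl a))); apply/funext => v; apply: (f_equal (heat s h)).
  by rewrite -{1}nuE dotr_cons; ring.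
apply: etrans (f_equal (fun f => heat 1 f (hd a)) inner) _.
apply: etrans (heat_heat (hd nu) be' (hd a) mh h01 s'0) _.
have -> : hd nu * hd a + be' = dotr a nu + be by rewrite anuE /be'; ring.
have -> // : Num.sqrt (s' ^+ 2 + hd nu ^+ 2) = Num.sqrt (s ^+ 2 + dotr nu nu).
rewrite sqr_sqrtr; last by rewrite addr_ge0 ?sqr_ge0 ?dotr_ge0.
by rewrite nuE2; apply: (f_equal Num.sqrt); ring.
Qed.

(** The limit of [gavg_heat] as [s] tends to 0: both the smoothing of [h] and the surplus variance
    cost a multiple of [K * s]. *)
Lemma gavg_dotr n (a nu : 'rV[R]_n) h K : enorm nu = 1 ->
  (forall y, 0 <= h y <= 1) -> (forall y z, `|h y - h z| <= K * `|y - z|) ->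
  gavg a (fun x => h (dotr x nu)) = heat 1 h (dotr a nu).
Proof.
move=> nu1 h01 hK.
have mh : measurable_fun setT h by exact: lipschitz_measurable hK.
have h1 y : `|h y| <= 1 by have /andP[h0 h1] := h01 y; rewrite ger0_norm.
have K0 : 0 <= K.
  by have := le_trans (normr_ge0 _) (hK 1 0); rewrite subr0 normr1 mulr1.
have nu2 : dotr nu nu = 1 by rewrite -sqr_enorm nu1 expr1n.
apply/eqP; rewrite -subr_eq0 -normr_le0; apply/ler_addgt0Pr => e e0; rewrite add0r.
pose s := Num.min 2^-1 (e / (8 * K + 1)).
have K80 : 0 < 8 * K + 1 by rewrite ltr_wpDl// mulr_ge0.
have s0 : 0 < s by rewrite lt_min invr_gt0 ltr0n/= divr_gt0.
have s1 : s <= 2^-1 by rewrite ge_min lexx.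
have sK : 8 * K * s <= e.
  have : s <= e / (8 * K + 1) by rewrite ge_min lexx orbT.
  by rewrite ler_pdivlMr//; nra.
have := gavg_heat a nu 0 mh h01 s0; rewrite nu2 !addr0 => gE.
have s21 : s ^+ 2 < 1 by nra.
have var := heat_variance_dist (dotr a nu) mh h1 hK (exprn_gt0 2 s0) s21.
rewrite [1 + s ^+ 2]addrC -gE in var.
have m1 : measurable_fun setT ((fun x => h (dotr x nu)) : borelRn R n -> R).
  exact: (measurableT_comp mh (measurable_dotr nu)).
have m2 := measurable_heat_dotr nu 0 mh h01 s0.
have d : `|gavg a (fun x => h (dotr x nu)) - gavg a (fun x => heat s h (dotr x nu + 0))|
    <= 2 * K * s.
  apply: (@gavg_dist _ _ a _ _ 1 _ m1 m2) => x.
  - exact: h1.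
  - by have /andP[u0 u1] := heat01 s (dotr x nu + 0) mh h01; rewrite ger0_norm.
  - by rewrite addr0 distrC; exact: heat_initial.
apply: le_trans (ler_distD _ _ _) _; apply: le_trans (lerD d var) _.
have -> : Num.sqrt (s ^+ 2) = s by rewrite sqrtr_sqr gtr0_norm.
have : Num.sqrt (2 * s ^+ 2) <= 2 * s.
  rewrite sqrtrM// sqrtr_sqr (gtr0_norm s0) ler_wpM2r ?(ltW s0)//.
  by rewrite -[leRHS](@ger0_norm _ 2)// -sqrtr_sqr ler_wsqrtr//; lra.
by move: sK s0 K0; clear; move: (Num.sqrt _) => q; nra.
Qed.

End gaussian_marginal.

Section gaussian_probability.
Context {R : realType} {n : nat}.
Implicit Types (a b nu : 'rV[R]_n) (A B : set (borelRn R n)) (c : R).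

Lemma EFin_gpr a A : measurable A ->
  (gpr a A)%:E = (\int[lebesgue_Rn n]_(x in A) (gauss_density (x - a))%:E)%E.
Proof.
move=> mA; rewrite /gpr (EFin_gavg _ _ (@norm_indic_le1 _ _ A)); last first.
  exact: measurable_indic.
rewrite [RHS]integral_mkcond; apply: eq_integral => x _.
by rewrite patchE indicE; case: ifP => _; rewrite ?mul1r ?mul0r.
Qed.

Lemma gpr01 a A : measurable A -> 0 <= gpr a A <= 1.
Proof.
move=> mA; apply: gavg_bounds; first exact: measurable_indic.
by move=> x; rewrite indicE; case: (_ \in _); rewrite ?lexx ?ler01.
Qed.

Lemma gprU a A B : measurable A -> measurable B -> [disjoint A & B] ->
  gpr a (A `|` B) = gpr a A + gpr a B.
Proof.
move=> mA mB AB; rewrite /gpr -(@gavgD _ _ _ _ _ 1).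
- apply: (f_equal (gavg a)); apply/funext => x.
  rewrite !indicE in_setU; case: (boolP (x \in A)) => [xA|_]; last by rewrite add0r.
  case: (boolP (x \in B)) => [xB|_]; last by rewrite addr0.
  by move/disj_setPS : AB => /(_ x); rewrite !inE in xA xB; case.
- exact: measurable_indic.
- exact: measurable_indic.
- exact: norm_indic_le1.
- exact: norm_indic_le1.
Qed.

Lemma gprT a : gpr a setT = 1.
Proof. by rewrite /gpr indicT gavg_cst. Qed.

Lemma gprC a A : measurable A -> gpr a (~` A) = 1 - gpr a A.
Proof.
move=> mA; have mC : measurable (~` A) by exact: measurableC.
apply/eqP; rewrite eq_sym subr_eq addrC -gprU ?setUv ?gprT//.
by apply/disj_setPS => x []; rewrite /setC/=.
Qed.

Lemma gprD a A B : measurable A -> measurable B -> A `<=` B ->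
  gpr a (B `\` A) = gpr a B - gpr a A.
Proof.
move=> mA mB AB; have mD : measurable (B `\` A) by exact: measurableD.
apply/eqP; rewrite eq_sym subr_eq addrC -gprU ?setDUK//.
by apply/disj_setPS => x [? []].
Qed.

(** The Gaussian density is positive everywhere, so null sets do not depend on the centre. *)
Lemma gpr_eq0 a A : measurable A -> gpr a A = 0 <-> lebesgue_Rn n A = 0%E.
Proof.
move=> mA; have mg : measurable_fun A
    ((fun x => (gauss_density (x - a))%:E) : borelRn R n -> \bar R).
  by apply/measurable_EFinP; apply: measurable_funTS; exact: measurable_gauss_density.
have gE : (\int[lebesgue_Rn n]_(x in A) `|(gauss_density (x - a))%:E|)%E =
    (gpr a A)%:E.
  rewrite EFin_gpr//; apply: eq_integral => x _.
  by rewrite abse_EFin ger0_norm// ltW// gauss_density_gt0.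
split=> [A0|A0].
  move: gE; rewrite A0 => /(ae_eq_integral_abs _ mA mg)[N [mN N0 AN]].
  apply/eqP; rewrite -measure_le0 -N0 le_measure ?inE// => x Ax; apply: AN => /=.
  by move=> /(_ Ax)/eqP; rewrite eqe gt_eqF// gauss_density_gt0.
by apply: EFin_inj; rewrite -gE integral_abs_eq0.
Qed.

Lemma measurable_halfspace_lt c nu : measurable (halfspace_lt c nu : set (borelRn R n)).
Proof.
rewrite (_ : halfspace_lt c nu = (fun x => dotr x nu) @^-1` `]-oo, c[%classic).
  by rewrite -[X in measurable X]setTI; exact: measurable_dotr.
by apply/seteqP; split => x; rewrite /halfspace_lt/= in_itv.
Qed.

Lemma halfspace_gtE c nu : halfspace_gt c nu = halfspace_lt (- c) (- nu).
Proof.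
by apply/seteqP; split => x; rewrite /halfspace_gt /halfspace_lt/= dotrNr ltrN2.
Qed.

Lemma measurable_halfspace_gt c nu : measurable (halfspace_gt c nu : set (borelRn R n)).
Proof. by rewrite halfspace_gtE; exact: measurable_halfspace_lt. Qed.

(** The indicator is squeezed between ramps of slope [e^-1], to which [gavg_dotr] applies. Allowing
    any [A] between the open and the closed half-space also yields that hyperplanes are null. *)
Lemma gpr_halfspace a nu A c : enorm nu = 1 -> measurable A ->
  halfspace_lt c nu `<=` A -> A `<=` [set x | dotr x nu <= c] ->
  gpr a A = Phi (c - dotr a nu).
Proof.
move=> nu1 mA HA AH.
suff dist (e : R) : 0 < e -> `|gpr a A - Phi (c - dotr a nu)| <= e.
  by apply/eqP; rewrite -subr_eq0 -normr_le0; apply/ler_addgt0Pr => e e0;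
    rewrite add0r dist.
move=> e0; pose h (y : R) := clamp ((c - y) / e); pose h' (y : R) := clamp ((c + e - y) / e).
have hK (c' y z : R) : `|clamp ((c' - y) / e) - clamp ((c' - z) / e)| <= e^-1 * `|y - z|.
  apply: le_trans (clamp_lip _ _) _.
  rewrite -mulrBl opprD addrACA subrr add0r -opprD normrM normrN mulrC.
  by rewrite gtr0_norm ?invr_gt0.
have h1 (u : R) : `|clamp u| <= 1 :> R by have /andP[? ?] := clamp01 u; rewrite ger0_norm.
have mh (c' : R) : measurable_fun setT (fun y : R => clamp ((c' - y) / e)).
  exact: lipschitz_measurable (hK c').
have mhd (c' : R) : measurable_fun setT
    ((fun x => clamp ((c' - dotr x nu) / e)) : borelRn R n -> R).
  exact: (measurableT_comp (mh c') (measurable_dotr nu)).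
have mI : measurable_fun setT (\1_A : borelRn R n -> R) by exact: measurable_indic.
have lo : gavg a (fun x => h (dotr x nu)) <= gpr a A.
  apply: (@gavg_le _ _ _ _ _ 1 (mhd c) mI) => [x|x|x].
  - exact: h1.
  - exact: norm_indic_le1.
  - rewrite indicE; case: (boolP (x \in A)) => [_|]; first by have /andP[] := clamp01 ((c - dotr x nu) / e).
    rewrite notin_setE => Ax; rewrite /h clamp0// pmulr_lle0 ?invr_gt0// subr_le0 leNgt.
    by apply/negP => /HA.
have up : gpr a A <= gavg a (fun x => h' (dotr x nu)).
  apply: (@gavg_le _ _ _ _ _ 1 mI (mhd (c + e))) => [x|x|x].
  - exact: norm_indic_le1.
  - exact: h1.
  - rewrite indicE; case: (boolP (x \in A)) => [|_]; last by have /andP[] := clamp01 ((c + e - dotr x nu) / e).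
    rewrite inE => /AH/= xc; rewrite /h' clamp1// ler_pdivlMr// mul1r.
    by move: xc; clear; lra.
have indic_le1 (b : R) y : `|(\1_(`]-oo, b] : set R) y : R)| <= 1.
  by have /andP[? ?] := indic01 (`]-oo, b]) y; rewrite ger0_norm.
have lo2 : Phi (c - e - dotr a nu) <= heat 1 h (dotr a nu).
  rewrite -heat_indic; apply: (@heat_le _ _ _ _ _ 1) => [||y|y|y]; [|exact: mh|
    exact: indic_le1|exact: h1|]; first exact: measurable_indic.
  rewrite indicE; case: (boolP (_ \in _)) => [|_]; last by have /andP[] := clamp01 ((c - y) / e).
  rewrite inE/= in_itv/= => yc; rewrite /h clamp1// ler_pdivlMr// mul1r.
  by move: yc; clear; lra.
have up2 : heat 1 h' (dotr a nu) <= Phi (c + e - dotr a nu).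
  rewrite -heat_indic; apply: (@heat_le _ _ _ _ _ 1) => [||y|y|y]; [exact: mh| |
    exact: h1|exact: indic_le1|]; first exact: measurable_indic.
  rewrite indicE; case: (boolP (_ \in _)) => [_|]; first by have /andP[] := clamp01 ((c + e - y) / e).
  rewrite notin_setE/= in_itv/= => /negP; rewrite -ltNge => yc.
  by rewrite /h' clamp0// pmulr_lle0 ?invr_gt0// subr_le0 ltW.
rewrite (gavg_dotr a nu1 _ (hK c)) in lo; last by move=> y; exact: clamp01.
rewrite (gavg_dotr a nu1 _ (hK (c + e))) in up; last by move=> y; exact: clamp01.
have d1 := Phi_lipschitz (c - e - dotr a nu) (c - dotr a nu).
have d2 := Phi_lipschitz (c + e - dotr a nu) (c - dotr a nu).
have E1 : `|c - e - dotr a nu - (c - dotr a nu)| = e.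
  by rewrite (_ : _ - _ = - e) ?normrN ?gtr0_norm//; ring.
have E2 : `|c + e - dotr a nu - (c - dotr a nu)| = e.
  by rewrite (_ : _ - _ = e) ?gtr0_norm//; ring.
rewrite E1 in d1; rewrite E2 in d2.
move: (le_trans lo2 lo) (le_trans up up2) d1 d2; clear; rewrite !ler_norml.
set A1 := Phi _; set A2 := Phi _; set A3 := Phi _; set A4 := gpr _ _.
by clearbody A1 A2 A3 A4 => ? ? /andP[? ?] /andP[? ?]; apply/andP; split; lra.
Qed.

Lemma gpr_halfspace_lt a nu c : enorm nu = 1 ->
  gpr a (halfspace_lt c nu) = Phi (c - dotr a nu).
Proof.
move=> nu1; apply: gpr_halfspace => //; first exact: measurable_halfspace_lt.
by move=> x /=; rewrite /halfspace_lt/= => /ltW.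
Qed.

Lemma gpr_halfspace_gt a nu c : enorm nu = 1 ->
  gpr a (halfspace_gt c nu) = Phi (dotr a nu - c).
Proof.
by move=> nu1; rewrite halfspace_gtE gpr_halfspace_lt ?enormN// dotrNr opprK addrC.
Qed.

Lemma hyperplane_null c nu : enorm nu = 1 ->
  lebesgue_Rn n [set x | dotr x nu = c] = 0%E.
Proof.
move=> nu1; pose A : set (borelRn R n) := [set x | dotr x nu <= c].
have AE : A = ~` halfspace_gt c nu.
  by apply/seteqP; split => x; rewrite /A /halfspace_gt/= leNgt => /negP.
have mH := measurable_halfspace_lt c nu.
have mA : measurable A by rewrite AE; apply: measurableC; exact: measurable_halfspace_gt.
have HA : halfspace_lt c nu `<=` A by move=> x; rewrite /halfspace_lt/= => /ltW.
have -> : [set x | dotr x nu = c] = A `\` halfspace_lt c nu.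
  apply/seteqP; split => x; rewrite /A /halfspace_lt/=.
    by move=> ->; rewrite ltxx; split.
  by move=> [xc /negP]; rewrite -leNgt => cx; apply/eqP; rewrite eq_le xc.
apply/(gpr_eq0 0); first exact: measurableD.
by rewrite gprD// gpr_halfspace_lt// (gpr_halfspace 0 nu1 mA HA)// subrr.
Qed.

End gaussian_probability.

(** * Testing between two translates *)

Section neyman_pearson.
Context {R : realType} {n : nat}.
Implicit Types (a nu : 'rV[R]_n) (A : set (borelRn R n)) (c d k : R).

Lemma gauss_density_shift a nu d (x : 'rV[R]_n) : enorm nu = 1 ->
  gauss_density (x - (a + d *: nu)) =
  expR (d * (dotr x nu - dotr a nu) - d ^+ 2 / 2) * gauss_density (x - a).
Proof.
move=> nu1; have nu2 : dotr nu nu = 1 by rewrite -sqr_enorm nu1 expr1n.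
rewrite !gauss_densityE mulrCA -expRD; congr (_ * expR _).
rewrite opprD addrA -dotrBl; set y := x - a; clearbody y.
rewrite dotrBl !dotrBr !dotrZl !dotrZr nu2 (dotrC nu y).
by field.
Qed.

(** The likelihood ratio increases along [nu], so the half-space [H] collects the points where it is
    large. Since [A] and [H] have equal measure at [a], the integral of [F] is the difference of
    their measures at [a + d *: nu]. *)
Lemma neyman_pearson a nu d A c : enorm nu = 1 -> 0 < d -> measurable A ->
  gpr a A = Phi (dotr a nu - c) ->
  gpr (a + d *: nu) A <= Phi (dotr a nu - c + d) /\
  (gpr (a + d *: nu) A = Phi (dotr a nu - c + d) ->
    lebesgue_Rn n (A `+` halfspace_gt c nu) = 0%E).
Proof.
move=> nu1 d0 mA Ac; set b : 'rV[R]_n := a + d *: nu; pose H : set (borelRn R n) := halfspace_gt c nu.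
have mH : measurable H by exact: measurable_halfspace_gt.
have nu2 : dotr nu nu = 1 by rewrite -sqr_enorm nu1 expr1n.
have aH : gpr a H = Phi (dotr a nu - c) by rewrite gpr_halfspace_gt.
have bH : gpr b H = Phi (dotr a nu - c + d).
  by rewrite gpr_halfspace_gt// /b dotrDl dotrZl nu2 mulr1 addrAC.
have mIA : measurable_fun setT (\1_A : borelRn R n -> R) by exact: measurable_indic.
pose w (x : borelRn R n) : R := \1_H x - \1_A x.
have mw : measurable_fun setT w by apply: measurable_funB; exact: measurable_indic.
have w1 (x : borelRn R n) : `|w x| <= 1.
  rewrite /w !indicE; case: (_ \in _); case: (_ \in _);
    by rewrite ?subrr ?subr0 ?sub0r ?normrN ?normr1 ?normr0 ?ler01.
pose k := expR (d * (c - dotr a nu) - d ^+ 2 / 2).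
(* [H] is where the ratio of the densities exceeds [k], so [F] is nonnegative. *)
pose F (x : borelRn R n) : R :=
  w x * gauss_density (x - b) - k * (w x * gauss_density (x - a)).
have ia := integrable_gavg a mw w1; have ib := integrable_gavg b mw w1.
have iF : (lebesgue_Rn n).-integrable setT (EFin \o F).
  have := integrableB measurableT ib (integrableZl measurableT k ia).
  exact.
have FE (x : borelRn R n) : F x = w x * (expR (d * (dotr x nu - dotr a nu) - d ^+ 2 / 2) - k) *
    gauss_density (x - a).
  by rewrite /F gauss_density_shift//; ring.
have expRk (x : borelRn R n) : 0 <= (dotr x nu - c) *
    (expR (d * (dotr x nu - dotr a nu) - d ^+ 2 / 2) - k).
  have [xc|xc] := leP (dotr x nu) c.
    rewrite mulr_le0// ?subr_le0// ler_expR lerD2r ler_pM2l//.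
    by rewrite lerD2r.
  apply: mulr_ge0; first by rewrite subr_ge0 ltW.
  by rewrite subr_ge0 ler_expR lerD2r ler_pM2l// lerD2r ltW.
have F0 (x : borelRn R n) : 0 <= F x.
  rewrite FE; apply: mulr_ge0; last by rewrite ltW// gauss_density_gt0.
  rewrite /w !indicE; have := expRk x.
  case: (boolP (x \in H)); rewrite ?inE ?notin_setE /H /halfspace_gt/=.
    rewrite -subr_gt0 => xc; rewrite pmulr_rge0// => e0.
    by rewrite mulr_ge0//; case: (_ \in _); rewrite ?subrr ?subr0.
  move=> /negP; rewrite -leNgt -subr_le0 le_eqVlt => /orP[/eqP xc _|xc].
    suff -> : expR (d * (dotr x nu - dotr a nu) - d ^+ 2 / 2) = k by rewrite subrr mulr0.
    by rewrite /k; congr expR; move/eqP : xc; rewrite subr_eq0 => /eqP ->.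
  rewrite nmulr_rge0// => e0.
  by rewrite mulr_le0//; case: (_ \in _); rewrite ?subrr ?sub0r ?lerN10.
have IF : \int[lebesgue_Rn n]_x F x = Phi (dotr a nu - c + d) - gpr b A.
  rewrite RintegralB//; last exact: (integrableZl measurableT k ia).
  rewrite RintegralZl//.
  change (gavg b w - k * gavg a w = Phi (dotr a nu - c + d) - gpr b A).
  have gw (e : 'rV[R]_n) : gavg e w = gpr e H - gpr e A.
    apply/eqP; rewrite eq_sym subr_eq; apply/eqP; rewrite /gpr.
    rewrite -(@gavgD _ _ e w (\1_A) 1 mw mIA w1 (@norm_indic_le1 _ _ A)).
    by apply: (f_equal (gavg e)); apply/funext => x; rewrite /w subrK.
  by rewrite !gw aH Ac subrr mulr0 subr0 bH.
split.
  rewrite -subr_ge0 -IF; apply: Rintegral_ge0 => x _; exact: F0.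
move=> bA; rewrite bA subrr in IF.
have mF : measurable_fun setT (EFin \o F) by exact: measurable_int iF.
have FN : (\int[lebesgue_Rn n]_x `|(EFin \o F) x| = 0)%E.
  under eq_integral do rewrite /= ger0_norm//.
  by rewrite -[LHS]fineK ?(integrable_fin_num _ iF)// -[X in X%:E]/(Rintegral _ _ _) IF.
have [N [mN N0 FN0]] := (ae_eq_integral_abs _ measurableT mF).1 FN.
have hp := hyperplane_null c nu1.
have mP : measurable ([set x | dotr x nu = c] : set (borelRn R n)).
  by have := measurable_dotr nu measurableT (measurable_set1 c); rewrite setTI.
apply/eqP; rewrite -measure_le0.
apply: (@le_trans _ _ (lebesgue_Rn n (N `|` [set x | dotr x nu = c])%classic)).
  apply: le_measure; rewrite ?inE.
  - by apply: measurableU; apply: measurableD.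
  - exact: measurableU.
  (* Off the hyperplane the likelihood ratio differs from [k], so [F] vanishes only where [A] and
     [H] agree. *)
  - move=> x AHx; have [xc|xc] := eqVneq (dotr x nu) c; [by right|left].
    apply: FN0 => /(_ I)[Fx0]; move: (FE x); rewrite Fx0 => /esym/eqP.
    rewrite mulf_eq0 => /orP[|]; first (rewrite mulf_eq0 => /orP[|]).
    + rewrite /w !indicE; case: AHx => -[Ax Hx].
        by rewrite (mem_set Ax) memNset// sub0r oppr_eq0 oner_eq0.
      by rewrite (mem_set Ax) memNset// subr0 oner_eq0.
    + rewrite subr_eq0 /k (inj_eq (@expR_inj R)) (inj_eq (addIr _)).
      by rewrite (inj_eq (mulfI (lt0r_neq0 d0))) (inj_eq (addIr _)) (negbTE xc).
    + by move/eqP => g0; have := gauss_density_gt0 (x - a : 'rV[R]_n); rewrite g0 ltxx.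
by rewrite measureU0 ?N0.
Qed.

End neyman_pearson.

(** * The one-dimensional optimisation *)

Section line_optimisation.
Context {R : realType}.
Implicit Types (x y s t k c d p r : R).

(** The function increases up to [k] and tends to 0 at [-oo]. For [k = s < 0] this is the classical
    Mills bound. *)
Lemma gphi_Phi_gt0 k s : s <= k -> 0 < gphi s + k * Phi s.
Proof.
move=> sk; have [k0|k0] := leP 0 k.
  by rewrite ltr_pwDl ?gphi_gt0// mulr_ge0// ltW// Phi_gt0.
apply: le_lt_trans (@lt_gphi_Phi _ k (s - 1) s _ sk); last by rewrite gtrBl.
rewrite leNgt; apply/negP => lt0; set w := _ + _ in lt0.
have wk0 : 0 < w / k by rewrite nmulr_lgt0// invr_lt0.
have [u Pu] := exists_Phi_lt wk0.
have sk1 : s - 1 <= k by move: sk; clear; lra.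
have kPu (x : R) : Phi x <= Phi u -> w < k * Phi x.
  by move=> xu; rewrite mulrC -ltr_ndivlMr// (le_lt_trans xu).
have [us|su] := leP u (s - 1).
  have := le_gphi_Phi us sk1; have := gphi_gt0 u; have := kPu _ (lexx _).
  by rewrite -/w; clear; lra.
have : w < k * Phi (s - 1) by apply: kPu; rewrite Phi_mono ltW.
by have := gphi_gt0 (s - 1); rewrite /w; clear; lra.
Qed.

(** With [k = - (2 * gphi 0)] the function [gphi + k * Phi] vanishes at 0 and decreases on [[k, 0]];
    to the left of [k] it is positive by [gphi_Phi_gt0]. *)
Lemma mills_zero r : r <= 0 -> 2 * gphi 0 * Phi r <= gphi r.
Proof.
move=> r0; have g0 := gphi_gt0 (0 : R).
have [rk|kr] := leP r (- (2 * gphi 0)).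
  by have := gphi_Phi_gt0 rk; lra.
by have := ge_gphi_Phi r0 (ltW kr); rewrite Phi0; lra.
Qed.

Lemma lt_mills_zero r : r < 0 -> 2 * gphi 0 * Phi r < gphi r.
Proof.
move=> r0; have g0 := gphi_gt0 (0 : R).
have [rk|kr] := leP r (- (2 * gphi 0)).
  by have := gphi_Phi_gt0 rk; lra.
by have := gt_gphi_Phi r0 (ltW kr); rewrite Phi0; lra.
Qed.

Lemma le_gphi0 x : gphi x <= gphi 0.
Proof. by apply: le_gphi; rewrite expr0n sqr_ge0. Qed.

Lemma is_derive_mul_gphi x :
  is_derive x 1 (fun x => x * gphi x) ((1 - x ^+ 2) * gphi x).
Proof. by apply: is_derive_eq; rewrite /GRing.scale/=; ring. Qed.

Lemma mul_gphi_ge (u : R) : 0 <= u -> (1 - u ^+ 2) * (Phi u - 2^-1) <= u * gphi u.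
Proof.
move=> u0; pose h x := x * gphi x - (1 - x ^+ 2) * (Phi x - 2^-1).
have hdh (x : R) : is_derive x 1 h (2 * x * (Phi x - 2^-1)).
  have d := is_derive_mul_gphi x.
  by rewrite /h; apply: is_derive_eq; rewrite /GRing.scale/=; ring.
have : h 0 <= h u.
  apply: (is_derive_le u0 (fun x _ => hdh x)) => x /andP[x0 _].
  by rewrite mulr_ge0 ?mulr_ge0 ?(ltW x0)// subr_ge0 -Phi0 Phi_mono ltW.
by rewrite /h mul0r Phi0 subrr mulr0 subrr subr_ge0.
Qed.

(** In other words, [x * gphi x / (Phi x - 2^-1)] does not increase. Its value [rho] at [u] is at
    least [1 - u ^+ 2] by [mul_gphi_ge], which fixes the sign of the derivative of [h] to the right
    of [u]. *)
Lemma mul_gphi_ratio (u v : R) : 0 < u -> u <= v ->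
  v * gphi v * (Phi u - 2^-1) <= u * gphi u * (Phi v - 2^-1).
Proof.
move=> u0 uv; have Fu : 0 < Phi u - 2^-1 by rewrite subr_gt0 -Phi0 Phi_lt_mono.
pose rho := u * gphi u / (Phi u - 2^-1).
have rhou : rho * (Phi u - 2^-1) = u * gphi u by rewrite divfK ?gt_eqF.
have rho1 : 1 - u ^+ 2 <= rho by rewrite ler_pdivlMr// mul_gphi_ge// ltW.
clearbody rho.
pose h x := rho * (Phi x - 2^-1) - x * gphi x.
have hdh (x : R) : is_derive x 1 h (gphi x * (rho - (1 - x ^+ 2))).
  have d := is_derive_mul_gphi x.
  by rewrite /h; apply: is_derive_eq; rewrite /GRing.scale/=; ring.
have : h u <= h v.
  apply: (is_derive_le uv (fun x _ => hdh x)) => x /andP[ux _].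
  rewrite mulr_ge0 ?(ltW (gphi_gt0 _))// subr_ge0 (le_trans _ rho1)//.
  by rewrite lerD2l lerN2 ler_sqr ?nnegrE ?(ltW u0) ?(ltW ux)// ltW// (lt_trans u0).
rewrite {1}/h rhou subrr /h subr_ge0 => vh.
by rewrite -rhou (mulrAC rho) ler_pM2r.
Qed.

Lemma is_derive_gphi_shift c s :
  is_derive s 1 (fun x => gphi (x - c)) (- (s - c) * gphi (s - c)).
Proof.
have d1 : is_derive s 1 (fun x : R => x - c) 1.
  by apply: is_derive_eq; rewrite subr0.
apply: is_derive_eq (@is_derive1_comp R gphi (fun x => x - c) s _ _
  (is_derive_gphi (s - c)) d1) _.
by rewrite mulr1.
Qed.

Definition dQ q d x : R := q * gphi x + (1 - q) * gphi (x - d).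

Lemma is_derive_Qfun q d x : is_derive x 1 (Qfun q d) (dQ q d x).
Proof.
rewrite (_ : Qfun q d = fun x => q * Phi x + (1 - q) * Phi (x - d))//.
by rewrite /dQ; apply: is_derive_eq; rewrite /GRing.scale/=; ring.
Qed.

(** The reflection about [d / 2] exchanges the two centres and thus the weights. *)
Lemma Qfun_refl q d x : Qfun (1 - q) d (d - x) = 1 - Qfun q d x.
Proof.
rewrite /Qfun (_ : d - x - d = - x); last by ring.
by rewrite (_ : d - x = - (x - d)) ?PhiN ?PhiN; ring.
Qed.

Lemma dQ_refl q d x : dQ (1 - q) d (d - x) = dQ q d x.
Proof.
rewrite /dQ (_ : d - x - d = - x); last by ring.
by rewrite (_ : d - x = - (x - d)) ?gphiN ?gphiN; ring.
Qed.

Lemma Qfun_gt0 q d x : 0 < q -> q < 1 -> 0 < Qfun q d x.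
Proof.
by move=> q0 q1; rewrite /Qfun addr_gt0// mulr_gt0 ?Phi_gt0// subr_gt0.
Qed.

Lemma dQ_gt0 q d x : 0 < q -> q < 1 -> 0 < dQ q d x.
Proof.
by move=> q0 q1; rewrite /dQ addr_gt0// mulr_gt0 ?gphi_gt0// subr_gt0.
Qed.

Lemma lt_Qfun q d x y : 0 < q -> q < 1 -> x < y -> Qfun q d x < Qfun q d y.
Proof.
move=> q0 q1 xy; rewrite /Qfun ltrD// ltr_pM2l ?subr_gt0// Phi_lt_mono//.
by rewrite ltrD2r.
Qed.

Lemma le_Qfun q d : 0 < q -> q < 1 -> {mono Qfun q d : x y / x <= y}.
Proof. by move=> q0 q1; apply: le_mono => x y; exact: lt_Qfun. Qed.

Lemma dlogQE q d x : 0 < q -> q < 1 -> dlogQ q d x = dQ q d x / Qfun q d x.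
Proof.
move=> q0 q1; rewrite /dlogQ derive1E; apply: derive_val.
have d1 := is_derive_Qfun q d x; have d2 := is_derive1_ln (Qfun_gt0 d x q0 q1).
by have := is_derive1_comp d2 d1; rewrite mulrC.
Qed.

Lemma continuous_dlogQ q d : 0 < q -> q < 1 -> continuous (dlogQ q d).
Proof.
move=> q0 q1 x; rewrite (_ : dlogQ q d = fun x => dQ q d x / Qfun q d x); last first.
  by apply/funext => y; exact: dlogQE.
apply: cvgM.
  apply: cvgD; apply: cvgM; [exact: cvg_cst|exact: continuous_gphi|exact: cvg_cst|].
  apply: (@continuous_comp _ _ _ (fun x => x - d) gphi); last exact: continuous_gphi.
  by apply: cvgB; [exact: cvg_id|exact: cvg_cst].
apply: cvgV; first by rewrite gt_eqF// Qfun_gt0.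
exact: is_derive_continuous (is_derive_Qfun q d x).
Qed.

Lemma minimizer_exists q d r : 0 < q -> q < 1 -> 0 <= r ->
  exists t, minimizers (dlogQ q d) r t.
Proof.
move=> q0 q1 r0; have [|t tr tmin] := @EVT_min _ (dlogQ q d) 0 r r0.
  by apply: continuous_subspaceT; exact: continuous_dlogQ.
by exists t; split.
Qed.

(** With [dQ_le], which bounds the logarithmic derivative at the median by [2 * gphi 0], this rules
    out minimisers to the left of 0. *)
Lemma dQ_neg q d r : 0 < q -> q < 1 -> 0 < d -> r <= 0 ->
  2 * gphi 0 * Qfun q d r < dQ q d r.
Proof.
move=> q0 q1 d0 r0; rewrite /Qfun /dQ mulrDr ler_ltD//.
  by rewrite mulrCA ler_pM2l// mills_zero.
by rewrite mulrCA ltr_pM2l ?subr_gt0// lt_mills_zero; lra.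
Qed.

Lemma dQ_le q d x : 0 < q -> q < 1 -> dQ q d x <= gphi 0.
Proof.
move=> q0 q1; have := le_gphi0 x; have := le_gphi0 (x - d).
by rewrite /dQ; move: q0 q1; clear; nra.
Qed.

(** * The heavier weight, to the left of its median [ys] *)

Section heavy_weight.
Variables (q d ys : R).
Hypotheses (q0 : 2^-1 <= q) (q1 : q < 1) (d0 : 0 < d) (ysQ : Qfun q d ys = 2^-1).

Let q_gt0 : 0 < q. Proof. by apply: lt_le_trans q0; rewrite invr_gt0. Qed.

Lemma half_root_gt0 : 0 < ys.
Proof.
rewrite ltNge -(le_Qfun d q_gt0 q1) ysQ -ltNge /Qfun Phi0 sub0r.
have h : Phi (- d) < 2^-1 by rewrite -Phi0 Phi_lt_mono oppr_lt0.
have : 0 < (1 - q) * (2^-1 - Phi (- d)) by rewrite mulr_gt0// subr_gt0.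
lra.
Qed.

Lemma half_root_le : ys <= d / 2.
Proof.
rewrite -(le_Qfun d q_gt0 q1) ysQ /Qfun (_ : d / 2 - d = - (d / 2)); last by field.
rewrite PhiN; have h : Phi 0 < Phi (d / 2) by rewrite Phi_lt_mono divr_gt0.
rewrite Phi0 in h.
have : 0 <= (q - 2^-1) * (Phi (d / 2) - 2^-1) by apply: mulr_ge0; rewrite subr_ge0// ltW.
lra.
Qed.

Let A s := q * gphi s.
Let B s := (1 - q) * gphi (s - d).
(** The posterior weight of the centre [d] at [s], a logistic function; it expresses the derivative
    of [A + B] as [(A s + B s) * (d * sg s - s)]. *)
Let sg s := B s / (A s + B s).

Let A0 s : 0 < A s. Proof. by rewrite mulr_gt0 ?q_gt0 ?gphi_gt0. Qed.
Let B0 s : 0 < B s. Proof. by rewrite mulr_gt0 ?gphi_gt0// subr_gt0. Qed.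

Let is_derive_A s : is_derive s 1 A (- s * A s).
Proof. by rewrite /A; apply: is_derive_eq; rewrite /GRing.scale/=; ring. Qed.

Let is_derive_B s : is_derive s 1 B (- (s - d) * B s).
Proof.
have h : is_derive s 1 B ((1 - q) *: (- (s - d) * gphi (s - d))).
  exact: (@is_deriveZ _ _ _ (fun x => gphi (x - d)) (1 - q) s 1 _ (is_derive_gphi_shift d s)).
apply: is_derive_eq h _.
by rewrite /GRing.scale/= /B; ring.
Qed.

Let is_derive_sg s : is_derive s 1 sg (d * (sg s * (1 - sg s))).
Proof.
have AB0 : A s + B s != 0 by rewrite gt_eqF// addr_gt0.
have dA := is_derive_A s; have dB := is_derive_B s.
rewrite /sg; apply: is_derive_eq; rewrite /GRing.scale/= /sg.
by field.
Qed.

Let sg_half s : s <= d / 2 -> sg s <= 2^-1.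
Proof.
move=> sd; rewrite ler_pdivrMr ?addr_gt0//.
suff : B s <= A s by lra.
apply: (@le_trans _ _ (q * gphi (s - d))).
  by rewrite ler_wpM2r ?(ltW (gphi_gt0 _))//; move: q0; lra.
rewrite ler_pM2l ?q_gt0//; apply: le_gphi; rewrite -subr_ge0.
rewrite (_ : _ - _ = d * (d - 2 * s)); last by ring.
by rewrite mulr_ge0 ?(ltW d0)//; move: sd; lra.
Qed.

Let sg_ge0 s : 0 <= sg s. Proof. by rewrite divr_ge0 ?addr_ge0 ?ltW. Qed.

Let le_sg s t : s <= t -> t <= d / 2 -> sg s <= sg t.
Proof.
move=> st td; apply: (is_derive_le st (fun x _ => is_derive_sg x)) => x /andP[_ xt].
have h : sg x <= 2^-1 by apply: sg_half; lra.
apply: mulr_ge0; first exact: ltW.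
by apply: mulr_ge0; [exact: sg_ge0|lra].
Qed.

(** The value of the logarithmic derivative at [ys], where [Qfun] is one half. The sign of [G] is
    that of the derivative of [dQ q d s - lam * Qfun q d s]. *)
Let lam := 2 * dQ q d ys.
Let G s := d * sg s - s - lam.
Let dG s := d * (d * (sg s * (1 - sg s))) - 1.

Let is_derive_G s : is_derive s 1 G (dG s).
Proof.
have ds := is_derive_sg s.
by rewrite /G /dG; apply: is_derive_eq; rewrite /GRing.scale/=; ring.
Qed.

Let le_dG s t : s <= t -> t <= d / 2 -> dG s <= dG t.
Proof.
move=> st td; rewrite lerD2r !ler_pM2l//.
have := le_sg st td; have := sg_half (le_trans st td); have := sg_half td.
move: (sg s) (sg t) => u v v2 u2 uv.
have : 0 <= (v - u) * (1 - v - u) by apply: mulr_ge0; lra.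
lra.
Qed.

(** It suffices that the mixture density does not increase at its median. There the excess masses
    [Phi - 2^-1] at [ys] and [d - ys] balance with their weights, and [mul_gphi_ratio] applies
    because [ys <= d - ys]. *)
Let G_root : G ys < 0.
Proof.
have ys0 := half_root_gt0; have ysd := half_root_le.
have rat := mul_gphi_ratio ys0 (v := d - ys) _.
have bal : q * (Phi ys - 2^-1) = (1 - q) * (Phi (d - ys) - 2^-1).
  have := ysQ; rewrite /Qfun (_ : ys - d = - (d - ys)) ?PhiN; last by ring.
  by lra.
have F0 : 0 < Phi ys - 2^-1 by rewrite subr_gt0 -Phi0 Phi_lt_mono.
have key : (1 - q) * ((d - ys) * gphi (d - ys)) <= q * (ys * gphi ys).
  have {}rat : (d - ys) * gphi (d - ys) * (Phi ys - 2^-1) <=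
    ys * gphi ys * (Phi (d - ys) - 2^-1) by apply: rat; move: ysd; lra.
  rewrite -(ler_pM2r F0) -mulrA; apply: (le_trans (ler_wpM2l _ rat)).
    by rewrite subr_ge0 ltW.
  by rewrite mulrCA -bal mulrCA mulrA.
have AB0 : 0 < A ys + B ys by rewrite addr_gt0.
have E : (d * sg ys - ys) * (A ys + B ys) =
    (1 - q) * ((d - ys) * gphi (d - ys)) - q * (ys * gphi ys).
  have sE : sg ys * (A ys + B ys) = B ys by rewrite /sg divfK// gt_eqF.
  rewrite mulrBl -mulrA sE.
  by rewrite /A /B (_ : ys - d = - (d - ys)) ?gphiN; ring.
have : d * sg ys - ys <= 0 by rewrite -(pmulr_lle0 _ AB0) E subr_le0.
have : 0 < lam by rewrite mulr_gt0// dQ_gt0// q_gt0.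
by rewrite /G; lra.
Qed.

(** A convex function that is nonpositive at [s] and at [ys] is so in between; the slopes on both
    sides of [z] are compared through [le_dG]. *)
Let G_le s z : s <= z -> z <= ys -> G s <= 0 -> G z <= 0.
Proof.
move=> sz zy Gs; rewrite leNgt; apply/negP => Gz.
have G0 := G_root; have ysd := half_root_le.
have sz' : s < z.
  by rewrite lt_neqAle sz andbT; apply/negP => /eqP E; move: Gz; rewrite -E ltNge Gs.
have zy' : z < ys.
  rewrite lt_neqAle zy andbT; apply/negP => /eqP E; move: G0.
  by rewrite -E ltNge ltW.
have [c1 [sc1 c1z E1]] := is_derive_mvt sz' (fun x _ => is_derive_G x).
have [c2 [zc2 c2y E2]] := is_derive_mvt zy' (fun x _ => is_derive_G x).
have c12 : dG c1 <= dG c2 by apply: le_dG; [exact: ltW (lt_trans c1z zc2)|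
  exact: le_trans (ltW c2y) ysd].
have : 0 < dG c1.
  by rewrite -(pmulr_lgt0 _ (_ : 0 < z - s)) ?subr_gt0// -E1 subr_gt0 (le_lt_trans Gs).
have : dG c2 < 0.
  by rewrite -(pmulr_llt0 _ (_ : 0 < ys - z)) ?subr_gt0// -E2 subr_lt0 (lt_trans G0).
by move: c12; lra.
Qed.

Let G_lt s z : s < z -> z <= ys -> G s <= 0 -> G z < 0.
Proof.
move=> sz zy Gs; rewrite lt_neqAle (G_le (ltW sz) zy Gs) andbT; apply/negP => /eqP Gz.
have G0 := G_root; have ysd := half_root_le.
have zy' : z < ys.
  by rewrite lt_neqAle zy andbT; apply/negP => /eqP E; move: G0; rewrite -E Gz ltxx.
have [c1 [sc1 c1z E1]] := is_derive_mvt sz (fun x _ => is_derive_G x).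
have [c2 [zc2 c2y E2]] := is_derive_mvt zy' (fun x _ => is_derive_G x).
have c12 : dG c1 <= dG c2 by apply: le_dG; [exact: ltW (lt_trans c1z zc2)|
  exact: le_trans (ltW c2y) ysd].
have : 0 <= dG c1.
  by rewrite -(pmulr_lge0 _ (_ : 0 < z - s)) ?subr_gt0// -E1 Gz sub0r oppr_ge0.
have : dG c2 < 0.
  by rewrite -(pmulr_llt0 _ (_ : 0 < ys - z)) ?subr_gt0// -E2 Gz subr0.
by move: c12; lra.
Qed.

Let H s := dQ q d s - lam * Qfun q d s.

Let is_derive_H s : is_derive s 1 H ((A s + B s) * G s).
Proof.
have dq := is_derive_Qfun q d s; have dA := is_derive_A s; have dB := is_derive_B s.
have AB0 : A s + B s != 0 by rewrite gt_eqF// addr_gt0.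
rewrite (_ : H = fun s => A s + B s - lam * Qfun q d s)//.
apply: is_derive_eq; rewrite /GRing.scale/= /G /sg -/(A s) -/(B s).
rewrite (_ : dQ q d s = A s + B s)//.
by field.
Qed.

(* [G] is convex up to [d / 2] and negative at [ys], so [H], which is positive near
   [-oo] and vanishes at [ys], first increases and then decreases. *)
Lemma heavy_weight_min s : s < ys -> 2 * dQ q d ys * Qfun q d s < dQ q d s.
Proof.
move=> sy; rewrite -subr_gt0 -/lam -/(H s).
have Hys : H ys = 0 by rewrite /H ysQ /lam mulrAC divff ?mul1r ?subrr.
have [Gs|Gs] := leP (G s) 0.
  rewrite -oppr_lt0 -[X in _ < X]oppr0 -Hys.
  apply: (@is_derive_lt _ (fun x => - H x) (fun x => - ((A x + B x) * G x)) _ _ sy).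
    by move=> x _; have dh := is_derive_H x; apply: is_derive_eq.
  move=> x /andP[sx xy]; rewrite oppr_gt0 pmulr_rlt0 ?addr_gt0//.
  by apply: G_lt Gs => //; exact: ltW.
(* To the left of [- lam] both components of [H] are positive by [gphi_Phi_gt0] with [k = - lam],
   which replaces a limit at [-oo]. *)
pose s0 := Num.min s (- lam).
have s0s : s0 <= s by rewrite ge_min lexx.
have s0l : s0 <= - lam by rewrite ge_min lexx orbT.
apply: (@lt_le_trans _ _ (H s0)).
  have h1 := gphi_Phi_gt0 s0l.
  have s0d : s0 - d <= - lam by move: s0l d0; lra.
  have h2 := gphi_Phi_gt0 s0d.
  rewrite (_ : H s0 = q * (gphi s0 + - lam * Phi s0) +
    (1 - q) * (gphi (s0 - d) + - lam * Phi (s0 - d))).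
    by rewrite addr_gt0// mulr_gt0 ?q_gt0// subr_gt0.
  by rewrite /H /dQ /Qfun; ring.
apply: (is_derive_le s0s (fun x _ => is_derive_H x)) => x /andP[_ xs].
apply: mulr_ge0; first by apply: addr_ge0; exact: ltW.
rewrite leNgt; apply/negP => Gx.
by have := G_le (ltW xs) (ltW sy) (ltW Gx); rewrite leNgt Gs.
Qed.

End heavy_weight.

End line_optimisation.

(** * Minimisation of the content bound at a given measure *)

Section level_lines.
Context {R : realType}.
Implicit Types (x y s t d p r : R).

(* The tangent functional [gphi + x Phi] increases up to [x] and decreases
   afterwards, so spreading the two points apart along a level line lowers it. *)
Lemma level_line_end p d x y : 0 < p -> p < 1 -> y <= x -> x - y <= d ->
  exists t, [/\ Qfun p d t = p * Phi x + (1 - p) * Phi y,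
    dQ p d t <= p * gphi x + (1 - p) * gphi y &
    dQ p d t = p * gphi x + (1 - p) * gphi y -> t = x /\ y = x - d].
Proof.
move=> p0 p1 yx xyd; set V := p * Phi x + _; have q0 : 0 < 1 - p by rewrite subr_gt0.
have xyd' : x <= y + d by move: xyd; clear; lra.
have QxV : Qfun p d x <= V.
  by rewrite /Qfun /V lerD2l ler_pM2l// Phi_mono; move: xyd; clear; lra.
have VQy : V <= Qfun p d (y + d).
  by rewrite /Qfun /V addrK lerD2r ler_pM2l// Phi_mono.
have [||t] := @IVT R (Qfun p d) x (y + d) V xyd'.
- apply: continuous_subspaceT => z.
  exact: is_derive_continuous (is_derive_Qfun p d z).
- by rewrite ge_min QxV/= le_max VQy orbT.
rewrite in_itv/= => /andP[xt ty] QtV; exists t; split => //.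
  (* Both points are tested with the slope [x]; the multiples of [x] then cancel because the measure
     is the same. *)
  have h1 := ge_gphi_Phi xt (lexx x).
  have h2 : gphi (t - d) + x * Phi (t - d) <= gphi y + x * Phi y.
    by apply: le_gphi_Phi => //; move: ty; clear; lra.
  have := lerD (ler_wpM2l (ltW p0) h1) (ler_wpM2l (ltW q0) h2).
  by move: (f_equal ( *%R x) QtV); rewrite /dQ /Qfun /V; clear; lra.
move=> E; have tx : t = x.
  apply/eqP; rewrite eq_le xt andbT leNgt; apply/negP => {}xt.
  have h1 := gt_gphi_Phi xt (lexx x).
  have h2 : gphi (t - d) + x * Phi (t - d) <= gphi y + x * Phi y.
    by apply: le_gphi_Phi => //; move: ty; clear; lra.
  rewrite -(ltr_pM2l p0) in h1; have := ltr_leD h1 (ler_wpM2l (ltW q0) h2).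
  by move: E (f_equal ( *%R x) QtV); rewrite /dQ /Qfun /V; clear; lra.
split => //; move: QtV; rewrite tx /Qfun /V => /addrI /(mulfI (lt0r_neq0 q0)).
by move=> /Phi_inj.
Qed.

(** The sign of [x - y] decides which end of the level line is reached. For [y <= x] it is a point
    [t <= rs] of the lighter weight, for [x <= y] a point [s <= d - rs] of the heavier one. *)
Theorem mixture_profile_min p d rs r0 x y : 0 < p -> p <= 2^-1 -> 0 < d ->
  0 < rs -> Qfun p d rs = 2^-1 -> minimizers (dlogQ p d) rs r0 -> `|x - y| <= d ->
  p * Phi x + (1 - p) * Phi y <= 2^-1 ->
  dlogQ p d r0 * (p * Phi x + (1 - p) * Phi y) <= p * gphi x + (1 - p) * gphi y /\
  (dlogQ p d r0 * (p * Phi x + (1 - p) * Phi y) = p * gphi x + (1 - p) * gphi y ->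
    y = x - d /\ minimizers (dlogQ p d) rs x \/
    y = x + d /\ minimizers (dlogQ p d) rs (- x)).
Proof.
move=> p0 p12 d0 rs0 Qrs [r0I r0min] xyd.
have p1 : p < 1 by move: p12; clear; lra.
set V := _ + _ * Phi y; set J := _ + _ * gphi y => V12; set h := dlogQ p d r0.
have V0 : 0 < V by rewrite addr_gt0// mulr_gt0 ?Phi_gt0// subr_gt0.
have dlogQ_Q t : dQ p d t = dlogQ p d t * Qfun p d t.
  by rewrite dlogQE// divfK// gt_eqF// Qfun_gt0.
have hrs : h <= dlogQ p d rs by apply: r0min; rewrite in_itv/= ltW/=.
have rsE : dQ p d rs = dlogQ p d rs / 2 by rewrite dlogQ_Q Qrs.
have minE t : 0 <= t -> t <= rs -> dlogQ p d t = h -> minimizers (dlogQ p d) rs t.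
  by move=> t0 trs th; split; [rewrite in_itv/= t0|rewrite th].
have {}r0min t : 0 <= t -> t <= rs -> h <= dlogQ p d t.
  by move=> t0 trs; apply: r0min; rewrite in_itv/= t0.
have VE : p * Phi x + (1 - p) * Phi y = V by [].
have JE : p * gphi x + (1 - p) * gphi y = J by [].
clearbody h V J.
have [yx|/ltW xy] := leP y x.
  have xyd' : x - y <= d by move: xyd; rewrite ger0_norm ?subr_ge0.
  have [t [QtV dJ Jeq]] := level_line_end p0 p1 yx xyd'.
  rewrite VE in QtV; rewrite JE in dJ Jeq.
  have trs : t <= rs by rewrite -(le_Qfun d p0 p1) Qrs QtV.
  have [t0|t0] := leP 0 t.
    have ht := r0min t t0 trs.
    have hd : h * V <= dQ p d t by rewrite dlogQ_Q QtV ler_pM2r.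
    split=> [|E]; first exact: le_trans dJ.
    have dE : dQ p d t = J by apply/eqP; rewrite eq_le dJ -E.
    have [tx yE] := Jeq dE; left; split; first by rewrite yE.
    rewrite -tx; apply: (minE t t0 trs).
    by apply: (mulIf (lt0r_neq0 V0)); rewrite E -QtV -dlogQ_Q dE.
  (* A negative [t] is never optimal: the logarithmic derivative exceeds [2 * gphi 0] there, while
     [h] is at most its value at [rs]. *)
  have hd : h * V < dQ p d t.
    apply: le_lt_trans (dQ_neg p0 p1 d0 (ltW t0)); rewrite QtV ler_pM2r//.
    by apply: le_trans hrs _; have := dQ_le d rs p0 p1; rewrite rsE; clear; lra.
  split=> [|E]; first by rewrite (le_trans (ltW hd)).
  by have := lt_le_trans hd dJ; rewrite E ltxx.
have q0 : 0 < 1 - p by rewrite subr_gt0.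
have q1 : 1 - p < 1 by rewrite gtrBl.
have xyd' : y - x <= d by move: xyd; rewrite distrC ger0_norm ?subr_ge0.
have [s [QsV dJ Jeq]] := level_line_end q0 q1 xy xyd'.
rewrite subKr [_ + p * _]addrC VE in QsV; rewrite subKr [_ + p * _]addrC JE in dJ Jeq.
have Qys : Qfun (1 - p) d (d - rs) = 2^-1 by rewrite Qfun_refl Qrs; clear; lra.
have : s <= d - rs by rewrite -(le_Qfun d q0 q1) Qys QsV.
(* The tie occurs at the median of the heavier weight, where by reflection the value equals that of
   the lighter weight at [rs]; equality thus makes [rs] itself a minimiser. Strictly below the
   median, [heavy_weight_min] is strict. *)
rewrite le_eqVlt => /orP[/eqP sE|sys].
  have V12' : V = 2^-1 by rewrite -QsV sE.
  have dE : dQ (1 - p) d s = dlogQ p d rs / 2 by rewrite sE dQ_refl rsE.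
  rewrite V12'; split=> [|E].
    by rewrite (le_trans _ dJ)// dE ler_pM2r// invr_gt0.
  have hE : h = dlogQ p d rs.
    apply/eqP; rewrite eq_le hrs/=; have := dJ; rewrite dE -E.
    by rewrite ler_pM2r// invr_gt0.
  have [sy xE] := Jeq (etrans dE (etrans (f_equal (fun u => u / 2) (esym hE)) E)).
  right; split; first by rewrite xE; ring.
  have -> : - x = rs by move: xE sy sE; clear; lra.
  by apply: (minE rs (ltW rs0) (lexx rs)).
have q12 : 2^-1 <= 1 - p by move: p12; clear; lra.
have := heavy_weight_min q12 q1 d0 Qys sys.
rewrite dQ_refl QsV rsE [2 * _]mulrC divfK// => hs.
have hd : h * V < dQ (1 - p) d s by apply: le_lt_trans hs; rewrite ler_pM2r.
split=> [|E]; first exact: le_trans (ltW hd) dJ.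
by have := lt_le_trans hd dJ; rewrite E ltxx.
Qed.

End level_lines.

(** * Minkowski contents and Cheeger sets *)

Section lower_limit.
Context {R : realType}.
Implicit Types (f : R -> \bar R) (g : R -> R) (l e : R).

Lemma limf_einf_at_right_ge f l :
  (forall d, 0 < d -> \forall e \near 0^'+, ((l - d)%:E <= f e)%E) ->
  (l%:E <= limf_einf f 0^'+)%E.
Proof.
move=> H; rewrite limf_einfE; apply/lee_addgt0Pr => d d0.
rewrite -leeBlDr//; apply: le_trans (ereal_sup_ubound _); last first.
  by exists [set e | ((l - d)%:E <= f e)%E]; [exact: H|reflexivity].
by apply: le_ereal_inf_tmp => _ [e /= he <-].
Qed.

Lemma limf_einf_at_right_le f l :
  (forall d, 0 < d -> \forall e \near 0^'+, (f e <= (l + d)%:E)%E) ->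
  (limf_einf f 0^'+ <= l%:E)%E.
Proof.
move=> H; rewrite limf_einfE; apply: ge_ereal_sup => _ [V FV <-].
apply/lee_addgt0Pr => d d0; rewrite -EFinD.
have [e [Ve fe]] : exists e, V e /\ (f e <= (l + d)%:E)%E.
  by apply: (@filter_ex _ (0 : R)^'+); apply: filterI => //; exact: H.
by apply: le_trans fe; apply: ereal_inf_lbound; exists e.
Qed.

Lemma is_derive_at_right g (x l d : R) : is_derive x (1 : R) g l -> 0 < d ->
  \forall e \near (0 : R)^'+, `|(g (x + e) - g x) / e - l| < d.
Proof.
move=> [dg <-] d0.
have /cvgr_distC_lt/(_ d d0) := (dg : cvg _).
rewrite -/(derive g x 1).
move=> /nbhs_ballP[r /= r0 br]; near=> e.
have e0 : 0 < e by near: e; exact: nbhs_right_gt.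
have := br e; rewrite /ball/= sub0r normrN gtr0_norm//.
have er : e < r by near: e; exact: nbhs_right_lt.
move=> /(_ er); rewrite gt_eqF// => /(_ isT).
rewrite /GRing.scale/= mulr1 addrC.
by rewrite addrC mulrC [e + x]addrC.
Unshelve. all: by end_near. Qed.

End lower_limit.

Section halfspace_neighbourhood.
Context {R : realType} {n : nat}.
Implicit Types (nu : 'rV[R]_n) (c e : R).

Lemma halfspace_lt_nonempty c nu : enorm nu = 1 -> halfspace_lt c nu !=set0.
Proof.
move=> nu1; exists ((c - 1) *: nu).
by rewrite /halfspace_lt/= dotrZl -sqr_enorm nu1 expr1n mulr1 gtrBl.
Qed.

Lemma nbhd_halfspace_lt c nu e : enorm nu = 1 -> 0 < e ->
  nbhd_set (halfspace_lt c nu) e = halfspace_lt (c + e) nu.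
Proof.
move=> nu1 e0; have H0 := halfspace_lt_nonempty c nu1.
have nu2 : dotr nu nu = 1 by rewrite -sqr_enorm nu1 expr1n.
rewrite nbhd_setE//; apply/seteqP; split => x /=.
  move=> /(rdist_lt H0)[y]; rewrite /halfspace_lt/= => yc xye.
  have := cauchy_schwarz (x - y) nu; rewrite dotrBl nu1 mulr1.
  by move: yc xye; clear; lra.
rewrite /halfspace_lt/= => xce.
have [xc|cx] := ltP (dotr x nu) c; first by rewrite rdist_eq0.
(* Moving back along [nu] by any amount strictly between [dotr x nu - c] and [e] reaches the
   half-space; the midpoint is taken. *)
pose t := (dotr x nu - c + e) / 2.
have t0 : 0 <= t by rewrite /t; move: cx e0; clear; lra.
apply: (@le_lt_trans _ _ (enorm (x - (x - t *: nu)))).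
  apply: rdist_le; rewrite /halfspace_lt/= dotrBl dotrZl nu2 mulr1 /t.
  by move: xce; clear; lra.
rewrite subKr enormZ nu1 mulr1 ger0_norm// /t.
by move: xce; clear; lra.
Qed.

End halfspace_neighbourhood.

Lemma gaussian_isoperimetry_Phi {R : realType} {n : nat} (a : 'rV[R]_n)
    (A : set (borelRn R n)) (e x : R) : measurable A -> 0 < e ->
  gpr a A = Phi x -> Phi (x + e) <= gpr a (nbhd_set A e).
Proof.
move=> mA e0 E; have := gaussian_isoperimetry (a := a) mA e0.
by rewrite E PhiK; apply; rewrite Phi_gt0 Phi_lt1.
Qed.

Section gaussian_mixture.
Context {R : realType} {n : nat}.
Implicit Types (a b nu : 'rV[R]_n) (p c : R) (A : set (borelRn R n)).
Variable mu : probability (borelRn R n) R.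

Definition is_mixture a b p := forall A, measurable A ->
  mu A = (p * gpr a A + (1 - p) * gpr b A)%:E.

Lemma is_mixtureC a b p : is_mixture a b p -> is_mixture b a (1 - p).
Proof. by move=> M A mA; rewrite (M A mA) subKr; apply: (f_equal EFin); exact: addrC. Qed.

Lemma measurable_EFin_gauss_density a A : measurable_fun A
  ((fun x => (gauss_density (x - a))%:E) : borelRn R n -> \bar R).
Proof.
by apply/measurable_EFinP; apply: measurable_funTS; exact: measurable_gauss_density.
Qed.

Lemma mixture_gauss_density a b p : 0 <= p <= 1 ->
  (forall A, measurable A -> mu A = (\int[lebesgue_Rn n]_(x in A)
    (p * gauss_density (x - a) + (1 - p) * gauss_density (x - b))%:E)%E) ->
  is_mixture a b p.
Proof.
move=> /andP[p0 p1] H A mA; apply: etrans (H A mA) _.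
have g0 (c x : 'rV[R]_n) : (0 <= (gauss_density (x - c))%:E)%E.
  by rewrite lee_fin ltW// gauss_density_gt0.
have q0 : 0 <= 1 - p by rewrite subr_ge0.
have Z (c : 'rV[R]_n) (r : R) : 0 <= r -> (\int[lebesgue_Rn n]_(x in A)
    (r%:E * (gauss_density (x - c))%:E) = r%:E * (gpr c A)%:E)%E.
  by move=> r0; rewrite EFin_gpr// ge0_integralZl//; exact: measurable_EFin_gauss_density.
apply: etrans (f_equal2 adde (Z a p p0) (Z b (1 - p) q0)).
under eq_integral do rewrite EFinD !EFinM.
apply: ge0_integralD => //.
- by move=> x _; apply: mule_ge0; [rewrite lee_fin|exact: g0].
- by apply: measurable_funeM; exact: measurable_EFin_gauss_density.
- by move=> x _; apply: mule_ge0; [rewrite lee_fin|exact: g0].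
- by apply: measurable_funeM; exact: measurable_EFin_gauss_density.
Qed.

Section fixed_mixture.
Variables (a b : 'rV[R]_n) (p : R).
Hypotheses (p0 : 0 < p) (p1 : p < 1) (M : is_mixture a b p).

Lemma mixture_eq0 A : measurable A -> mu A = 0%E <-> lebesgue_Rn n A = 0%E.
Proof.
move=> mA; have /andP[a0 _] := gpr01 a mA; have /andP[b0 _] := gpr01 b mA.
have q0 : 0 < 1 - p by rewrite subr_gt0.
split=> [S0|A0].
  have {}S0 := EFin_inj (etrans (esym (M mA)) S0); apply/(gpr_eq0 a mA)/eqP.
  have qb := mulr_ge0 (ltW q0) b0.
  by rewrite eq_le a0 andbT -(pmulr_rle0 _ p0) -S0 lerDl.
by rewrite (M mA) ((gpr_eq0 a mA).2 A0) ((gpr_eq0 b mA).2 A0) !mulr0 addr0.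
Qed.

(** All the measures involved share their null sets; this is what makes [iPhi] meaningful at both
    centres. *)
Lemma admissible_gpr A : admissible mu A -> 0 < gpr a A < 1 /\ 0 < gpr b A < 1.
Proof.
move=> [mA muA0 muA1].
have mC : measurable (~` A) by exact: measurableC.
have LA : lebesgue_Rn n A <> 0%E.
  by move=> /(mixture_eq0 mA).2 A0; rewrite A0 ltxx in muA0.
have LC : lebesgue_Rn n (~` A) <> 0%E.
  move=> /(mixture_eq0 mC).2 A0; have {}A0 := EFin_inj (etrans (esym (M mC)) A0).
  have P1 : p * gpr a A + (1 - p) * gpr b A < 1 by rewrite -lte_fin -(M mA).
  rewrite (gprC a mA) (gprC b mA) in A0.
  move: (gpr a A) (gpr b A) P1 A0 => u v P1 A0; clear LA muA0 muA1; lra.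
suff in01 (c : 'rV[R]_n) : 0 < gpr c A < 1 by [].
have /andP[c0 c1] := gpr01 c mA; rewrite !lt_neqAle c0 c1 !andbT.
apply/andP; split; apply/negP => /eqP E; first by apply/LA/(gpr_eq0 c mA).
by apply/LC/(gpr_eq0 c mC); rewrite gprC// E subrr.
Qed.

Lemma mixture_nbhd A e : measurable A -> A !=set0 -> 0 < e ->
  mu (nbhd_set A e `\` A) = (p * (gpr a (nbhd_set A e) - gpr a A) +
    (1 - p) * (gpr b (nbhd_set A e) - gpr b A))%:E.
Proof.
move=> mA A0 e0; have mN := measurable_nbhd_set e A0.
have AN : A `<=` nbhd_set A e by exact: sub_nbhd_set.
by rewrite M ?gprD//; exact: measurableD.
Qed.

Let gain (x y e : R) := p * Phi (x + e) + (1 - p) * Phi (y + e).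

Let is_derive_gain x y :
  is_derive (0 : R) (1 : R) (gain x y) (p * gphi x + (1 - p) * gphi y).
Proof.
have dP (z : R) : is_derive (0 : R) 1 (fun e => Phi (z + e)) (gphi z).
  have d1 : is_derive (0 : R) 1 (fun e : R => z + e) 1.
    by apply: is_derive_eq; rewrite add0r mulr1.
  have d2 : is_derive (z + 0) (1 : R) Phi (gphi z) by rewrite addr0; exact: is_derive_Phi.
  by apply: is_derive_eq (@is_derive1_comp R Phi (fun e => z + e) 0 _ _ d2 d1) _; rewrite mulr1.
have dx := dP x; have dy := dP y; rewrite /gain.
by apply: is_derive_eq; rewrite /GRing.scale/=; ring.
Qed.

Let gain_ratio x y d : 0 < d -> \forall e \near (0 : R)^'+,
  `|(gain x y e - (p * Phi x + (1 - p) * Phi y)) / e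
    - (p * gphi x + (1 - p) * gphi y)| < d.
Proof.
move=> d0; have := is_derive_at_right (is_derive_gain x y) d0.
by apply: filterS => e; rewrite add0r {2}/gain !addr0.
Qed.

(** Isoperimetry at each centre separately bounds the measure of the neighbourhood below by
    [gain x y e], whose derivative at 0 is the claimed bound. *)
Lemma minkowski_content_ge A x y : admissible mu A ->
  gpr a A = Phi x -> gpr b A = Phi y ->
  ((p * gphi x + (1 - p) * gphi y)%:E <= minkowski_content mu A)%E.
Proof.
move=> [mA muA0 _] ga gb.
have A0 : A !=set0.
  by apply/set0P/negP => /eqP E; move: muA0; rewrite E measure0 ltxx.
apply: limf_einf_at_right_ge => d d0; have := gain_ratio x y d0.
apply: filterS2 (nbhs_right_gt (0 : R)) => e e0 he.
rewrite (mixture_nbhd mA A0 e0) inver (gt_eqF e0) -EFinM lee_fin.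
have ia := gaussian_isoperimetry_Phi mA e0 ga.
have ib := gaussian_isoperimetry_Phi mA e0 gb.
rewrite ga gb; move: ia ib.
move: (gpr a (nbhd_set A e)) (gpr b (nbhd_set A e)) => u' v' ia ib.
have q0 : 0 <= 1 - p by rewrite subr_ge0 ltW.
have h2 := lerD (ler_wpM2l (ltW p0) ia) (ler_wpM2l q0 ib).
rewrite ler_pdivlMr//.
move: he; rewrite ltr_norml => /andP[+ _].
rewrite ltrBrDr ltr_pdivlMr// => h1.
rewrite [X in X * e]addrC; apply: le_trans (ltW h1) _.
rewrite (_ : p * (u' - _) + _ = p * u' + (1 - p) * v' - (p * Phi x + (1 - p) * Phi y)).
  by rewrite lerD2r.
by ring.
Qed.

(** The neighbourhood of a half-space is a translate of it, so [gain] is exact and the lower limit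
    is a limit. *)
Lemma minkowski_content_halfspace_lt nu c : enorm nu = 1 ->
  minkowski_content mu (halfspace_lt c nu) =
  (p * gphi (c - dotr a nu) + (1 - p) * gphi (c - dotr b nu))%:E.
Proof.
move=> nu1; have mH := measurable_halfspace_lt c nu.
have H0 := halfspace_lt_nonempty c nu1.
have near_eq d : 0 < d -> \forall e \near (0 : R)^'+,
    exists2 v, (mu (nbhd_set (halfspace_lt c nu) e `\` halfspace_lt c nu) / e%:E)%E = v%:E &
      `|v - (p * gphi (c - dotr a nu) + (1 - p) * gphi (c - dotr b nu))| < d.
  move=> d0.
  have := gain_ratio (c - dotr a nu) (c - dotr b nu) d0.
  apply: filterS2 (nbhs_right_gt (0 : R)) => e e0 he.
  rewrite (mixture_nbhd mH H0 e0) inver (gt_eqF e0) -EFinM.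
  rewrite (nbhd_halfspace_lt c nu1 e0) !gpr_halfspace_lt//; eexists; first reflexivity.
  rewrite (_ : p * (_ - _) + _ = gain (c - dotr a nu) (c - dotr b nu) e -
    (p * Phi (c - dotr a nu) + (1 - p) * Phi (c - dotr b nu))); first exact: he.
  by rewrite /gain !(addrAC c e); ring.
apply/eqP; rewrite eq_le; apply/andP; split.
  apply: limf_einf_at_right_le => d d0; have := near_eq d d0.
  apply: filterS => e [v -> ]; rewrite ltr_norml lee_fin => /andP[_].
  by lra.
apply: limf_einf_at_right_ge => d d0; have := near_eq d d0.
apply: filterS => e [v -> ]; rewrite ltr_norml lee_fin => /andP[+ _].
by lra.
Qed.

End fixed_mixture.

End gaussian_mixture.

Section cheeger_line.
Context {R : realType}.
Implicit Types (x y p d r : R).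

(** Measures above one half are reduced to the complement: negating [x] and [y] keeps [J], turns [P]
    into [1 - P] and exchanges the two equality cases. *)
Lemma cheeger_line p d rs r0 x y : 0 < p -> p <= 2^-1 -> 0 < d ->
  0 < rs -> Qfun p d rs = 2^-1 -> minimizers (dlogQ p d) rs r0 -> `|x - y| <= d ->
  let P := p * Phi x + (1 - p) * Phi y in
  let J := p * gphi x + (1 - p) * gphi y in
  dlogQ p d r0 * Num.min P (1 - P) <= J /\
  (dlogQ p d r0 * Num.min P (1 - P) = J ->
    y = x - d /\ minimizers (dlogQ p d) rs x \/
    y = x + d /\ minimizers (dlogQ p d) rs (- x)).
Proof.
move=> p0 p12 d0 rs0 Qrs Or0 xyd P J.
have [P12|P12] := leP P 2^-1.
  rewrite (min_idPl _); first exact: mixture_profile_min.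
  by move: (P) P12; clear => ? ?; lra.
rewrite (min_idPr _); last by move: (P) P12; clear => ? ?; lra.
have xyd' : `|- x - - y| <= d by rewrite -opprD normrN.
have PN : p * Phi (- x) + (1 - p) * Phi (- y) = 1 - P by rewrite !PhiN /P; ring.
have PN12 : p * Phi (- x) + (1 - p) * Phi (- y) <= 2^-1.
  by rewrite PN; move: (P) P12; clear => ? ?; lra.
have [] := mixture_profile_min p0 p12 d0 rs0 Qrs Or0 xyd' PN12.
rewrite PN !gphiN -/J => h1 h2; split; first exact: h1.
move=> /h2[[yE Ox]|[yE Ox]].
  by right; split; [move: yE; clear; lra|exact: Ox].
by rewrite opprK in Ox; left; split; [move: yE; clear; lra|exact: Ox].
Qed.

End cheeger_line.

(** * Cheeger sets of the mixture *)

Section gaussian_mixture_cheeger.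
Context {R : realType} {n : nat}.
Variable mu : probability (borelRn R n) R.
Implicit Types (A E H S : set (borelRn R n)).

Lemma cheeger_ratio_ge A (P J : R) : mu A = P%:E -> 0 < P < 1 ->
  (J%:E <= minkowski_content mu A)%E ->
  ((J / Num.min P (1 - P))%:E <= cheeger_ratio mu A)%E.
Proof.
move=> muA /andP[P0 P1] JA; rewrite /cheeger_ratio muA -EFinB -EFin_min.
have w0 : 0 < Num.min P (1 - P) by rewrite lt_min P0 subr_gt0.
by rewrite inver (gt_eqF w0) EFinM; apply: lee_wpmul2r; rewrite // lee_fin invr_ge0 ltW.
Qed.

Lemma cheeger_ratioE A (P J : R) : mu A = P%:E -> 0 < P < 1 ->
  minkowski_content mu A = J%:E ->
  cheeger_ratio mu A = (J / Num.min P (1 - P))%:E.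
Proof.
move=> muA /andP[P0 P1] JA; rewrite /cheeger_ratio muA -EFinB -EFin_min JA.
have w0 : 0 < Num.min P (1 - P) by rewrite lt_min P0 subr_gt0.
by rewrite inver (gt_eqF w0) EFinM.
Qed.

Lemma eq_mod0_trans A E H : measurable A -> measurable E -> measurable H ->
  eq_mod0 mu A E -> eq_mod0 mu E H -> eq_mod0 mu A H.
Proof.
move=> mA mE mH AE EH.
have mD (X Y : set (borelRn R n)) : measurable X -> measurable Y -> measurable (X `+` Y).
  by move=> mX mY; apply: measurableU; exact: measurableD.
apply/eqP; rewrite -measure_le0.
apply: (@le_trans _ _ (mu ((A `+` E) `|` (E `+` H)))).
  apply: le_measure; rewrite ?inE; [exact: mD|by apply: measurableU; exact: mD|].
  move=> x [[Ax Hx]|[Hx Ax]]; have [Ex|Ex] := pselect (E x).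
  - by right; left.
  - by left; left.
  - by left; right.
  - by right; right.
have -> : mu ((A `+` E) `|` (E `+` H)) = mu (A `+` E).
  by apply: measureU0; [exact: mD|exact: mD|exact: EH].
by rewrite [mu _]AE.
Qed.

Section light_weight.
Variables (a nu : 'rV[R]_n) (p d rs : R).
Let b := a + d *: nu.
Hypotheses (p0 : 0 < p) (p12 : p <= 2^-1) (d0 : 0 < d) (rs0 : 0 < rs).
Hypotheses (nu1 : enorm nu = 1) (Qrs : Qfun p d rs = 2^-1).
Hypothesis M : is_mixture mu a b p.

Let O := minimizers (dlogQ p d) rs.

Let p1 : p < 1. Proof. by apply: le_lt_trans p12 _; rewrite invf_lt1// ltr1n. Qed.

Let bnu : dotr b nu = dotr a nu + d.
Proof. by rewrite /b dotrDl dotrZl -sqr_enorm nu1 expr1n mulr1. Qed.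

Lemma cheeger_ratio_halfspace t : O t ->
  [/\ admissible mu (halfspace_lt (dotr a nu + t) nu),
      cheeger_ratio mu (halfspace_lt (dotr a nu + t) nu) = (dlogQ p d t)%:E,
      admissible mu (halfspace_gt (dotr a nu + t) nu) &
      cheeger_ratio mu (halfspace_gt (dotr a nu + t) nu) = (dlogQ p d t)%:E].
Proof.
move=> [tI _]; have trs : t <= rs by move: tI; rewrite in_itv/= => /andP[].
have Q0 : 0 < Qfun p d t by exact: Qfun_gt0.
have Q12 : Qfun p d t <= 2^-1 by rewrite -Qrs le_Qfun.
have Q1 : Qfun p d t < 1 by lra.
have minQ : Num.min (Qfun p d t) (1 - Qfun p d t) = Qfun p d t.
  by apply/min_idPl; lra.
have ml := measurable_halfspace_lt (dotr a nu + t) nu.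
have mg := measurable_halfspace_gt (dotr a nu + t) nu.
have mul : mu (halfspace_lt (dotr a nu + t) nu) = (Qfun p d t)%:E.
  rewrite (M ml) !gpr_halfspace_lt// bnu; congr (_ * Phi _ + _ * Phi _)%:E; ring.
have mug : mu (halfspace_gt (dotr a nu + t) nu) = (1 - Qfun p d t)%:E.
  rewrite (M mg) !gpr_halfspace_gt// bnu /Qfun.
  rewrite (_ : dotr a nu - _ = - t); last by ring.
  rewrite (_ : dotr a nu + d - _ = - (t - d)); last by ring.
  by rewrite !PhiN; congr EFin; ring.
have cl : minkowski_content mu (halfspace_lt (dotr a nu + t) nu) = (dQ p d t)%:E.
  rewrite (minkowski_content_halfspace_lt M)// bnu.
  by congr (_ * gphi _ + _ * gphi _)%:E; ring.
have cg : minkowski_content mu (halfspace_gt (dotr a nu + t) nu) = (dQ p d t)%:E.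
  rewrite halfspace_gtE (minkowski_content_halfspace_lt M) ?enormN//.
  rewrite !dotrNr bnu /dQ.
  rewrite (_ : - _ - - dotr a nu = - t); last by ring.
  by rewrite (_ : - _ - - (dotr a nu + d) = - (t - d)) ?gphiN; last by ring.
split.
- by split; rewrite // mul lte_fin.
- by rewrite (cheeger_ratioE mul _ cl) ?Q0// minQ dlogQE.
- by split; rewrite // mug lte_fin; lra.
- rewrite (cheeger_ratioE mug _ cg); last by apply/andP; split; lra.
  by rewrite subKr minC minQ dlogQE.
Qed.

(** Neyman-Pearson from [a] to [b] along [nu] gives [y <= x + d], and from [b] to [a] along [- nu]
    it gives [x <= y + d]. An optimal set attains one of the two, and the equality case identifies
    its half-space. *)
Lemma cheeger_ratio_lb A r : O r -> admissible mu A ->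
  ((dlogQ p d r)%:E <= cheeger_ratio mu A)%E /\
  (cheeger_ratio mu A = (dlogQ p d r)%:E -> exists2 t, O t &
    eq_mod0 mu A (halfspace_lt (dotr a nu + t) nu) \/
    eq_mod0 mu A (halfspace_gt (dotr a nu + t) nu)).
Proof.
move=> Or admA; have [ga gb] := admissible_gpr p0 p1 M admA.
have [mA _ _] := admA.
have [x gaE] : exists x, gpr a A = Phi x by exists (iPhi (gpr a A)); rewrite iPhiK.
have [y gbE] : exists y, gpr b A = Phi y by exists (iPhi (gpr b A)); rewrite iPhiK.
have cA := minkowski_content_ge p0 p1 M admA gaE gbE.
have muAE : mu A = (p * Phi x + (1 - p) * Phi y)%:E.
  exact: etrans (M mA) (f_equal2 (fun u v => (p * u + (1 - p) * v)%:E) gaE gbE).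
have gaE1 : gpr a A = Phi (dotr a nu - (dotr a nu - x)) by rewrite subKr.
have [np1 np1E] := neyman_pearson nu1 d0 mA gaE1.
rewrite subKr in np1 np1E; rewrite [gpr _ A]gbE Phi_mono in np1.
rewrite [gpr _ A]gbE in np1E.
have nuN1 : enorm (- nu) = 1 by rewrite enormN.
have gbE1 : gpr b A = Phi (dotr b (- nu) - (dotr b (- nu) - y)).
  by rewrite subKr.
have [np2 np2E] := neyman_pearson nuN1 d0 mA gbE1.
have abE : b + d *: - nu = a by rewrite /b scalerN addrK.
rewrite subKr abE in np2 np2E; rewrite [gpr _ A]gaE Phi_mono in np2.
rewrite [gpr _ A]gaE in np2E.
have xyd : `|x - y| <= d by rewrite ler_distl lerBlDr np1 np2.
have [] := cheeger_line p0 p12 d0 rs0 Qrs Or xyd.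
set P := p * Phi x + _; set J := _ + (1 - p) * gphi y => hJ hJE.
have P01 : 0 < P < 1.
  by have [_] := admA; rewrite muAE !lte_fin -/P => -> ->.
have w0 : 0 < Num.min P (1 - P).
  by have /andP[P0 P1] := P01; rewrite lt_min P0 subr_gt0.
have rA := cheeger_ratio_ge muAE P01 cA.
have hw : dlogQ p d r <= J / Num.min P (1 - P) by rewrite ler_pdivlMr.
split; first by rewrite (le_trans _ rA)// lee_fin.
move=> rE; rewrite rE lee_fin in rA.
have /hJE : dlogQ p d r * Num.min P (1 - P) = J.
  by apply/eqP; rewrite eq_le hJ/= -ler_pdivrMr.
have null (H : set (borelRn R n)) : measurable H -> lebesgue_Rn n (A `+` H) = 0%E -> eq_mod0 mu A H.
  move=> mH AH; apply/(mixture_eq0 p0 p1 M) => //.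
  by apply: measurableU; exact: measurableD.
move=> [[yE Ox]|[yE Ox]].
  exists x => //; left; apply: null; first exact: measurable_halfspace_lt.
  have := np2E (f_equal Phi (_ : x = y + d)); rewrite halfspace_gtE opprK dotrNr bnu.
  rewrite (_ : - (- (dotr a nu + d) - y) = dotr a nu + x); last by rewrite yE; ring.
  by apply; rewrite yE subrK.
exists (- x) => //; right; apply: null; first exact: measurable_halfspace_gt.
by apply: np1E; rewrite yE.
Qed.

Lemma cheeger_constant_light r : O r -> cheeger_constant mu = (dlogQ p d r)%:E.
Proof.
move=> Or; apply/eqP; rewrite eq_le; apply/andP; split.
  have [adm rE _ _] := cheeger_ratio_halfspace Or.
  by apply: ereal_inf_lbound; exists (halfspace_lt (dotr a nu + r) nu).
by apply: le_ereal_inf_tmp => _ [A admA <-]; have [] := cheeger_ratio_lb Or admA.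
Qed.

Lemma cheeger_set_halfspace t : O t ->
  cheeger_set mu (halfspace_lt (dotr a nu + t) nu) /\
  cheeger_set mu (halfspace_gt (dotr a nu + t) nu).
Proof.
move=> Ot; have [al rl ag rg] := cheeger_ratio_halfspace Ot.
by rewrite /cheeger_set (cheeger_constant_light Ot) rl rg.
Qed.

Lemma cheeger_set_mod0P E : measurable E -> cheeger_set_mod0 mu E <->
  exists2 t, O t & eq_mod0 mu E (halfspace_lt (dotr a nu + t) nu) \/
                   eq_mod0 mu E (halfspace_gt (dotr a nu + t) nu).
Proof.
move=> mE; split=> [[S [admS rS] ES]|[t Ot EH]]; last first.
  have [cl cg] := cheeger_set_halfspace Ot.
  case: EH => EH; [exists (halfspace_lt (dotr a nu + t) nu)|
    exists (halfspace_gt (dotr a nu + t) nu)]; [exact: cl|exact: EH|exact: cg|exact: EH].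
have [r Or] := minimizer_exists d p0 p1 (ltW rs0).
have [_] := cheeger_ratio_lb Or admS; rewrite rS (cheeger_constant_light Or).
have [mS _ _] := admS; move=> /(_ erefl)[t Ot SH]; exists t => //.
case: SH => SH; [left|right]; apply: eq_mod0_trans ES SH => //.
- exact: measurable_halfspace_lt.
- exact: measurable_halfspace_gt.
Qed.

End light_weight.

End gaussian_mixture_cheeger.

(** The minimum is expressed by a minimiser realising [cheeger_constant]. Besides the classification
    up to null sets, each case states that the half-spaces themselves attain the infimum. *)
Theorem theorem1p1 (R : realType) (n : nat) (hn : (1 <= n)%N)
    (a b : 'rV[R]_n) (hab : a != b) (p : R) (hp0 : 0 < p) (hp1 : p < 1)
    (mu : probability (borelRn R n) R)
    (hmu : forall A : set (borelRn R n), measurable A ->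
      mu A = (\int[lebesgue_Rn n]_(x in A)
        (p * gauss_density (x - a) + (1 - p) * gauss_density (x - b))%:E)%E)
    (rs : R) (hrs0 : 0 < rs)
    (hrs : Qfun (Num.min p (1 - p)) (enorm (a - b)) rs = 2^-1) :
  let d := enorm (a - b) in
  let m := Num.min p (1 - p) in
  let nu := (enorm (b - a))^-1 *: (b - a) in
  let O := minimizers (dlogQ m d) rs in
  [/\ (exists2 r, O r & cheeger_constant mu = (dlogQ m d r)%:E),
      p <= 2^-1 ->
        (forall E : set (borelRn R n), measurable E ->
          (cheeger_set_mod0 mu E <->
           exists2 t, O t &
             eq_mod0 mu E (halfspace_lt (dotr a nu + t) nu) \/
             eq_mod0 mu E (halfspace_gt (dotr a nu + t) nu))) /\
        (forall t, O t ->
          cheeger_set mu (halfspace_lt (dotr a nu + t) nu) /\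
          cheeger_set mu (halfspace_gt (dotr a nu + t) nu))
    & 2^-1 < p ->
        (forall E : set (borelRn R n), measurable E ->
          (cheeger_set_mod0 mu E <->
           exists2 t, O t &
             eq_mod0 mu E (halfspace_lt (- dotr b nu + t) (- nu)) \/
             eq_mod0 mu E (halfspace_gt (- dotr b nu + t) (- nu)))) /\
        (forall t, O t ->
          cheeger_set mu (halfspace_lt (- dotr b nu + t) (- nu)) /\
          cheeger_set mu (halfspace_gt (- dotr b nu + t) (- nu)))].
Proof.
move=> d m nu O.
have dab : enorm (b - a) = d by rewrite /d enormB.
have d0 : 0 < d.
  rewrite lt_neqAle enorm_ge0 andbT eq_sym; apply/negP => /eqP/enorm_eq0/eqP.
  by rewrite subr_eq0 (negbTE hab).
have nu1 : enorm nu = 1.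
  by rewrite /nu enormZ dab ger0_norm ?invr_ge0 ?(ltW d0)// mulVf// gt_eqF.
have bE : b = a + d *: nu.
  by rewrite /nu dab scalerA mulfV ?gt_eqF// scale1r addrC subrK.
have aE : a = b + d *: - nu by rewrite scalerN {1}bE addrK.
have p01 : 0 <= p <= 1 by rewrite !ltW.
have M := mixture_gauss_density p01 hmu.
have MC := is_mixtureC M.
have nuN1 : enorm (- nu) = 1 by rewrite enormN.
have bN : - dotr b nu = dotr b (- nu) by rewrite dotrNr.
have q0 : 0 < 1 - p by rewrite subr_gt0.
have Qrs : Qfun m d rs = 2^-1 := hrs.
rewrite bN /O; clear O hrs; clearbody d nu.
have m0 : 0 < m by rewrite lt_min hp0.
have m1 : m < 1 by rewrite gt_min hp1.
have [r Or] := minimizer_exists d m0 m1 (ltW hrs0).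
have [p12|p12] := leP p 2^-1.
  have mp : m = p by apply/min_idPl; move: p12; clear; lra.
  rewrite mp in Or Qrs *; rewrite bE in M.
  split=> //.
  - exists r => //; exact: cheeger_constant_light M _ Or.
  - split=> [E mE|t Ot]; first exact: cheeger_set_mod0P M _ mE.
    exact: cheeger_set_halfspace M _ Ot.
(* The same results are applied with the centres exchanged: weight [1 - p] at [b], and direction
   [- nu] leading from [b] to [a]. *)
have mp : m = 1 - p by apply/min_idPr; move: p12; clear; lra.
have q12 : 1 - p <= 2^-1 by move: p12; clear; lra.
rewrite mp in Or Qrs *; rewrite aE in MC.
split=> //.
- exists r => //; exact: cheeger_constant_light MC _ Or.
- split=> [E mE|t Ot]; first exact: cheeger_set_mod0P MC _ mE.
  exact: cheeger_set_halfspace MC _ Ot.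
Qed.
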